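(* Let $F$ be an algebraically closed field of characteristic zero, let $\lambda=(\lambda_1,\dots,\lambda_n)$ be a composition of $N$ (positive parts) such that either $\lambda_1\ge\cdots\ge\lambda_n$ or $\lambda_1\le\cdots\le\lambda_n$, let $e\in\mathfrak{g}=\mathfrak{gl}_N(F)$ be the nilpotent matrix with Jordan blocks of sizes $\lambda_1,\dots,\lambda_n$ in order down the diagonal, and let $Z(\mathfrak{g}_e)$ be the center of the universal enveloping algebra $U(\mathfrak{g}_e)$ of the centralizer $\mathfrak{g}_e$ of $e$ in $\mathfrak{g}$. Then the elements $z_1,\dots,z_N\in U(\mathfrak{g}_e)$ defined below are algebraically independent generators of $Z(\mathfrak{g}_e)$.
   Context: Let $e_{h,k}$ denote the matrix units of $\mathfrak{gl}_N(F)$. Draw a diagram with rows $1,\dots,n$ (top to bottom) having $\lambda_i$ boxes in row $i$ in columns $1,\dots,\lambda_i$; write $1,\dots,N$ into the boxes along rows (left to right, top row first), and let $\mathrm{row}(h),\mathrm{col}(h)$ be the row and column of the box containing $h$. For $1\le i,j\le n$ and $\lambda_j-\min(\lambda_i,\lambda_j)\le r<\lambda_j$ set $e_{i,j;r}:=\sum e_{h,k}$, the sum over all $1\le h,k\le N$ with $\mathrm{row}(h)=i$, $\mathrm{row}(k)=j$, $\mathrm{col}(k)-\mathrm{col}(h)=r$; these form a basis of $\mathfrak{g}_e$. Set $\tilde e_{i,j;r}:=e_{i,j;r}-\delta_{r,0}\delta_{i,j}(i-1)\lambda_i$. The invariant degrees $(d_1,\dots,d_N)$ are: $d$ consists of $\lambda_1$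 copies of $1$, then $\lambda_2$ copies of $2$, ..., then $\lambda_n$ copies of $n$ if $\lambda_1\ge\cdots\ge\lambda_n$; and of $\lambda_n$ copies of $1$, then $\lambda_{n-1}$ copies of $2$, ..., then $\lambda_1$ copies of $n$ if $\lambda_1\le\cdots\le\lambda_n$. Write $\mu\subseteq\lambda$ if $\mu=(\mu_1,\dots,\mu_n)$ with $0\le\mu_i\le\lambda_i$ for all $i$; $|\mu|=\sum\mu_i$ and $\ell(\mu)$ is the number of nonzero parts. For $0\ne\mu\subseteq\lambda$ with $\ell(\mu)=d_{|\mu|}=:d$, with nonzero parts in positions $i_1<\cdots<i_d$, define $\mathrm{cdet}(\mu):=\sum_{w\in S_d}\mathrm{sgn}(w)\,\tilde e_{i_{w1},i_1;\mu_{i_1}-1}\tilde e_{i_{w2},i_2;\mu_{i_2}-1}\cdots\tilde e_{i_{wd},i_d;\mu_{i_d}-1}$ (all $e_{i,j;r}$ occurring here satisfy $\lambda_j-\min(\lambda_i,\lambda_j)\le r<\lambda_j$). For $r=1,\dots,N$ define $z_r:=\sum_{\mu\subseteq\lambda,\ |\mu|=r,\ \ell(\mu)=d_r}\mathrm{cdet}(\mu)$. *)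

(* Defs.v *)
From HB Require Import structures.
From mathcomp Require Import all_boot all_order all_algebra perm.
From mathcomp Require Import mpoly.
Set Implicit Arguments. Unset Strict Implicit. Unset Printing Implicit Defensive.
Import GRing.Theory.
Local Open Scope ring_scope.

(* For a box numbered h (0-based, 0 <= h < N), [box_rc lam h] = (row, col),
   both 0-based: rows are filled left to right, top row first.           *)
Fixpoint box_rc (lam : seq nat) (h : nat) : nat * nat :=
  match lam with
  | [::] => (0%N, h)
  | a :: l => if (h < a)%N then (0%N, h)
              else let rc := box_rc l (h - a) in (rc.1.+1, rc.2)
  end.
Definition brow (lam : seq nat) h := (box_rc lam h).1.
Definition bcol (lam : seq nat) h := (box_rc lam h).2.

Definition jordan_nil (F : nzRingType) (lam : seq nat) : 'M[F]_(sumn lam) :=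
  \matrix_(h, k) ((brow lam h == brow lam k) && (bcol lam k == (bcol lam h).+1))%:R.

Definition Eijr (F : nzRingType) (lam : seq nat) (i j r : nat) : 'M[F]_(sumn lam) :=
  \matrix_(h, k) [&& brow lam h == i, brow lam k == j
                   & bcol lam k == (bcol lam h + r)%N]%:R.

Definition centralizer (F : nzRingType) (n : nat) (e : 'M[F]_n) : pred 'M[F]_n :=
  fun X => X *m e == e *m X.

Definition is_linear_map (F : nzRingType) (U V : lmodType F) (f : U -> V) :=
  forall (c : F) (x y : U), f (c *: x + y) = c *: f x + f y.

Definition lie_on (F : nzRingType) (n : nat) (A : algType F)
  (P : pred 'M[F]_n) (f : 'M[F]_n -> A) :=
  forall X Y, P X -> P Y -> f (X *m Y - Y *m X) = f X * f Y - f Y * f X.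

Definition is_alg_morph (F : nzRingType) (A B : algType F) (phi : A -> B) :=
  [/\ forall a b, phi (a + b) = phi a + phi b,
      forall a b, phi (a * b) = phi a * phi b,
      phi 1 = 1
    & forall (c : F) a, phi (c *: a) = c *: phi a].

Definition is_UEA (F : nzRingType) (n : nat) (P : pred 'M[F]_n)
  (A : algType F) (iu : 'M[F]_n -> A) :=
  [/\ is_linear_map iu, lie_on P iu &
    forall (B : algType F) (f : 'M[F]_n -> B),
      is_linear_map f -> lie_on P f ->
      (exists phi : A -> B, is_alg_morph phi /\ forall X, P X -> phi (iu X) = f X)
      /\ (forall phi psi : A -> B, is_alg_morph phi -> is_alg_morph psi ->
            (forall X, P X -> phi (iu X) = psi (iu X)) -> forall a, phi a = psi a)].

Definition in_center (F : nzRingType) (A : algType F) (a : A) :=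
  forall b : A, a * b = b * a.

(* d = (d_1,...,d_N) as a sequence; d_r = nth 0 (degseq lam) (r-1).       *)
Definition degseq (lam : seq nat) : seq nat :=
  let n := size lam in
  if sorted geq lam then
    flatten [seq nseq (nth 0%N lam i) i.+1 | i <- iota 0 n]
  else
    flatten [seq nseq (nth 0%N lam (n - k.+1)) k.+1 | k <- iota 0 n].

Fixpoint subcomps (lam : seq nat) : seq (seq nat) :=
  match lam with
  | [::] => [:: [::]]
  | a :: l => flatten [seq [seq x :: s | s <- subcomps l] | x <- iota 0 a.+1]
  end.

Definition ell (mu : seq nat) : nat := count (fun x => x != 0%N) mu.

Section Gens.
Variables (F : nzRingType) (lam : seq nat) (A : algType F)
          (iu : 'M[F]_(sumn lam) -> A).

(* tilde e_{i,j;r} (0-based rows: (i-1) lam_i becomes i * lam_i). *)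
Definition etilde (i j r : nat) : A :=
  iu (Eijr F lam i j r)
  - ((i == j) && (r == 0%N))%:R * (i * nth 0%N lam i)%:R.

Definition cdet (mu : seq nat) : A :=
  let s := [seq i <- iota 0 (size mu) | nth 0%N mu i != 0%N] in
  \sum_(w : 'S_(size s))
     (-1) ^+ (odd_perm w) *:
       \prod_(k < size s)
          etilde (nth 0%N s (w k)) (nth 0%N s k) (nth 0%N mu (nth 0%N s k)).-1.

Definition zgen (r : nat) : A :=
  \sum_(mu <- subcomps lam | (sumn mu == r) && (ell mu == nth 0%N (degseq lam) r.-1))
     cdet mu.
End Gens.

(* Evaluation of a commutative polynomial in N variables at (z_1,...,z_N)
   (the z's commute, so the ordered product is harmless). *)
Definition zeval (F : nzRingType) (N : nat) (A : algType F) (z : 'I_N -> A)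
  (p : {mpoly F[N]}) : A :=
  \sum_(m <- msupp p) p@_m *: \prod_(i < N) z i ^+ (m i).

(* Main.v *)
Require Import Defs.
From HB Require Import structures.
From mathcomp Require Import all_boot all_order all_algebra perm.
From mathcomp Require Import mpoly.
From mathcomp Require Import zify ring.
From mathcomp Require boolp.
Set Implicit Arguments. Unset Strict Implicit. Unset Printing Implicit Defensive.
Import GRing.Theory.
Local Open Scope ring_scope.

(** The associated graded of U(g) is S(g) = F[g^*] (PBW, proved by letting U(g) act by
    left invariant differential operators on F[g], as g = g_e is an associative algebra),
    so it suffices to show that the z_r are central and that their principal symbols x_r
    are algebraically independent and generate all g-invariant polynomials on g^*.

    Centrality: for fixed r, put the terms of z_r with support I in the form of the
    coefficient of a column determinant of polynomials
    f_ij(u) = sum_c e~_{i,j;L_j-1-c} u^c, rows and columns in I. The commutator with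
    e_{a,b;s} is a row operation minus a column operation. It vanishes if I contains
    both or none of a, b, and cancels between I and the set obtained from I by
    exchanging a and b otherwise. It is enough to treat |a - b| <= 1, since these
    e_{a,b;s} generate g.

    Invariants: restrict to an affine space of companion matrices in g^*. There each x_r
    becomes, up to sign, a coordinate function, and an invariant polynomial vanishing
    there is zero because the coadjoint orbits are transverse to this slice. *)

(** * Linear endomorphisms and subalgebras as algebras *)

(** A column determinant with two equal rows vanishes, but one with two equal columns need not: if
    the repeated column b, in adjacent positions, has entries f_i, antisymmetrising leaves the
    commutators f_i f_j - f_j f_i. In the relevant range of degrees these equal L_b u^(L_b - 1) (f_i
    delta_jb - f_j delta_ib). The shift (i-1) lambda_i absorbs this error: for neighbouring rows
    with equal parts its values differ by exactly lambda_i. Only |a - b| <= 1 is treated directly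
    because then the columns involved are adjacent, and exchanging a and b keeps the order of the
    noncommuting columns. The condition l(mu) = d_r makes the total defect, the sum of lambda_i -
    mu_i over the support, smaller than every part involved; this is the range of degrees where the
    commutator formulas for f_ij(u) hold. In the symbols the shift has lower degree and disappears,
    so the x_r are ordinary determinants. Associativity of g_e provides left invariant vector fields
    with linear coefficients, so that polynomials suffice. *)

Record endo (F : fieldType) (m : nat) :=
  Endo { efun :> {mpoly F[m]} -> {mpoly F[m]}; efunP : is_linear_map efun }.

Section EndoAlgebra.
Variables (F : fieldType) (m : nat).
Local Notation E := (endo F m).
Implicit Types f g h : E.

(** Extensionality and proof irrelevance make equality of operators pointwise, so that they form an
    [algType], the kind of target that the universal property accepts. *)
Lemma endoP f g : (forall p, f p = g p) -> f = g.
Proof.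
case: f g => f Hf [g Hg] /= fg.
have {}fg : f = g by apply: boolp.funext.
by rewrite fg in Hf *; congr Endo; apply: boolp.Prop_irrelevance.
Qed.

Lemma endoD f p q : f (p + q) = f p + f q.
Proof. by rewrite -[p]scale1r efunP !scale1r. Qed.

Lemma endo0 f : f 0 = 0.
Proof. by apply: (@addIr _ (f 0)); rewrite -endoD !add0r. Qed.

Lemma endoZ f c p : f (c *: p) = c *: f p.
Proof. by rewrite -[c *: p]addr0 efunP endo0 addr0. Qed.

HB.instance Definition _ := boolp.gen_eqMixin E.
HB.instance Definition _ := boolp.gen_choiceMixin E.

Fact zero_lin : is_linear_map (fun _ : {mpoly F[m]} => 0 : {mpoly F[m]}).
Proof. by move=> c x y; rewrite scaler0 addr0. Qed.
Fact one_lin : is_linear_map (fun p : {mpoly F[m]} => p).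
Proof. by []. Qed.
Fact add_lin f g : is_linear_map (fun p => f p + g p).
Proof. by move=> c x y; rewrite !efunP scalerDr addrACA. Qed.
Fact opp_lin f : is_linear_map (fun p => - f p).
Proof. by move=> c x y; rewrite !efunP opprD scalerN. Qed.
Fact mul_lin f g : is_linear_map (fun p => f (g p)).
Proof. by move=> c x y; rewrite !efunP. Qed.
Fact scale_lin a f : is_linear_map (fun p => a *: f p).
Proof. by move=> c x y; rewrite !efunP scalerDr !scalerA mulrC. Qed.

Definition endo_zero := Endo zero_lin.
Definition endo_one := Endo one_lin.
Definition endo_add f g := Endo (add_lin f g).
Definition endo_opp f := Endo (opp_lin f).
Definition endo_mul f g := Endo (mul_lin f g).
Definition endo_scale a f := Endo (scale_lin a f).

Fact endo_addA : associative endo_add.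
Proof. by move=> f g h; apply: endoP => p /=; rewrite addrA. Qed.
Fact endo_addC : commutative endo_add.
Proof. by move=> f g; apply: endoP => p /=; rewrite addrC. Qed.
Fact endo_add0 : left_id endo_zero endo_add.
Proof. by move=> f; apply: endoP => p /=; rewrite add0r. Qed.
Fact endo_addN : left_inverse endo_zero endo_opp endo_add.
Proof. by move=> f; apply: endoP => p /=; rewrite addNr. Qed.
HB.instance Definition _ :=
  GRing.isZmodule.Build E endo_addA endo_addC endo_add0 endo_addN.

Fact endo_mulA : associative endo_mul.
Proof. by move=> f g h; apply: endoP. Qed.
Fact endo_mul1 : left_id endo_one endo_mul.
Proof. by move=> f; apply: endoP. Qed.
Fact endo_mulr1 : right_id endo_one endo_mul.
Proof. by move=> f; apply: endoP. Qed.
Fact endo_mulDl : left_distributive endo_mul endo_add.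
Proof. by move=> f g h; apply: endoP. Qed.
Fact endo_mulDr : right_distributive endo_mul endo_add.
Proof. by move=> f g h; apply: endoP => p /=; rewrite endoD. Qed.
Fact endo_1neq0 : endo_one != endo_zero.
Proof.
apply/eqP => /(congr1 (fun f : E => f 1)) /= /eqP.
by rewrite oner_eq0.
Qed.
HB.instance Definition _ := GRing.Zmodule_isNzRing.Build E
  endo_mulA endo_mul1 endo_mulr1 endo_mulDl endo_mulDr endo_1neq0.

Fact endo_scaleA a b f : endo_scale a (endo_scale b f) = endo_scale (a * b) f.
Proof. by apply: endoP => p /=; rewrite scalerA. Qed.
Fact endo_scale1 : left_id 1 endo_scale.
Proof. by move=> f; apply: endoP => p /=; rewrite scale1r. Qed.
Fact endo_scaleDr : right_distributive endo_scale +%R.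
Proof. by move=> a f g; apply: endoP => p /=; rewrite scalerDr. Qed.
Fact endo_scaleDl f : {morph endo_scale^~ f : a b / a + b}.
Proof. by move=> a b; apply: endoP => p /=; rewrite scalerDl. Qed.
HB.instance Definition _ := GRing.Zmodule_isLmodule.Build F E
  endo_scaleA endo_scale1 endo_scaleDr endo_scaleDl.

Fact endo_scaleAl a (f g : E) : a *: (f * g) = a *: f * g.
Proof. by apply: endoP. Qed.
HB.instance Definition _ := GRing.Lmodule_isLalgebra.Build F E endo_scaleAl.
Fact endo_scaleAr a (f g : E) : a *: (f * g) = f * (a *: g).
Proof. by apply: endoP => p /=; rewrite endoZ. Qed.
HB.instance Definition _ := GRing.Lalgebra_isAlgebra.Build F E endo_scaleAr.

End EndoAlgebra.

Section Subalgebra.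
Variables (F : fieldType) (A : algType F) (S : A -> Prop).
Hypotheses (S1 : S 1) (SL : forall c x y, S x -> S y -> S (c *: x + y))
           (SM : forall x y, S x -> S y -> S (x * y)).

(** The universal property quantifies over bundled algebras, so [S] must become an [algType];
    [asbool] gives the boolean predicate that the subtype needs. *)
Definition subalg_pred : {pred A} := fun a => boolp.asbool (S a).

Fact subalg_pred_closed : GRing.subalg_closed subalg_pred.
Proof.
split=> [|c x y /boolp.asboolP Sx /boolp.asboolP Sy|
          x y /boolp.asboolP Sx /boolp.asboolP Sy]; apply/boolp.asboolP;
  by [|apply: SL|apply: SM].
Qed.
HB.instance Definition _ :=
  GRing.isSubalgClosed.Build F A subalg_pred subalg_pred_closed.

Record subalg_of := SubAlg { subalg_val :> A; _ : subalg_val \in subalg_pred }.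
HB.instance Definition _ := [isSub for subalg_val].
HB.instance Definition _ := [Choice of subalg_of by <:].
HB.instance Definition _ := [SubChoice_isSubLalgebra of subalg_of by <:].
HB.instance Definition _ := [SubLalgebra_isSubAlgebra of subalg_of by <:].

Definition subalgebra : algType F := subalg_of.
Definition subalg_incl (x : subalgebra) : A := subalg_val x.

Lemma subalg_inclP (x : subalgebra) : S (subalg_incl x).
Proof. by case: x => x /= /boolp.asboolP. Qed.

Lemma subalg_incl_morph : is_alg_morph subalg_incl.
Proof. by split. Qed.

Lemma subalg_incl_inj : injective subalg_incl.
Proof. exact: val_inj. Qed.

Lemma subalg_lift x : S x -> exists y, subalg_incl y = x.
Proof. by move=> Sx; exists (@SubAlg x (introT (boolp.asboolP _) Sx)). Qed.

End Subalgebra.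

(** * The degree filtration and principal symbols *)

Section Words.
Variables (F : fieldType) (A : algType F) (m : nat) (y : 'I_m -> A).

Definition word (w : seq 'I_m) : A := \prod_(i <- w) y i.
Definition mword (w : seq 'I_m) : {mpoly F[m]} := \prod_(i <- w) 'X_i.

Lemma word_cat w1 w2 : word (w1 ++ w2) = word w1 * word w2.
Proof. exact: big_cat. Qed.
Lemma mword_cat w1 w2 : mword (w1 ++ w2) = mword w1 * mword w2.
Proof. exact: big_cat. Qed.

(* Strict bound: [fil k] is the part of degree < k of the PBW filtration. *)
Inductive fil (k : nat) : A -> Prop :=
| fil_zero : fil k 0
| fil_word c w a : (size w < k)%N -> fil k a -> fil k (c *: word w + a).

(* [symb k a p]: a has degree <= k and principal symbol p in S(g) = F[X_1..X_m];
   p = 0 if a has degree < k. *)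
Inductive symb (k : nat) : A -> {mpoly F[m]} -> Prop :=
| symb_low a : fil k a -> symb k a 0
| symb_word c w a p : size w = k -> symb k a p ->
    symb k (c *: word w + a) (c *: mword w + p).

Lemma filW k l a : (k <= l)%N -> fil k a -> fil l a.
Proof.
move=> kl; elim=> [|c w {}a sw _ IH]; first exact: fil_zero.
by apply: fil_word => //; apply: leq_trans kl.
Qed.

Lemma filL k c a b : fil k a -> fil k b -> fil k (c *: a + b).
Proof.
move=> fa fb; elim: fa => [|d w {}a sw _ IH]; first by rewrite scaler0 add0r.
by rewrite scalerDr scalerA -addrA; apply: fil_word.
Qed.

Lemma filD k a b : fil k a -> fil k b -> fil k (a + b).
Proof. by move=> fa fb; rewrite -[a]scale1r; apply: filL. Qed.

Lemma filZ k c a : fil k a -> fil k (c *: a).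
Proof. by move=> fa; rewrite -[_ *: _]addr0; apply: filL => //; apply: fil_zero. Qed.

Lemma filwd w k : (size w < k)%N -> fil k (word w).
Proof.
by move=> sw; rewrite -[word w]scale1r -[_ *: _]addr0; apply/fil_word/fil_zero.
Qed.

Lemma fil0 a : fil 0 a -> a = 0.
Proof. by case. Qed.

(** With strict bounds, [fil k.+1] means degree at most [k]; one factor strictly below its bound is
    enough. [filMl] is the mirror image. *)
Lemma filM k l a b : fil k.+1 a -> fil l b -> fil (k + l) (a * b).
Proof.
move=> fa fb; elim: fa => [|c w {}a sw _ IH]; first by rewrite mul0r; apply: fil_zero.
rewrite mulrDl -scalerAl; apply: filL => //.
elim: fb {IH} => [|d v {}b sv _ IH']; first by rewrite mulr0; apply: fil_zero.
rewrite mulrDr -scalerAr -word_cat; apply: fil_word => //.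
by rewrite size_cat -addnS leq_add.
Qed.

Lemma filMl k l a b : fil k a -> fil l.+1 b -> fil (k + l) (a * b).
Proof.
move=> fa fb; elim: fa => [|c w {}a sw _ IH]; first by rewrite mul0r; apply: fil_zero.
rewrite mulrDl -scalerAl; apply: filL => //.
elim: fb {IH} => [|d v {}b sv _ IH']; first by rewrite mulr0; apply: fil_zero.
rewrite mulrDr -scalerAr -word_cat; apply: fil_word => //.
by rewrite size_cat -addSn leq_add.
Qed.

Lemma symb_fil k a p : symb k a p -> fil k.+1 a.
Proof.
elim=> [{}a|c w {}a {}p sw _ IH]; first exact: filW.
by apply: fil_word => //; rewrite sw.
Qed.

Lemma symbL k c a b p q :
  symb k a p -> symb k b q -> symb k (c *: a + b) (c *: p + q).
Proof.
move=> sa sb; elim: sa => [{}a fa|d w {}a {}p sw _ IH].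
  rewrite scaler0 add0r; elim: sb => [{}b fb|e v {}b {}q sv _ IH].
    by apply: symb_low; apply: filL.
  by rewrite addrCA; apply: symb_word.
by rewrite !scalerDr !scalerA -!addrA; apply: symb_word.
Qed.

Lemma symbD k a b p q : symb k a p -> symb k b q -> symb k (a + b) (p + q).
Proof.
by move=> sa sb; rewrite -[a]scale1r -[p]scale1r; apply: symbL.
Qed.

Lemma symb0 k : symb k 0 0.
Proof. by apply: symb_low; apply: fil_zero. Qed.

Lemma symbZ k c a p : symb k a p -> symb k (c *: a) (c *: p).
Proof.
move=> sa; rewrite -[X in symb _ X _]addr0 -[X in symb _ _ X]addr0.
by apply: symbL => //; apply: symb0.
Qed.

Lemma symbN k a p : symb k a p -> symb k (- a) (- p).
Proof. by move=> sa; rewrite -scaleN1r -[- p]scaleN1r; apply: symbZ. Qed.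

Lemma symbB k a b p q : symb k a p -> symb k b q -> symb k (a - b) (p - q).
Proof. by move=> sa /symbN; apply: symbD. Qed.

Lemma symb_sum k (I : Type) (r : seq I) (Q : pred I) (G : I -> A) (g : I -> {mpoly F[m]}) :
  (forall i, Q i -> symb k (G i) (g i)) ->
  symb k (\sum_(i <- r | Q i) G i) (\sum_(i <- r | Q i) g i).
Proof.
move=> H; elim/big_ind2: _ => //; [exact: symb0 | move=> *; exact: symbD].
Qed.

Lemma symbwd w : symb (size w) (word w) (mword w).
Proof.
rewrite -[word w]scale1r -[mword w]scale1r.
by rewrite -[_ *: word w]addr0 -[_ *: mword w]addr0; apply/symb_word/symb0.
Qed.

Lemma symbM k l a b p q :
  symb k a p -> symb l b q -> symb (k + l) (a * b) (p * q).
Proof.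
move=> sa sb; elim: sa => [{}a fa|c w {}a {}p sw _ IH].
  by rewrite mul0r; apply/symb_low/filMl/(symb_fil sb).
rewrite !mulrDl -!scalerAl; apply: symbL => //.
elim: sb {IH} => [{}b fb|d v {}b {}q sv _ IH'].
  rewrite mulr0; apply/symb_low/filM => //.
  by apply: filwd; rewrite sw.
rewrite !mulrDr -!scalerAr -word_cat -mword_cat; apply: symb_word => //.
by rewrite size_cat sw sv.
Qed.

Lemma symb1 : symb 0 1 1.
Proof. by have := symbwd [::]; rewrite /word /mword !big_nil. Qed.

Lemma symbX k n a p : symb k a p -> symb (k * n) (a ^+ n) (p ^+ n).
Proof.
move=> sa; elim: n => [|n IH]; first by rewrite muln0 !expr0; apply: symb1.
by rewrite mulnS !exprS; apply: symbM.
Qed.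

Lemma symb_prod (I : eqType) (r : seq I) (k : I -> nat) (G : I -> A) (g : I -> {mpoly F[m]}) :
  (forall i, i \in r -> symb (k i) (G i) (g i)) ->
  symb (\sum_(i <- r) k i) (\prod_(i <- r) G i) (\prod_(i <- r) g i).
Proof.
elim: r => [|i r IH] H; first by rewrite !big_nil; apply: symb1.
rewrite !big_cons; apply: symbM; first by apply: H; rewrite mem_head.
by apply: IH => j jr; apply: H; rewrite in_cons jr orbT.
Qed.

Lemma filS_symb k a : fil k.+1 a -> exists p, symb k a p.
Proof.
elim=> [|c w {}a sw _ [p IH]]; first by exists 0; apply: symb0.
move: sw; rewrite ltnS leq_eqVlt => /orP[/eqP sw|sw].
  by exists (c *: mword w + p); apply: symb_word.
exists p; rewrite -[p]add0r -[X in symb _ _ (X + _)](scaler0 _ c).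
by apply: symbL => //; apply/symb_low/filwd.
Qed.

Lemma symb_homog k a p : symb k a p -> p \is k.-homog.
Proof.
elim=> [{}a _|c w {}a {}p sw _ IH]; first exact: dhomog0.
apply: rpredD => //; apply: rpredZ; rewrite -sw /mword.
elim: w {sw} => [|i w IHw]; first by rewrite big_nil dhomog1.
rewrite big_cons -[size _]/(1 + size w)%N; apply: dhomogM => //.
by rewrite dhomogX /= mdeg1.
Qed.

(** * Reordering words modulo lower degree *)

Section Commuting.
Hypothesis yC : forall i j, fil 2 (y i * y j - y j * y i).

Lemma word_swap w1 w2 i j :
  fil (size w1 + size w2).+2 (word (w1 ++ i :: j :: w2) - word (w1 ++ j :: i :: w2)).
Proof.
have -> : word (w1 ++ i :: j :: w2) - word (w1 ++ j :: i :: w2) =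
    word w1 * ((y i * y j - y j * y i) * word w2).
  by rewrite !word_cat /word !big_cons mulrBl mulrBr !mulrA.
have -> : (size w1 + size w2).+2 = (size w1 + (2 + size w2))%N by rewrite !addnS.
by apply: filM; [apply: filwd | apply: filMl => //; apply: filwd].
Qed.

(** The first letter of [w] is carried to its place in [v] by adjacent swaps, each costing a term of
    lower degree; the rest follows by induction on the length. *)
Lemma word_perm w v : perm_eq w v -> fil (size w) (word w - word v).
Proof.
have [k] := ubnP (size w); elim: k w v => // k IH w v sk.
case: w sk => [|i w] sk wv.
  by move: wv; rewrite perm_sym => /perm_nilP ->; rewrite subrr; apply: fil_zero.
have iv : i \in v by rewrite -(perm_mem wv) mem_head.
case/splitPr: iv wv => v1 v2 wv.
have wv' : perm_eq w (v1 ++ v2).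
  by rewrite -(perm_cons i) (permPl wv) perm_catC /= perm_cons perm_catC.
have sw : size w = (size v1 + size v2)%N by rewrite (perm_size wv') size_cat.
have -> : word (i :: w) - word (v1 ++ i :: v2) =
    y i * (word w - word (v1 ++ v2)) + (word (i :: v1 ++ v2) - word (v1 ++ i :: v2)).
  by rewrite /word !big_cons mulrBr addrA subrK.
apply: filD.
  rewrite -[size _]/(1 + size w)%N; apply: filM; last exact: IH.
  have -> : y i = word [:: i] by rewrite /word big_seq1.
  exact: filwd.
rewrite /= sw {wv sk wv' sw IH w v}.
elim/last_ind: v1 v2 => [|v1 j IHv] v2; first by rewrite subrr; apply: fil_zero.
rewrite !cat_rcons size_rcons addSnnS.
rewrite -[word (i :: _)](subrK (word (v1 ++ i :: j :: v2))) -addrA.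
by apply: filD; [exact: (IHv (j :: v2)) | rewrite addnS; apply: word_swap].
Qed.

(** [zeval] sums over the support, which changes under addition; rewritten as a sum over all
    monomials of degree below a common [d] it is visibly linear. *)
Lemma zeval_linear (N : nat) (z : 'I_N -> A) : is_linear_map (zeval z).
Proof.
pose M := fun u : 'X_{1..N} => \prod_(i < N) z i ^+ u i.
have E p d : (msize p <= d)%N -> zeval z p = \sum_(u : 'X_{1..N < d}) p@_u *: M u.
  move=> pd; rewrite /zeval -[RHS](big_map (@bmnm N d) xpredT (fun u => p@_u *: M u)).
  rewrite [RHS](bigID (mem (msupp p))) /= [X in _ + X]big1 ?addr0; last first.
    by move=> u /memN_msupp_eq0 ->; rewrite scale0r.
  rewrite -[RHS]big_filter; apply: perm_big; apply: uniq_perm => //.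
    by rewrite filter_uniq // map_inj_uniq ?index_enum_uniq //; apply: val_inj.
  move=> u; rewrite mem_filter /=; case: (boolP (u \in msupp p)) => //= up.
  have ud : (mdeg u < d)%N by apply: leq_trans pd; apply: msize_mdeg_lt.
  by apply/esym/mapP; exists (BMultinom ud); rewrite ?mem_index_enum.
move=> c p q; pose d := maxn (msize (c *: p + q)) (maxn (msize p) (msize q)).
rewrite !(@E _ d) ?leq_max ?leqnn ?orbT //.
rewrite scaler_sumr -big_split; apply: eq_bigr => u _ /=.
by rewrite mcoeffD mcoeffZ scalerDl scalerA.
Qed.

Lemma zevalX (N : nat) (z : 'I_N -> A) u : zeval z 'X_[u] = \prod_(i < N) z i ^+ u i.
Proof. by rewrite /zeval msuppX big_seq1 mcoeffX eqxx scale1r. Qed.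

Definition mnm_of (w : seq 'I_m) : 'X_{1..m} := [multinom count_mem i w | i < m].

Lemma mwordE w : mword w = 'X_[mnm_of w].
Proof.
rewrite /mword mpolyXE_id.
elim: w => [|i w IH].
  by rewrite big_nil big1 // => i _; rewrite mnmE expr0.
rewrite big_cons IH (bigD1 i) //= [in RHS](bigD1 i) //= !mnmE /= eqxx exprS -mulrA.
congr (_ * (_ * _)); apply: eq_bigr => j /negPf ij.
by rewrite !mnmE /= eq_sym ij.
Qed.

(** [zeval y] substitutes the [y i] in increasing order, so the monomial of [w] becomes the sorted
    word [v], a permutation of [w]. *)
Lemma word_zeval w : fil (size w) (word w - zeval y (mword w)).
Proof.
rewrite mwordE zevalX.
pose v := flatten [seq nseq (count_mem i w) i | i <- index_enum 'I_m].
have -> : \prod_(i < m) y i ^+ mnm_of w i = word v.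
  rewrite /word /v; move: (index_enum _) => r; elim: r => [|i r IH].
    by rewrite !big_nil.
  rewrite big_cons IH /= big_cat /= mnmE; congr (_ * _).
  by rewrite big_nseq -Monoid.iteropE.
apply: word_perm; apply/seq.permP => a.
rewrite /v count_flatten -map_comp sumnE big_map.
rewrite (eq_bigr (fun i => (a i * count_mem i w)%N)); last first.
  by move=> i _ /=; rewrite count_nseq.
elim: w {v} => [|i w IH]; first by rewrite big1 // => i; rewrite muln0.
rewrite /= IH (bigD1 i) //= [in RHS](bigD1 i) //= eqxx mulnDr muln1 addnA.
congr (_ + _)%N; apply: eq_bigr => j /negPf ij.
by rewrite eq_sym ij.
Qed.

(** Any [a] with symbol [p] agrees modulo lower degree with [zeval y p], which depends on [p] alone
    and is 0 for [p = 0]. *)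
Lemma symb_zero_fil k a : symb k a 0 -> fil k a.
Proof.
have zL := @zeval_linear m y.
have z0 : zeval y 0 = 0 by rewrite /zeval msupp0 big_nil.
suff H p : symb k a p -> fil k (a - zeval y p).
  by move=> /H; rewrite z0 subr0.
elim=> [{}a fa|c w {}a {}p sw _ IH]; first by rewrite z0 subr0.
rewrite zL opprD addrACA -scalerBr; apply: filL => //.
by rewrite -sw; apply: word_zeval.
Qed.

End Commuting.
End Words.

(** * Derivations of polynomial rings *)

Lemma mpoly_ring_ind (R : comNzRingType) (n : nat) (Q : {mpoly R[n]} -> Prop) :
  (forall c, Q c%:MP) -> (forall i, Q 'X_i) ->
  (forall p q, Q p -> Q q -> Q (p + q)) -> (forall p q, Q p -> Q q -> Q (p * q)) ->
  forall p, Q p.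
Proof.
move=> QC QX QD QM p; rewrite [p]mpolyE.
have Q1 : Q 1 by exact: (QC 1).
elim/big_ind: _ => // [|u _]; first exact: (QC 0).
rewrite -mul_mpolyC; apply: (QM); first exact: QC.
rewrite mpolyXE_id; elim/big_ind: _ => // i _.
by elim: (u i) => [|k IH]; rewrite ?expr0 // exprS; apply: QM.
Qed.

Lemma comp_mpolyA (R : comNzRingType) (n k l : nat) (p : {mpoly R[n]})
  (q : n.-tuple {mpoly R[k]}) (r : k.-tuple {mpoly R[l]}) :
  (p \mPo q) \mPo r = p \mPo [tuple tnth q i \mPo r | i < n].
Proof.
move: p; apply: mpoly_ring_ind => [c|i|p p' Ep Ep'|p p' Ep Ep'].
- by rewrite !comp_mpolyC.
- by rewrite !comp_mpolyXU -!tnth_nth tnth_mktuple.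
- by rewrite !comp_mpolyD Ep Ep'.
- by rewrite !(rmorphM (comp_mpoly _)) /= Ep Ep'.
Qed.

(* Characteristic zero: a polynomial all of whose partial derivatives vanish is constant. *)
Lemma deriv_closed_zero (F : fieldType) (m : nat) (Q : {mpoly F[m]} -> Prop) :
  [pchar F] =i pred0 -> (forall p k, Q p -> Q p^`M(k)) -> (forall c, Q c%:MP -> c = 0) ->
  forall p, Q p -> p = 0.
Proof.
move=> HF QD QC p; have [k] := ubnP (msize p); elim: k p => // k IH p pk Qp.
have [k0|k0] := posnP k.
  by move: pk; rewrite k0 ltnS leqn0 msize_poly_eq0 => /eqP.
have D0 i : p^`M(i) = 0.
  apply: IH; last exact: QD.
  rewrite msizeE big_seq; apply: (@big_ind _ (fun x => x < k)%N) => //.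
    by move=> u v uk vk; rewrite gtn_max uk.
  move=> u; rewrite mcoeff_msupp mcoeff_deriv => nz.
  have : (u + U_(i))%MM \in msupp p.
    by rewrite mcoeff_msupp; apply: contraNneq nz => ->; rewrite mul0rn.
  by move/msize_mdeg_lt; rewrite mdegD mdeg1 addn1 => /leq_trans/(_ pk).
suff E : p = (p@_0)%:MP by rewrite E; rewrite E in Qp; rewrite (QC _ Qp).
apply/mpolyP => u; rewrite mcoeffC; case: eqVneq => [->|nz]; rewrite ?mulr1 ?mulr0 //.
have [i ui] : exists i, (0 < u i)%N.
  apply/existsP; apply: contraNT nz => /existsPn nu; apply/eqP/mnmP => i.
  by rewrite mnm0E; apply/eqP; rewrite -leqn0 leqNgt nu.
have Eu : u = (u - U_(i) + U_(i))%MM.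
  apply/mnmP => j; rewrite mnmDE mnmBE mnm1E; case: eqVneq => [<-|_].
    by rewrite subnK.
  by rewrite subn0 addn0.
have := congr1 (mcoeff (u - U_(i))%MM) (D0 i).
rewrite mcoeff_deriv -Eu mcoeff0 -mulr_natr => /eqP; rewrite mulf_eq0 => /orP[/eqP //|].
by rewrite ((pcharf0P F).1 HF).
Qed.

(** Vanishing at all points passes to partial derivatives: the restriction [r p] to a line in
    direction [k] is a polynomial in one variable with too many roots. Then [deriv_closed_zero]
    applies. *)
Lemma mpoly_eq0_meval (F : fieldType) (m : nat) (p : {mpoly F[m]}) :
  [pchar F] =i pred0 -> (forall l, p.@[l] = 0) -> p = 0.
Proof.
move=> HF; apply: (@deriv_closed_zero F m (fun p => forall l, p.@[l] = 0)) => // {p}.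
  move=> p k p0 l.
  pose h j : {poly F} := (l j)%:P + (j == k)%:R *: 'X.
  pose r p := mmap (@polyC F) h p.
  have rE t q : (r q).[t] = q.@[fun j => l j + (j == k)%:R * t].
    move: q; apply: mpoly_ring_ind => [c|j|q q' Eq Eq'|q q' Eq Eq'].
    - by rewrite /r mmapC mevalC hornerC.
    - by rewrite /r mmapX mmap1U mevalXU /h hornerD hornerC hornerZ hornerX.
    - by rewrite /r mmapD mevalD hornerD Eq Eq'.
    - by rewrite /r rmorphM mevalM hornerM Eq Eq'.
  have rD q : (r q)^`() = r q^`M(k).
    move: q; apply: mpoly_ring_ind => [c|j|q q' Eq Eq'|q q' Eq Eq'].
    - by rewrite /r mmapC mderivC derivC mmap0.
    - rewrite /r mmapX mmap1U mderivX mnm1E /h derivD derivC derivZ derivX add0r.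
      case: eqVneq => [->|jk]; last by rewrite !scale0r mmap0.
      have -> : (U_(k) - U_(k) = 0 :> 'X_{1..m})%MM.
        by apply/mnmP => i; rewrite mnmBE subnn mnm0E.
      by rewrite !scale1r mpolyX0 rmorph1.
    - by rewrite /r mmapD mderivD mmapD derivD Eq Eq'.
    - by rewrite /r rmorphM mderivM mmapD !rmorphM derivM Eq Eq'.
  (* The images of 0, 1, ..., size - 1 are distinct roots in characteristic zero. *)
  have r0 : r p = 0.
    apply/eqP; apply: contraT => rp.
    have := @max_poly_roots _ (r p) [seq i%:R | i <- iota 0 (size (r p))] rp.
    rewrite size_map size_iota ltnn; apply.
      by apply/allP => x /mapP[i _ ->]; rewrite /root rE p0.
    rewrite map_inj_in_uniq ?iota_uniq // => i j _ _ /eqP.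
    wlog ij : i j / (i <= j)%N => [H|].
      by case/orP: (leq_total i j) => ij; [|rewrite eq_sym => /(H _ _ ij) ->]; first exact: H.
    rewrite eq_sym -subr_eq0 -natrB // ((pcharf0P F).1 HF) subn_eq0 => ji.
    by apply/eqP; rewrite eqn_leq ij.
  have := rE 0 p^`M(k); rewrite -rD r0 derivC horner0 => ->.
  by apply: meval_eq => j; rewrite mulr0 addr0.
by move=> c /(_ (fun=> 0)); rewrite mevalC.
Qed.

Section Derivations.
Variables (F : fieldType) (m : nat).
Implicit Types (a : 'I_m -> {mpoly F[m]}) (p q : {mpoly F[m]}).

Definition deriv_of a p : {mpoly F[m]} := \sum_k a k * p^`M(k).

Lemma deriv_of_lin a : is_linear_map (deriv_of a).
Proof.
move=> c p q; rewrite /deriv_of scaler_sumr -big_split; apply: eq_bigr => k _ /=.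
by rewrite mderivD mderivZ mulrDr scalerAr.
Qed.

Lemma deriv_ofD a p q : deriv_of a (p + q) = deriv_of a p + deriv_of a q.
Proof. by rewrite -[p]scale1r deriv_of_lin !scale1r. Qed.

Lemma deriv_ofC a c : deriv_of a c%:MP = 0.
Proof. by rewrite /deriv_of big1 // => k _; rewrite mderivC mulr0. Qed.

Lemma deriv_ofX a k : deriv_of a 'X_k = a k.
Proof.
rewrite /deriv_of (bigD1 k) //= big1 ?addr0 => [|j /negPf jk]; rewrite mderivX mnm1E.
  have -> : (U_(k) - U_(k) = 0 :> 'X_{1..m})%MM by apply/mnmP => l; rewrite mnmBE subnn mnm0E.
  by rewrite eqxx scale1r mpolyX0 mulr1.
by rewrite eq_sym jk scale0r mulr0.
Qed.

Lemma deriv_ofM a p q : deriv_of a (p * q) = deriv_of a p * q + p * deriv_of a q.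
Proof.
rewrite /deriv_of mulr_suml mulr_sumr -big_split; apply: eq_bigr => k _ /=.
by rewrite mderivM mulrDr; congr (_ + _); [rewrite mulrA | rewrite mulrCA].
Qed.

Lemma deriv_of_exp a p n : deriv_of a (p ^+ n.+1) = n.+1%:R * p ^+ n * deriv_of a p.
Proof.
elim: n => [|n IH]; first by rewrite expr1 expr0 !mul1r.
rewrite exprS deriv_ofM IH -[n.+2]add1n natrD exprS; move: (deriv_of _ _) => d.
by rewrite mulrDl mul1r mulrDl mulrC; congr (_ + _); rewrite !mulrA; congr (_ * _); rewrite -!mulrA mulrCA.
Qed.

Lemma deriv_of_eq (D1 D2 : {mpoly F[m]} -> {mpoly F[m]}) :
  (forall p q, D1 (p + q) = D1 p + D1 q) -> (forall p q, D2 (p + q) = D2 p + D2 q) ->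
  (forall p q, D1 (p * q) = D1 p * q + p * D1 q) ->
  (forall p q, D2 (p * q) = D2 p * q + p * D2 q) ->
  (forall c, D1 c%:MP = D2 c%:MP) -> (forall i, D1 'X_i = D2 'X_i) ->
  forall p, D1 p = D2 p.
Proof.
move=> D1D D2D D1M D2M DC DX; apply: mpoly_ring_ind => // p q Ep Eq.
  by rewrite D1D D2D Ep Eq.
by rewrite D1M D2M Ep Eq.
Qed.

End Derivations.

(** * The Poincare-Birkhoff-Witt theorem and the center *)

Section PBW.
Variables (F : fieldType) (N : nat) (P : pred 'M[F]_N) (m : nat).
Variables (b : 'I_m -> 'M[F]_N) (co : 'I_m -> 'M[F]_N -> F).
Hypotheses (coL : forall k c X Y, co k (c *: X + Y) = c * co k X + co k Y)
  (Pb : forall k, P (b k)) (Pspan : forall X, P X -> X = \sum_k co k X *: b k)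
  (cob : forall k l, co k (b l) = (k == l)%:R)
  (PM : forall X Y, P X -> P Y -> P (X *m Y)) (P1 : P 1%:M)
  (PL : forall c X Y, P X -> P Y -> P (c *: X + Y)).
Variables (A : algType F) (iu : 'M[F]_N -> A) (HU : is_UEA P iu).

Local Notation MP := {mpoly F[m]}.
Let y k := iu (b k).

Lemma iuL c X Y : iu (c *: X + Y) = c *: iu X + iu Y.
Proof. by case: HU. Qed.

Lemma iu0 : iu 0 = 0.
Proof.
have := iuL 1 0 0; rewrite !scale1r addr0 => E.
by apply: (@addIr _ (iu 0)); rewrite -E add0r.
Qed.

Lemma iuD X Y : iu (X + Y) = iu X + iu Y.
Proof. by rewrite -[X]scale1r iuL !scale1r. Qed.

Lemma iuZ c X : iu (c *: X) = c *: iu X.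
Proof. by rewrite -[_ *: _]addr0 iuL iu0 addr0. Qed.

Lemma iu_sum (I : Type) (r : seq I) Q (G : I -> 'M[F]_N) :
  iu (\sum_(i <- r | Q i) G i) = \sum_(i <- r | Q i) iu (G i).
Proof. exact: (big_morph iu iuD iu0). Qed.

Lemma co0 k : co k 0 = 0.
Proof.
have := coL k 1 0 0; rewrite scale1r addr0 mul1r => E.
by apply: (@addIr _ (co k 0)); rewrite -E add0r.
Qed.

Lemma coD k X Y : co k (X + Y) = co k X + co k Y.
Proof. by rewrite -[X]scale1r coL mul1r scale1r. Qed.

Lemma coZ k c X : co k (c *: X) = c * co k X.
Proof. by rewrite -[_ *: _]addr0 coL co0 addr0. Qed.

Lemma co_sum k (I : Type) (r : seq I) Q (G : I -> 'M[F]_N) :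
  co k (\sum_(i <- r | Q i) G i) = \sum_(i <- r | Q i) co k (G i).
Proof. exact: (big_morph (co k) (coD k) (co0 k)). Qed.

Lemma P_sub X Y : P X -> P Y -> P (X - Y).
Proof. by move=> PX PY; rewrite -scaleN1r addrC; apply: PL. Qed.

Lemma iu_span X : P X -> iu X = \sum_k co k X *: y k.
Proof.
by move=> PX; rewrite {1}(Pspan PX) iu_sum; apply: eq_bigr => k _; rewrite iuZ.
Qed.

(** The universal property asks for maps linear on all matrices; composing with this projection
    extends a map given on [P] only. *)
Definition mproj X : 'M[F]_N := \sum_k co k X *: b k.

Lemma mprojL c X Y : mproj (c *: X + Y) = c *: mproj X + mproj Y.
Proof.
rewrite /mproj scaler_sumr -big_split; apply: eq_bigr => k _ /=.
by rewrite coL scalerDl scalerA.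
Qed.

Lemma P_zero : P 0.
Proof. by rewrite -(subrr 1%:M); apply: P_sub. Qed.

Lemma mprojP X : P (mproj X).
Proof.
rewrite /mproj; elim/big_ind: _ => [|Y Z PY PZ|k _]; first exact: P_zero.
  by rewrite -[Y]scale1r; apply: PL.
by rewrite -[_ *: _]addr0; apply: PL => //; apply: P_zero.
Qed.

Lemma lin_form_symb X : P X -> symb y 1 (iu X) (\sum_k co k X *: 'X_k).
Proof.
move=> PX; rewrite (iu_span PX); apply: symb_sum => k _; apply: symbZ.
by have := symbwd y [:: k]; rewrite /word /mword !big_seq1.
Qed.

Definition lform X : MP := \sum_k co k X *: 'X_k.

Lemma lformL c X Y : lform (c *: X + Y) = c *: lform X + lform Y.
Proof.
rewrite /lform scaler_sumr -big_split; apply: eq_bigr => k _ /=.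
by rewrite coL scalerDl scalerA.
Qed.

Lemma lform_b k : lform (b k) = 'X_k.
Proof.
rewrite /lform (bigD1 k) //= cob eqxx scale1r big1 ?addr0 // => j /negPf jk.
by rewrite cob jk scale0r.
Qed.

Lemma y_comm i j : fil y 2 (y i * y j - y j * y i).
Proof.
case: (HU) => _ HL _; rewrite /y -HL //.
by apply/symb_fil/lin_form_symb/P_sub; apply: PM.
Qed.

(* The subalgebra generated by [iu] inherits the universal property, so the identity
   of A factors through it. *)
Lemma generated a : exists k, fil y k a.
Proof.
pose S (a : A) := exists k, fil y k a.
have S1 : S 1 by exists 1%N; have := @filwd _ _ _ y [::] 1; rewrite /word big_nil; apply.
have SL c x z : S x -> S z -> S (c *: x + z).
  move=> [k fx] [l fz]; exists (maxn k l).
  by apply: filL; [apply: filW fx; rewrite leq_maxl | apply: filW fz; rewrite leq_maxr].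
have SM x z : S x -> S z -> S (x * z).
  move=> [k fx] [l fz]; exists (k + l)%N; apply: filM => //.
  exact: filW fx.
pose incl := @subalg_incl F A S S1 SL SM.
have [iD iM i1 iZ] : is_alg_morph incl by exact: subalg_incl_morph.
have Siu X : P X -> S (iu X) by move=> PX; exists 2%N; apply/symb_fil/lin_form_symb.
have sIu X : {c | incl c = iu (mproj X)}.
  exact/boolp.cid/(subalg_lift S1 SL SM (Siu _ (mprojP X))).
pose f X := sval (sIu X).
have fE X : incl (f X) = iu (mproj X) by exact: svalP (sIu X).
have iI : injective incl by exact: subalg_incl_inj.
have prP X : P X -> mproj X = X by move=> /Pspan.
have fL : is_linear_map f.
  by move=> c X Z; apply: iI; rewrite fE iD iZ !fE mprojL iuL.
case: (HU) => _ HL HA; have iN u v : incl (u - v) = incl u - incl v.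
  by rewrite -scaleN1r addrC iD iZ scaleN1r addrC.
have fX : lie_on P f.
  move=> X Z PX PZ; apply: iI; rewrite fE iN !iM !fE !prP ?HL //.
  by apply: P_sub; apply: PM.
have [[phi [[pD pM p1 pZ] pE]] _] := HA _ _ fL fX.
have [_ uniq] := HA A iu iuL HL.
have /(_ a) <- : forall a, incl (phi a) = id a.
  apply: uniq => [|//|X PX]; last by rewrite pE // fE prP.
  by split=> [u v|u v||c u]; rewrite ?pD ?pM ?p1 ?pZ ?iD ?iM ?i1 ?iZ.
exact: (subalg_inclP (phi a)).
Qed.


(** * Invariant differential operators and uniqueness of symbols *)

Section Regular.
Variables (HF : [pchar F] =i pred0).

(* The span C of the [b k] is an associative algebra, and U(C) acts on F[C] by left
   invariant differential operators: X acts as the vector field c |-> c X. *)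
Definition rform X (k : 'I_m) : MP := \sum_j co k (b j *m X) *: 'X_j.
Definition rop X : endo F m := Endo (deriv_of_lin (rform X)).

Lemma rformL c X Z k : rform (c *: X + Z) k = c *: rform X k + rform Z k.
Proof.
rewrite /rform scaler_sumr -big_split; apply: eq_bigr => j _ /=.
by rewrite mulmxDr -scalemxAr coL scalerDl scalerA.
Qed.

Lemma ropL : is_linear_map rop.
Proof.
move=> c X Z; apply: endoP => p /=; rewrite /deriv_of scaler_sumr -big_split.
by apply: eq_bigr => k _ /=; rewrite rformL mulrDl scalerAl.
Qed.

(** [rform Z k] is the k-th coordinate of c Z as a function of c; its derivative along the vector
    field c X is the k-th coordinate of c X Z. *)
Lemma rop_rform X Z k : P X -> P Z -> rop X (rform Z k) = rform (X *m Z) k.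
Proof.
move=> PX PZ; rewrite /rform.
have -> p : rop X p = deriv_of (rform X) p by [].
have lin := @deriv_of_lin F m (rform X).
have l0 : deriv_of (rform X) 0 = 0 by apply: (@endo0 F m (rop X)).
rewrite (big_morph _ (@deriv_ofD _ _ _) l0).
rewrite (eq_bigr (fun j => \sum_i co k (b j *m Z) *: (co j (b i *m X) *: 'X_i))); last first.
  by move=> j _; rewrite -[_ *: 'X_j]addr0 lin l0 addr0 deriv_ofX /rform scaler_sumr.
rewrite exchange_big; apply: eq_bigr => i _ /=.
rewrite mulmxA {2}[b i *m X](Pspan (PM (Pb i) PX)) mulmx_suml co_sum scaler_suml.
by apply: eq_bigr => j _; rewrite -scalemxAl coZ scalerA mulrC.
Qed.

(** A commutator of derivations is a derivation, so both sides need only be compared on the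
    coordinates, where [rop_rform] applies. *)
Lemma rop_lie : lie_on P rop.
Proof.
move=> X Z PX PZ; apply: endoP.
have E p : (rop X * rop Z - rop Z * rop X) p = rop X (rop Z p) - rop Z (rop X p) by [].
move=> p; rewrite E; move: p.
have dM W p q : rop W (p * q) = rop W p * q + p * rop W q by apply: deriv_ofM.
apply: deriv_of_eq.
- by move=> p q; apply: endoD.
- by move=> p q; rewrite !endoD opprD addrACA.
- by move=> p q; apply: deriv_ofM.
- by move=> p q; rewrite !dM !endoD !dM; ring.
- move=> c; have z W : rop W c%:MP = 0 by apply: deriv_ofC.
  by rewrite !z !endo0 subr0.
- move=> k; have rX W : rop W 'X_k = rform W k by apply: deriv_ofX.
  rewrite !rX !rop_rform //.
  by have := rformL (-1) (Z *m X) (X *m Z) k; rewrite !scaleN1r ![- _ + _]addrC => ->.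
Qed.

Let e0 k := co k 1%:M.

Lemma rform_e0 X k : P X -> (rform X k).@[e0] = co k X.
Proof.
move=> PX; have EX : X = \sum_j e0 j *: (b j *m X).
  rewrite -[LHS]mul1mx {1}(Pspan P1) mulmx_suml; apply: eq_bigr => j _.
  by rewrite -scalemxAl.
rewrite [in RHS]EX co_sum /rform raddf_sum /=; apply: eq_bigr => j _.
by rewrite mevalZ mevalXU coZ mulrC.
Qed.

Section Test.
Variable l : 'I_m -> F.
Let g : MP := \sum_k l k *: ('X_k - (e0 k)%:MP).

Lemma g_e0 : g.@[e0] = 0.
Proof.
rewrite /g raddf_sum big1 // => k _.
by rewrite /= mevalZ mevalB mevalXU mevalC subrr mulr0.
Qed.

Lemma rop_g k : (rop (b k) g).@[e0] = l k.
Proof.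
rewrite /g -[rop _ _]/(deriv_of _ _).
have l0 X : deriv_of (rform X) 0 = 0 by apply: (@endo0 F m (rop X)).
rewrite (big_morph _ (@deriv_ofD _ _ _) (l0 _)) raddf_sum /= (bigD1 k) //=.
rewrite big1 ?addr0 => [|j jk].
  have -> : deriv_of (rform (b k)) (l k *: ('X_k - (e0 k)%:MP)) = l k *: rform (b k) k.
    rewrite -[_ *: _]addr0 deriv_of_lin l0 addr0 -scaleN1r addrC deriv_of_lin.
    by rewrite deriv_ofC scaler0 add0r deriv_ofX.
  by rewrite mevalZ rform_e0 // cob eqxx mulr1.
have -> : deriv_of (rform (b k)) (l j *: ('X_j - (e0 j)%:MP)) = l j *: rform (b k) j.
  rewrite -[_ *: _]addr0 deriv_of_lin l0 addr0 -scaleN1r addrC deriv_of_lin.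
  by rewrite deriv_ofC scaler0 add0r deriv_ofX.
by rewrite mevalZ rform_e0 // cob (negPf jk) mulr0.
Qed.

Variables (phi : A -> endo F m) (phiP : is_alg_morph phi)
  (phiE : forall X, P X -> phi (iu X) = rop X).

(* g vanishes at the unit e0 of C, so an operator of order < k kills g ^+ k at e0, and
   one of order k sees only its symbol, evaluated at the linear form l. *)
Lemma phi_word w k : (size w <= k)%N -> exists2 q : MP,
  phi (word y w) (g ^+ k) = g ^+ (k - size w) * q &
  q.@[e0] = (k ^_ (size w))%:R * (mword F w).@[l].
Proof.
case: phiP => pD pM p1 pZ.
elim: w k => [|i w IH] k sk.
  exists 1; first by rewrite /word big_nil p1 subn0 mulr1.
  by rewrite /mword big_nil ffactn0 !rmorph1 mulr1.
have [q Eq qe] := IH k (ltnW sk).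
rewrite /word big_cons pM phiE //.
have -> : (rop (b i) * phi (word y w)) (g ^+ k) = rop (b i) (phi (word y w) (g ^+ k)) by [].
rewrite Eq.
have [p Ep] : exists p, (k - size w = p.+1)%N.
  by exists (k - size w).-1; rewrite prednK // subn_gt0.
have Ep' : (k - size (i :: w) = p)%N by rewrite /= subnS Ep.
rewrite Ep Ep' [rop _ _]deriv_ofM deriv_of_exp.
exists (p.+1%:R * deriv_of (rform (b i)) g * q + g * deriv_of (rform (b i)) q).
  by rewrite exprS; ring.
have := rop_g i; rewrite -[rop _ _]/(deriv_of _ _) => gi.
rewrite mevalD !mevalM g_e0 mul0r addr0 qe gi rmorph_nat /mword big_cons mevalM mevalXU.
rewrite ffactnSr natrM Ep; ring.
Qed.

Lemma phi_fil k a : fil y k a -> (phi a (g ^+ k)).@[e0] = 0.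
Proof.
case: phiP => pD pM p1 pZ; elim=> [|c w {}a sw _ IH].
  have -> : phi 0 = 0 by rewrite -(scale0r 1) pZ scale0r.
  exact: raddf0.
rewrite pD pZ [X in X.@[_]]/(c *: phi (word y w) (g ^+ k) + phi a (g ^+ k)).
rewrite mevalD mevalZ IH addr0.
have [q -> _] := phi_word (ltnW sw); rewrite mevalM rmorphXn /= g_e0.
by rewrite expr0n subn_eq0 leqNgt sw /= mul0r mulr0.
Qed.

Lemma phi_symb k a p : symb y k a p -> (phi a (g ^+ k)).@[e0] = k`!%:R * p.@[l].
Proof.
case: phiP => pD pM p1 pZ; elim=> [{}a fa|c w {}a {}p sw _ IH].
  by rewrite phi_fil // meval0 mulr0.
rewrite pD pZ [X in X.@[_]]/(c *: phi (word y w) (g ^+ k) + phi a (g ^+ k)).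
rewrite !mevalD !mevalZ IH.
have := @phi_word w k; rewrite sw leqnn => /(_ isT)[q -> qe].
by rewrite subnn expr0 mul1r qe ffactnn; ring.
Qed.

End Test.

(** This is the Poincare-Birkhoff-Witt theorem in the form used below. The symbol is read off some
    expression in words; it is well defined because [phi_symb] recovers k! times its value at every
    [l] from the action of the element. *)
Lemma symb_unique k p : symb y k 0 p -> p = 0.
Proof.
move=> sp; case: (HU) => _ _ /(_ _ _ ropL rop_lie) [[phi [phiP phiE]] _].
apply: mpoly_eq0_meval => // l.
have := phi_symb l phiP phiE sp.
have -> : phi 0 = 0 by case: phiP => _ _ _ pZ; rewrite -(scale0r 1) pZ scale0r.
rewrite meval0 => /esym/eqP; rewrite mulf_eq0 => /orP[|/eqP //].
by rewrite ((pcharf0P F).1 HF) -leqn0 leqNgt fact_gt0.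
Qed.

(** The derivation of S(g) extending the bracket with [X] on g; the common kernel over all [X] in g
    is the algebra of invariants. *)
Definition ad X : MP -> MP := deriv_of (fun k => lform (X *m b k - b k *m X)).

Lemma symb_ad X k a p : P X -> symb y k a p -> symb y k (iu X * a - a * iu X) (ad X p).
Proof.
move=> PX; case: (HU) => _ HL _.
have wd w : symb y (size w) (iu X * word y w - word y w * iu X) (ad X (mword F w)).
  elim: w => [|i w IH].
    rewrite /word /mword !big_nil mulr1 mul1r subrr /ad deriv_ofC; exact: symb0.
  rewrite /word /mword !big_cons -!/(word _ _) -!/(mword _ _) /ad deriv_ofM deriv_ofX.
  have -> : iu X * (y i * word y w) - y i * word y w * iu X =
    (iu X * y i - y i * iu X) * word y w + y i * (iu X * word y w - word y w * iu X).
    by rewrite mulrBl mulrBr !mulrA addrA subrK.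
  rewrite -[size _]/(1 + size w)%N; apply: symbD; apply: symbM => //.
  - by rewrite -HL //; apply/lin_form_symb/P_sub; apply: PM.
  - exact: symbwd.
  - by have := symbwd y [:: i]; rewrite /word /mword !big_seq1.
elim=> [{}a fa|c w {}a {}p sw _ IH].
  rewrite /ad -[deriv_of _ 0]/(deriv_of _ 0%:MP) deriv_ofC; apply: symb_low.
  elim: fa => [|c w {}a sw _ IH]; first by rewrite mulr0 mul0r subrr; apply: fil_zero.
  have -> : iu X * (c *: word y w + a) - (c *: word y w + a) * iu X =
    c *: (iu X * word y w - word y w * iu X) + (iu X * a - a * iu X).
    by rewrite mulrDr mulrDl -scalerAr -scalerAl opprD addrACA scalerBr.
  by apply: filL => //; apply: filW sw _; apply: symb_fil (wd w).
have -> : iu X * (c *: word y w + a) - (c *: word y w + a) * iu X =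
    c *: (iu X * word y w - word y w * iu X) + (iu X * a - a * iu X).
  by rewrite mulrDr mulrDl -scalerAr -scalerAl opprD addrACA scalerBr.
by rewrite /ad deriv_of_lin; apply: symbL => //; rewrite -sw.
Qed.

Lemma ad_central k a p X : P X -> in_center a -> symb y k a p -> ad X p = 0.
Proof.
move=> PX aC /(symb_ad PX); rewrite aC subrr; exact: symb_unique.
Qed.

(** * From invariant symbols to central elements *)

Section Center.
Variables (M : nat) (z : 'I_M -> A) (d : 'I_M -> nat) (x : 'I_M -> MP).
Hypotheses (zC : forall r, in_center (z r)) (zx : forall r, symb y (d r) (z r) (x r)).
Variables (v : m.-tuple {mpoly F[M]}) (eps : 'I_M -> F).
Hypotheses (eps0 : forall r, eps r != 0) (xv : forall r, x r \mPo v = eps r *: 'X_r)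
  (vanish : forall f, (forall k, ad (b k) f = 0) -> f \mPo v = 0 -> f = 0).

(** The filtration degree of the monomial in the z_r with exponents [u]. *)
Let wt (u : 'X_{1..M}) := (\sum_(r <- index_enum 'I_M) d r * u r)%N.
Let xeval (p : {mpoly F[M]}) : MP := p \mPo [tuple x r | r < M].
Let xmon (u : 'X_{1..M}) := \prod_(r <- index_enum 'I_M) x r ^+ u r.
Let zmon (u : 'X_{1..M}) := \prod_(r <- index_enum 'I_M) z r ^+ u r.
Let wpart k (p : {mpoly F[M]}) := \sum_(u <- msupp p | wt u == k) p@_u *: 'X_[u].
Let unscale (p : {mpoly F[M]}) := p \mPo [tuple (eps r)^-1 *: 'X_r | r < M].

Lemma symb_mon u : symb y (wt u) (zmon u) (xmon u).
Proof. by apply: symb_prod => r _; apply: symbX. Qed.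

Lemma xeval_mon u : xeval 'X_[u] = xmon u.
Proof. by rewrite /xeval comp_mpolyX; apply: eq_bigr => r _; rewrite tnth_mktuple. Qed.

Lemma xevalL : is_linear_map xeval.
Proof. by move=> c p q; rewrite /xeval comp_mpolyD comp_mpolyZ. Qed.

Lemma symb_wpart k p : symb y k (zeval z (wpart k p)) (xeval (wpart k p)).
Proof.
have zL := @zeval_linear _ A M z.
have z0 : zeval z 0 = 0 by rewrite /zeval msupp0 big_nil.
rewrite /wpart; apply: (@big_ind _ (fun p => symb y k (zeval z p) (xeval p))).
- by rewrite z0 /xeval comp_mpoly0; apply: symb0.
- move=> q q' sq sq'; rewrite -[q]scale1r zL xevalL; exact: symbL.
- move=> u /eqP <-; rewrite -[_ *: _]addr0 zL xevalL z0 /xeval comp_mpoly0 !addr0.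
  by apply: symbZ; rewrite -/(xeval _) xeval_mon zevalX; apply: symb_mon.
Qed.

Lemma xeval_unscale p : xeval (unscale p) \mPo v = p.
Proof.
rewrite /xeval /unscale !comp_mpolyA -[RHS]comp_mpoly_id; congr (_ \mPo _).
apply: eq_mktuple => r; rewrite !tnth_mktuple comp_mpolyZ comp_mpolyXU -tnth_nth.
by rewrite !tnth_mktuple xv scalerA mulVf ?scale1r.
Qed.

(** A left inverse of [xeval]: the x_r are algebraically independent. *)
Lemma unscale_xeval p : unscale (xeval p \mPo v) = p.
Proof.
rewrite /xeval /unscale !comp_mpolyA -[RHS]comp_mpoly_id; congr (_ \mPo _).
apply: eq_mktuple => r; rewrite !tnth_mktuple -comp_mpolyA xv comp_mpolyZ comp_mpolyXU.
by rewrite -tnth_nth tnth_mktuple scalerA mulfV ?scale1r.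
Qed.

Lemma xeval_invariant p k : ad (b k) (xeval p) = 0.
Proof.
have ad0 : ad (b k) 0 = 0 by rewrite /ad -[deriv_of _ 0]/(deriv_of _ 0%:MP) deriv_ofC.
move: p; apply: mpoly_ring_ind => [c|r|p q Ep Eq|p q Ep Eq].
- by rewrite /xeval comp_mpolyC /ad deriv_ofC.
- rewrite /xeval comp_mpolyXU -tnth_nth tnth_mktuple.
  exact: (ad_central (Pb k) (zC r) (zx r)).
- by rewrite /xeval comp_mpolyD /ad deriv_ofD -!/(xeval _) -!/(ad _ _) Ep Eq addr0.
- rewrite /xeval rmorphM /ad deriv_ofM -!/(xeval _) -!/(ad _ _).
  by rewrite Ep Eq mulr0 mul0r addr0.
Qed.

(** Both sides agree on the slice by [xeval_unscale]; their difference is an invariant vanishing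
    there, hence 0. *)
Lemma invariant_xeval f : (forall k, ad (b k) f = 0) -> f = xeval (unscale (f \mPo v)).
Proof.
move=> fI; apply/eqP; rewrite -subr_eq0; apply/eqP/vanish => [k|].
  rewrite addrC -scaleN1r /ad deriv_of_lin -!/(ad _ _) fI addr0.
  by rewrite xeval_invariant scaler0.
by rewrite comp_mpolyB xeval_unscale subrr.
Qed.

(** x_r is homogeneous of degree [d r], so [xeval] sends the part of weight [k] to the component of
    degree [k]. A homogeneous invariant thus lifts to a combination of monomials in the z_r of
    filtration degree [k]. *)
Lemma xeval_homog k p : xeval p \is k.-homog -> xeval p = xeval (wpart k p).
Proof.
move=> hp; rewrite -(pihomog_dE hp) {1}[p]mpolyE.
have xD : {morph xeval : q r / q + r} by move=> q r; rewrite /xeval comp_mpolyD.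
have x0 : xeval 0 = 0 by rewrite /xeval comp_mpoly0.
have -> : wpart k p = \sum_(u <- msupp p) if wt u == k then p@_u *: 'X_[u] else 0.
  by rewrite /wpart big_mkcond.
rewrite !(big_morph _ xD x0) raddf_sum; apply: eq_bigr => u _ /=.
rewrite {1}/xeval comp_mpolyZ linearZ /= -/(xeval _) xeval_mon.
have hu := symb_homog (symb_mon u).
case: eqVneq => [<-|ne]; last by rewrite (pihomog_ne0 ne) // scaler0 x0.
by rewrite pihomog_dE // [in RHS]/xeval comp_mpolyZ -/(xeval _) xeval_mon.
Qed.

(** Induction on the filtration degree: the symbol of a central element is invariant, hence the
    symbol of some polynomial in the z_r; subtracting that leaves a central element of lower
    degree. *)
Theorem center_zeval a : in_center a -> exists p, zeval z p = a.
Proof.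
have [k] := generated a; elim: k a => [|k IH] a fa aC.
  by exists 0; rewrite (fil0 fa) /zeval msupp0 big_nil.
have [f sf] := filS_symb fa.
have fI i : ad (b i) f = 0 by apply: ad_central aC sf.
have Ef := invariant_xeval fI; set p := unscale _ in Ef.
have Ek : f = xeval (wpart k p).
  by rewrite {1}Ef; apply: xeval_homog; rewrite -Ef; apply: symb_homog sf.
have zL := @zeval_linear _ A M z.
have [q Eq] : exists q, zeval z q = a - zeval z (wpart k p).
  apply: IH.
    apply: (symb_zero_fil y_comm); rewrite -(subrr f) {2}Ek.
    by apply: symbB => //; apply: symb_wpart.
  have zCp q : in_center (zeval z q).
    rewrite /zeval => c; rewrite mulr_suml mulr_sumr; apply: eq_bigr => u _.
    rewrite -scalerAl -scalerAr; congr (_ *: _).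
    elim/big_ind: _ => [|s t sC tC|r _]; first by rewrite mulr1 mul1r.
      by rewrite -mulrA tC mulrA sC mulrA.
    by elim: (u r) => [|n IHn]; rewrite ?mulr1 ?mul1r // exprS -mulrA IHn !mulrA zC.
  by move=> c; rewrite mulrBl mulrBr aC zCp.
by exists (1 *: q + wpart k p); rewrite zL scale1r Eq subrK.
Qed.

Theorem zeval_inj : injective (zeval z).
Proof.
have zL := @zeval_linear _ A M z.
move=> p q Epq; apply/eqP; rewrite -subr_eq0; apply/eqP.
have {Epq}: zeval z (p - q) = 0.
  by rewrite addrC -scaleN1r zL Epq scaleN1r addNr.
move: (p - q) => {p q}p zp; apply/eqP; apply: contraT => p0.
have sp : msupp p != [::] by rewrite msupp_eq0.
have [u up umax] : exists2 u, u \in msupp p & forall t, t \in msupp p -> (wt t <= wt u)%N.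
  elim: (msupp p) sp => // u0 [|u1 s] IH _.
    by exists u0; rewrite ?mem_head // => t; rewrite inE => /eqP ->.
  have [//|u us umax] := IH; case: (leqP (wt u0) (wt u)) => [le|/ltnW le].
    exists u; first by rewrite inE us orbT.
    by move=> t; rewrite inE => /orP[/eqP ->|/umax].
  exists u0; first exact: mem_head.
  by move=> t; rewrite inE => /orP[/eqP -> //|/umax/leq_trans/(_ le)].
pose k := wt u.
have z0 : zeval z 0 = 0 by rewrite /zeval msupp0 big_nil.
(* [k] is the largest weight in [p]. Monomials of smaller weight have degree below [k], so in a
   relation the part of top weight has symbol 0, against the independence of the x_r. *)
have low : fil y k (zeval z (p - wpart k p)).
  rewrite {1}[p]mpolyE (bigID (fun t => wt t == k)) /= addrC addrK big_seq_cond.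
  apply: (@big_ind _ (fun q => fil y k (zeval z q))) => [|q q' fq fq'|t /andP[tp tk]].
  - by rewrite z0; apply: fil_zero.
  - by rewrite -[q]scale1r zL; apply: filL.
  - rewrite -[_ *: _]addr0 zL z0 addr0 zevalX; apply/filZ/(filW _ (symb_fil (symb_mon t))).
    by rewrite ltn_neqAle tk umax.
have : symb y k 0 (xeval (wpart k p)).
  have -> : 0 = 1 *: zeval z (p - wpart k p) + zeval z (wpart k p) :> A.
    by rewrite -zL scale1r subrK zp.
  rewrite -[xeval _]add0r -[X in X + xeval _](scaler0 _ 1).
  by apply: symbL; [apply: symb_low | apply: symb_wpart].
move/symb_unique => xw0; have := unscale_xeval (wpart k p).
rewrite xw0 /unscale !comp_mpoly0 => /esym/(congr1 (mcoeff u)).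
rewrite mcoeff0 /wpart raddf_sum /= big_mkcond (bigD1_seq u) ?msupp_uniq //=.
rewrite eqxx mcoeffZ mcoeffX eqxx mulr1 big1 ?addr0 => [pu|t tu].
  by move: up; rewrite mcoeff_msupp pu eqxx.
by case: ifP => // _; rewrite mcoeffZ mcoeffX (negPf tu) mulr0.
Qed.

End Center.
End Regular.
End PBW.

(** * The centralizer of a nilpotent matrix *)

Section Boxes.
Implicit Type lam : seq nat.

Lemma brow_lt lam h : (h < sumn lam)%N -> (brow lam h < size lam)%N.
Proof.
rewrite /brow; elim: lam h => [|a l IH] h //= hs.
by case: (ltnP h a) => // ah /=; apply: IH; rewrite ltn_subLR.
Qed.

Lemma bcol_lt lam h : (h < sumn lam)%N -> (bcol lam h < nth 0 lam (brow lam h))%N.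
Proof.
rewrite /brow /bcol; elim: lam h => [|a l IH] h //= hs.
by case: (ltnP h a) => // ah /=; apply: IH; rewrite ltn_subLR.
Qed.

Lemma box_eq lam h :
  (h < sumn lam)%N -> h = (sumn (take (brow lam h) lam) + bcol lam h)%N.
Proof.
rewrite /brow /bcol; elim: lam h => [|a l IH] h //= hs.
case: (ltnP h a) => // ah /=; rewrite -addnA -IH ?subnKC // ltn_subLR //.
Qed.

Lemma box_rcK lam i c : (i < size lam)%N -> (c < nth 0 lam i)%N ->
  (sumn (take i lam) + c < sumn lam)%N /\ box_rc lam (sumn (take i lam) + c) = (i, c).
Proof.
elim: lam i => [|a l IH] [|i] //= il cl; first by rewrite add0n cl ltn_addr.
have [lt E] := IH i il cl; rewrite -addnA ltn_add2l; split=> //.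
by rewrite ltnNge leq_addr /= addKn E.
Qed.

Lemma box_exists lam i c : (i < size lam)%N -> (c < nth 0 lam i)%N ->
  exists h : 'I_(sumn lam), brow lam h = i /\ bcol lam h = c.
Proof.
move=> il cl; have [lt E] := box_rcK il cl; exists (Ordinal lt).
by rewrite /brow /bcol /= E.
Qed.

Lemma box_inj lam (h k : 'I_(sumn lam)) :
  brow lam h = brow lam k -> bcol lam h = bcol lam k -> h = k.
Proof.
by move=> Er Ec; apply: val_inj; rewrite /= (box_eq (ltn_ord h)) Er Ec -box_eq.
Qed.

Lemma sum_box1 (V : nmodType) lam (h : 'I_(sumn lam)) (Q : pred 'I_(sumn lam)) (G : 'I_(sumn lam) -> V) :
  (forall x, Q x = (brow lam x == brow lam h) && (bcol lam x == bcol lam h)) ->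
  \sum_(x | Q x) G x = G h.
Proof.
move=> QE; rewrite (big_pred1 h) // => x; rewrite QE.
by apply/andP/eqP => [[/eqP ? /eqP ?]|-> //]; apply: box_inj.
Qed.

End Boxes.

Section Matrices.
Variables (F : fieldType) (lam : seq nat).
Local Notation n := (size lam).
Local Notation N := (sumn lam).
Local Notation L i := (nth 0%N lam i).
Local Notation row := (brow lam).
Local Notation col := (bcol lam).
Local Notation E := (Eijr F lam).
Local Notation e := (jordan_nil F lam).

(** The range lambda_j - min(lambda_i, lambda_j) <= r < lambda_j, without truncated subtraction. *)
Definition valid i j r := [&& (i < n)%N, (j < n)%N, (L j <= r + L i)%N & (r < L j)%N].

(** The bound on [s] provides the middle box: if [col p + r + s] is below [L k], then [col p + r] is
    below [L h]. Without it entries of the product could be missing. *)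
Lemma E_mul i j r h k s : (L k <= s + L h)%N ->
  E i j r *m E h k s = if j == h then E i k (r + s) else 0.
Proof.
move=> low; apply/matrixP => p q; rewrite !mxE.
have [jh|jh] := eqVneq j h; last first.
  rewrite mxE big1 // => x _; rewrite !mxE.
  by case: (row x =P j) => [->|_]; rewrite ?(negPf jh) ?andbF ?mul0r ?mulr0.
move: low; rewrite -{}jh mxE => low; case: (boolP [&& _, _ & _]) => [/and3P[/eqP rp /eqP rq /eqP cq]|H].
  have jn : (j < n)%N.
    rewrite ltnNge; apply/negP => nj; move: low; rewrite (nth_default _ nj).
    by have := bcol_lt (ltn_ord q); rewrite rq cq; lia.
  have cj : (col p + r < L j)%N.
    by have := bcol_lt (ltn_ord q); rewrite rq cq; lia.
  have [x [rx cx]] := box_exists jn cj.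
  rewrite (bigD1 x) //= big1 ?addr0 => [|z zx]; rewrite !mxE.
    by rewrite rp rx rq cx cq !eqxx addnA eqxx mulr1.
  rewrite rp eqxx /=; case: (row z =P j) => [rz|_]; last by rewrite /= mul0r.
  case: (col z =P _) => [cz|_]; last by rewrite /= mul0r.
  by move: zx; rewrite (box_inj (etrans rz (esym rx)) (etrans cz (esym cx))) eqxx.
rewrite big1 // => x _; rewrite !mxE -natrM mulnb.
case: andP => // -[/and3P[rp _ /eqP cx] /and3P[_ rq /eqP cq]].
by case/negP: H; rewrite rp rq cq cx addnA eqxx.
Qed.

Lemma E_ge i j r : (L j <= r)%N -> E i j r = 0.
Proof.
move=> jr; apply/matrixP => p q; rewrite !mxE.
case: (row q =P j) => [rq|_]; last by rewrite /= andbF.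
case: (col q =P _) => [cq|_]; last by rewrite !andbF.
by have := bcol_lt (ltn_ord q); rewrite rq cq; lia.
Qed.

Lemma jordan_nilE : e = \sum_(i < n) E i i 1.
Proof.
apply/matrixP => p q; rewrite summxE mxE.
rewrite (bigD1 (Ordinal (brow_lt (ltn_ord p)))) //= big1 ?addr0 => [|i ip]; rewrite !mxE.
  by rewrite eqxx eq_sym addn1.
by rewrite -val_eqE /= eq_sym in ip; rewrite (negPf ip).
Qed.

Local Notation P := (centralizer e).

Lemma centralizer_E i j r : (L j <= r + L i)%N -> (i < n)%N -> (j < n)%N -> P (E i j r).
Proof.
move=> low il jl; apply/eqP; rewrite jordan_nilE mulmx_sumr mulmx_suml.
rewrite (bigD1 (Ordinal jl)) //= big1 ?addr0 => [|k kj]; last first.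
  by rewrite E_mul ?leq_addl //; case: (j =P k :> nat) => // jk; case/eqP: kj; apply: val_inj; rewrite /= jk.
rewrite [RHS](bigD1 (Ordinal il)) //= [X in _ = _ + X]big1 ?addr0 => [|k ki]; last first.
  by rewrite E_mul //; case: (k =P i :> nat) => // jk; case/eqP: ki; apply: val_inj.
by rewrite !E_mul ?leq_addl // !eqxx addnC.
Qed.

Lemma centralizer1 : P 1%:M.
Proof. by rewrite /centralizer mul1mx mulmx1. Qed.

Lemma centralizerM X Y : P X -> P Y -> P (X *m Y).
Proof.
move=> /eqP PX /eqP PY; apply/eqP.
by rewrite -mulmxA PY mulmxA PX mulmxA.
Qed.

Lemma centralizerL c X Y : P X -> P Y -> P (c *: X + Y).
Proof.
move=> /eqP PX /eqP PY; apply/eqP.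
by rewrite mulmxDl mulmxDr -scalemxAl -scalemxAr PX PY.
Qed.

(** The coefficient of e_{i,j;r}, read at the first box of row [i]. Each sum has at most one term
    and is 0 if the box does not exist, so no ordinal has to be chosen. *)
Definition entry (i j r : nat) (X : 'M[F]_N) : F :=
  \sum_(h : 'I_N | (row h == i) && (col h == 0%N)) \sum_(k : 'I_N | (row k == j) && (col k == r)) X h k.

Lemma entryE (h k : 'I_N) X : col h = 0%N -> entry (row h) (row k) (col k) X = X h k.
Proof.
move=> h0; rewrite /entry (@sum_box1 _ _ h) => [|x]; last by rewrite h0.
by rewrite (@sum_box1 _ _ k).
Qed.

Lemma entryL i j r c X Y : entry i j r (c *: X + Y) = c * entry i j r X + entry i j r Y.
Proof.
rewrite /entry mulr_sumr -big_split; apply: eq_bigr => h _ /=.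
by rewrite mulr_sumr -big_split; apply: eq_bigr => k _ /=; rewrite !mxE.
Qed.

Lemma entry_E i j r i' j' r' : (i < n)%N -> (j < n)%N -> (0 < L i)%N -> (r < L j)%N ->
  entry i j r (E i' j' r') = ((i, j, r) == (i', j', r'))%:R.
Proof.
move=> il jl i0 rj; have [h [rh ch]] := box_exists il i0; have [k [rk ck]] := box_exists jl rj.
rewrite -{1}rh -{1}rk -{1}ck entryE // mxE rh rk ch ck add0n.
by rewrite !xpair_eqE andbA.
Qed.

(** * Entries of a matrix commuting with e *)

Section Entries.
Variable X : 'M[F]_N.
Hypothesis PX : P X.

(** The entry (h, k) of X e = e X. Each side has at most one term: the left neighbour of [k], or the
    right neighbour of [h]. *)
Let step (h k : 'I_N) :
  \sum_(x : 'I_N | (row x == row k) && (col k == (col x).+1)) X h x =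
  \sum_(x : 'I_N | (row x == row h) && (col x == (col h).+1)) X x k.
Proof.
move/eqP/matrixP/(_ h k): PX; rewrite !mxE => EX.
rewrite big_mkcond [RHS]big_mkcond /=; transitivity ((X *m e) h k).
  by rewrite mxE; apply: eq_bigr => x _; rewrite mxE; case: ifP; rewrite ?mulr1 ?mulr0.
rewrite mxE EX; apply: eq_bigr => x _; rewrite mxE eq_sym.
by case: ifP; rewrite ?mul1r ?mul0r.
Qed.

Lemma entry_shift (h k h' k' : 'I_N) : row h' = row h -> row k' = row k ->
  col h = (col h').+1 -> col k = (col k').+1 -> X h k = X h' k'.
Proof.
move=> rh rk ch ck; have := step h' k.
rewrite (@sum_box1 _ _ k') => [->|x]; last by rewrite rk ck eqSS [col k' == _]eq_sym.
by rewrite (@sum_box1 _ _ h) => [//|x]; rewrite rh ch.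
Qed.

Lemma entry_col0 (h k : 'I_N) : (0 < col h)%N -> col k = 0%N -> X h k = 0.
Proof.
move=> h0 k0; have hl := bcol_lt (ltn_ord h).
have [h' [rh ch]] : exists h' : 'I_N, row h' = row h /\ col h' = (col h).-1.
  by apply: box_exists; [apply: brow_lt | lia].
have := step h' k; rewrite big_pred0 => [E0|x]; last by rewrite k0 andbF.
by rewrite E0 (@sum_box1 _ _ h) // => x; rewrite rh ch prednK.
Qed.

Lemma entry_last (h k k' : 'I_N) : (col h).+1 = L (row h) -> row k' = row k ->
  col k = (col k').+1 -> X h k' = 0.
Proof.
move=> hl rk ck; have := step h k.
rewrite (@sum_box1 _ _ k') => [->|x]; last by rewrite rk ck eqSS [col k' == _]eq_sym.
rewrite big_pred0 // => x; apply/andP => -[/eqP rx /eqP cx].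
by have := bcol_lt (ltn_ord x); rewrite rx cx hl ltnn.
Qed.

Lemma entry_diag c (h k h' k' : 'I_N) : row h' = row h -> row k' = row k ->
  col h = (col h' + c)%N -> col k = (col k' + c)%N -> X h k = X h' k'.
Proof.
elim: c h k => [|c IH] h k rh rk.
  by rewrite !addn0 => ch ck; rewrite (box_inj rh (esym ch)) (box_inj rk (esym ck)).
rewrite !addnS => ch ck.
have hl := bcol_lt (ltn_ord h); have kl := bcol_lt (ltn_ord k).
have [|h1 [rh1 ch1]] := @box_exists lam (row h) (col h' + c) (brow_lt (ltn_ord h)).
  by lia.
have [|k1 [rk1 ck1]] := @box_exists lam (row k) (col k' + c) (brow_lt (ltn_ord k)).
  by lia.
rewrite (@entry_shift h k h1 k1) ?ch1 ?ck1 //.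
by apply: IH; rewrite ?rh1 ?rk1.
Qed.

Lemma entry_lt (h k : 'I_N) : (col k < col h)%N -> X h k = 0.
Proof.
move=> kh; have hl := bcol_lt (ltn_ord h); have kl := bcol_lt (ltn_ord k).
have [|h1 [rh1 ch1]] := @box_exists lam (row h) (col h - col k) (brow_lt (ltn_ord h)).
  by lia.
have [|k1 [rk1 ck1]] := @box_exists lam (row k) 0 (brow_lt (ltn_ord k)).
  by lia.
rewrite (@entry_diag (col k) h k h1 k1) //; [|lia|lia].
by apply: entry_col0 => //; lia.
Qed.

(** Slide along the diagonal until [h] becomes the last box of its row; the row of [k] still goes
    on, and [entry_last] gives 0. *)
Lemma entry_low (h k : 'I_N) : col h = 0%N -> (col k + L (row h) < L (row k))%N -> X h k = 0.
Proof.
move=> h0 low; have hl := bcol_lt (ltn_ord h); have kl := bcol_lt (ltn_ord k).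
have [|h1 [rh1 ch1]] := @box_exists lam (row h) (L (row h)).-1 (brow_lt (ltn_ord h)).
  by lia.
have [|k1 [rk1 ck1]] := @box_exists lam (row k) (col k + (L (row h)).-1) (brow_lt (ltn_ord k)).
  by lia.
have [|k2 [rk2 ck2]] := @box_exists lam (row k) (col k + (L (row h)).-1).+1 (brow_lt (ltn_ord k)).
  by lia.
rewrite -(@entry_diag (L (row h)).-1 h1 k1 h k) ?h0 //.
by apply: (@entry_last h1 k2 k1); rewrite ?rh1 ?rk2 //; lia.
Qed.

End Entries.

Definition triple := {x : 'I_n * 'I_n * 'I_N.+1 | valid x.1.1 x.1.2 x.2}.
Definition tri_row (x : triple) : nat := (val x).1.1.
Definition tri_col (x : triple) : nat := (val x).1.2.
Definition tri_deg (x : triple) : nat := (val x).2.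

Lemma triP (x : triple) : valid (tri_row x) (tri_col x) (tri_deg x).
Proof. by case: x. Qed.

Lemma part_le_sumn i : (L i <= N)%N.
Proof. by elim: lam i => [|a l IH] [|i] //=; [rewrite leq_addr | apply: leq_trans (IH i) (leq_addl _ _)]. Qed.

Lemma triple_ex i j r : valid i j r ->
  exists x : triple, [/\ tri_row x = i, tri_col x = j & tri_deg x = r].
Proof.
move=> v; have /and4P[il jl lo rj] := v.
have rN : (r < N.+1)%N by apply: leq_trans (leqW (part_le_sumn j)).
by exists (@exist _ _ (Ordinal il, Ordinal jl, Ordinal rN) v).
Qed.

Lemma triple_eq (x x' : triple) :
  (x == x') = ((tri_row x, tri_col x, tri_deg x) == (tri_row x', tri_col x', tri_deg x')).
Proof. by rewrite -val_eqE /=; case: x x' => [[[i j] r] v] [[[i' j'] r'] v']. Qed.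

Local Notation m := #|{: triple}|.
Definition tri (k : 'I_m) : triple := enum_val k.
Definition bas (k : 'I_m) : 'M[F]_N := E (tri_row (tri k)) (tri_col (tri k)) (tri_deg (tri k)).
Definition cob (k : 'I_m) : 'M[F]_N -> F :=
  entry (tri_row (tri k)) (tri_col (tri k)) (tri_deg (tri k)).

Hypothesis Lpos : all (fun x => 0 < x)%N lam.

Lemma L_gt0 i : (i < n)%N -> (0 < L i)%N.
Proof. by move=> il; apply: (allP Lpos); rewrite mem_nth. Qed.

Lemma bas_centralizer k : P (bas k).
Proof. by have /and4P[? ? ? ?] := triP (tri k); apply: centralizer_E. Qed.

Lemma cob_bas k l : cob k (bas l) = (k == l)%:R.
Proof.
have /and4P[il jl lo rj] := triP (tri k); rewrite /cob /bas entry_E ?L_gt0 //.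
by rewrite -triple_eq /tri (inj_eq enum_val_inj).
Qed.

Lemma cobL k c X Y : cob k (c *: X + Y) = c * cob k X + cob k Y.
Proof. exact: entryL. Qed.

Lemma centralizer_span X : P X -> X = \sum_k cob k X *: bas k.
Proof.
move=> PX; rewrite (reindex_onto enum_rank enum_val) /=; last by move=> ? _; apply: enum_valK.
rewrite (eq_bigl xpredT) => [|x]; last by rewrite enum_rankK eqxx.
rewrite (eq_bigr (fun x : triple => entry (tri_row x) (tri_col x) (tri_deg x) X *:
    E (tri_row x) (tri_col x) (tri_deg x))); last first.
  by move=> x _; rewrite /cob /bas /tri enum_rankK.
apply/matrixP => h k; rewrite summxE.
have [h0 [rh ch]] := box_exists (brow_lt (ltn_ord h)) (L_gt0 (brow_lt (ltn_ord h))).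
case: (ltnP (col k) (col h)) => [kh|hk].
  rewrite entry_lt // big1 // => x _; rewrite !mxE.
  case: (col k =P _) => [ck|_]; last by rewrite !andbF mulr0.
  by move: kh; rewrite ck; lia.
have kl := bcol_lt (ltn_ord k).
have [|k0 [rk ck]] := @box_exists lam (row k) (col k - col h) (brow_lt (ltn_ord k)).
  by lia.
(* Slide back to the first box of the row of [h], where [entry] reads the coefficient. *)
rewrite (@entry_diag _ PX (col h) h k h0 k0) ?ch ?ck ?subnK //.
case: (boolP (valid (row h) (row k) (col k - col h))) => [/triple_ex[x [rx cx dx]]|nv].
  rewrite (bigD1 x) //= big1 ?addr0 => [|z zx]; rewrite !mxE ?rx ?cx ?dx.
    by rewrite !eqxx subnKC // eqxx mulr1 -rh -rk -ck entryE.
  case: and3P => [[/eqP rz /eqP cz /eqP dz]|_]; last by rewrite mulr0.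
  move: zx; rewrite triple_eq rx cx dx -rz -cz !xpair_eqE !eqxx dz addKn eqxx //.
rewrite entry_low ?ch //; last first.
  rewrite rh rk ck ltnNge; apply: contra nv => lo; apply/and4P; split=> //; try exact: brow_lt.
  by apply: leq_ltn_trans kl; rewrite leq_subr.
rewrite big1 // => x _; rewrite !mxE; case: and3P => [[/eqP rz /eqP cz /eqP dz]|_]; last by rewrite mulr0.
by have := triP x; rewrite -rz -cz -[tri_deg x](addKn (col h)) -dz (negPf nv).
Qed.

End Matrices.

(** * Column determinants over noncommutative rings *)

Section OrderedProducts.
Variable R : nzRingType.
Implicit Types (d : nat).

(** In a noncommutative product a factor can only be isolated between a left and a right part, each
    depending on the factors of its own side. *)
Lemma prod_split d (p : 'I_d) : exists PL PR : ('I_d -> R) -> R,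
  [/\ forall g, \prod_(k < d) g k = PL g * g p * PR g,
      forall g g', (forall k : 'I_d, (k < p)%N -> g k = g' k) -> PL g = PL g'
    & forall g g', (forall k : 'I_d, (p < k)%N -> g k = g' k) -> PR g = PR g'].
Proof.
elim: d p => [[//]|d IH] p; case: (unliftP ord0 p) => [q|] ->.
  have [PL [PR [E1 E2 E3]]] := IH q.
  exists (fun g => g ord0 * PL (fun k => g (lift ord0 k))), (fun g => PR (fun k => g (lift ord0 k))).
  split=> [g|g g' E|g g' E].
  - by rewrite big_ord_recl E1 !mulrA.
  - by rewrite E //; congr (_ * _); apply: E2 => k kq; apply: E.
  - by apply: E3 => k kq; apply: E.
exists (fun=> 1), (fun g => \prod_(k < d) g (lift ord0 k)); split=> // [g|g g' E].
  by rewrite big_ord_recl mul1r.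
by apply: eq_bigr => k _; apply: E.
Qed.

Lemma prod_replace d (p : 'I_d) (g : 'I_d -> R) : exists PL PR : R,
  (forall u, \prod_(k < d) (if k == p then u else g k) = PL * u * PR) /\
  (forall g' : 'I_d -> R, (forall k, k != p -> g' k = g k) -> \prod_(k < d) g' k = PL * g' p * PR).
Proof.
have [PL [PR [E1 E2 E3]]] := prod_split p.
exists (PL g), (PR g); split=> [u|g' E]; rewrite E1.
  rewrite eqxx (E2 _ g) ?(E3 _ g) // => k; case: eqP => // ->; by rewrite ltnn.
by rewrite (E2 _ g) ?(E3 _ g) // => k kp; apply: E; apply: contraTneq kp => ->; rewrite ltnn.
Qed.

Lemma prod_zero d (p : 'I_d) (g : 'I_d -> R) : g p = 0 -> \prod_(k < d) g k = 0.
Proof.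
move=> g0; have [PL [PR [_ E]]] := prod_replace p g.
by rewrite (E g) // g0 mulr0 mul0r.
Qed.

Lemma prod_replace2 d (p q : 'I_d) (g : 'I_d -> R) : q = p.+1 :> nat -> exists PL PR : R,
  forall g' : 'I_d -> R, (forall k, k != p -> k != q -> g' k = g k) ->
    \prod_(k < d) g' k = PL * (g' p * g' q) * PR.
Proof.
elim: d p q g => [[//]|d IH] p q g.
case: (unliftP ord0 q) => [q'|] -> qp //.
case: (unliftP ord0 p) qp => [p'|] -> qp.
  have [] := IH p' q' (fun k => g (lift ord0 k)); first by case: qp.
  move=> PL [PR EP]; exists (g ord0 * PL), PR => g' E.
  rewrite big_ord_recl EP => [|k kp kq]; last by apply: E; rewrite (inj_eq (@lift_inj _ ord0)).
  by rewrite (E ord0) // !mulrA.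
case: d {p q} IH g q' qp => [|d] IH g q' qp; first by case: q' qp.
have {qp}-> : q' = ord0 by apply: val_inj; case: qp.
exists 1, (\prod_(k < d) g (lift ord0 (lift ord0 k))) => g' E.
rewrite !big_ord_recl mul1r -mulrA; congr (_ * (_ * _)).
by apply: eq_bigr => k _; apply: E.
Qed.

Lemma prod_commutator d (x : R) (g : 'I_d -> R) :
  x * (\prod_(k < d) g k) - (\prod_(k < d) g k) * x =
  \sum_l \prod_(k < d) (if k == l then x * g k - g k * x else g k).
Proof.
elim: d g => [|d IH] g; first by rewrite !big_ord0 mulr1 mul1r subrr.
rewrite !big_ord_recl /=.
have -> : \prod_(i < d) (if lift ord0 i == ord0 then x * g (lift ord0 i) - g (lift ord0 i) * x
    else g (lift ord0 i)) = \prod_(i < d) g (lift ord0 i) by apply: eq_bigr.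
rewrite [X in _ = _ + X](eq_bigr (fun l => g ord0 * \prod_(k < d) (if k == l then
    x * g (lift ord0 k) - g (lift ord0 k) * x else g (lift ord0 k)))); last first.
  by move=> l _; rewrite big_ord_recl.
rewrite -mulr_sumr -IH mulrBl mulrBr !mulrA; set P := \prod_(i < d) _.
by rewrite addrA subrK.
Qed.

End OrderedProducts.

Section ColumnDeterminant.
Variable R : nzRingType.
Implicit Types (d : nat) (M : nat -> nat -> R).

Definition cdetn d M : R := \sum_(w : 'S_d) (-1) ^+ w * \prod_(k < d) M (w k) k.

Lemma sgn_sum_cancel d (h : 'S_d -> 'S_d) (G : 'S_d -> R) : involutive h ->
  (forall w, odd_perm (h w) = ~~ odd_perm w) -> (forall w, G (h w) = G w) ->
  \sum_(w : 'S_d) (-1) ^+ w * G w = 0.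
Proof.
move=> hI ho hG; rewrite (bigID (@odd_perm _)) /= addrC.
rewrite [X in X + _](reindex_inj (inv_inj hI)) /=.
rewrite (eq_bigl (@odd_perm _)) => [|w]; last by rewrite ho negbK.
by rewrite -big_split big1 //= => w ow; rewrite hG ho ow expr0 expr1 mul1r mulN1r addrN.
Qed.

Lemma tperm_odd d (p q : 'I_d) : p != q -> forall w : 'S_d,
  odd_perm (w * tperm p q)%g = ~~ odd_perm w /\ odd_perm (tperm p q * w)%g = ~~ odd_perm w.
Proof. by move=> pq w; rewrite !odd_permM odd_tperm pq /= addbT. Qed.

(** Factors are ordered by columns, so exchanging two equal rows changes only the sign of each term.
    For equal columns this fails; see [eqm_cdetn_col_eq]. *)
Lemma cdetn_row_eq d M (p q : 'I_d) : p != q -> (forall k : 'I_d, M p k = M q k) ->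
  cdetn d M = 0.
Proof.
move=> pq E; apply: (@sgn_sum_cancel _ (fun w => (w * tperm p q)%g)) => w.
- by rewrite -mulgA tperm2 mulg1.
- by have [-> _] := tperm_odd pq w.
- by apply: eq_bigr => k _; rewrite permM; case: tpermP => [->|->|].
Qed.

Lemma eq_cdetn d M M' : (forall k l, (k < d)%N -> (l < d)%N -> M k l = M' k l) ->
  cdetn d M = cdetn d M'.
Proof.
by move=> E; apply: eq_bigr => w _; congr (_ * _); apply: eq_bigr => k _; apply: E.
Qed.

Lemma cdetn_row_lin d M (p : 'I_d) u v (c : R) : (forall x, GRing.comm c x) ->
  cdetn d (fun k l => if k == p then u l + c * v l else M k l) =
  cdetn d (fun k l => if k == p then u l else M k l) +
  c * cdetn d (fun k l => if k == p then v l else M k l).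
Proof.
move=> cC; rewrite /cdetn mulr_sumr -big_split; apply: eq_bigr => w _ /=.
rewrite mulrA (cC _) -mulrA -mulrDr; congr (_ * _).
pose q := (w^-1)%g p; have wq : w q = p by rewrite permKV.
have wE (k : 'I_d) : (w k == p :> nat) = (k == q).
  by rewrite (inj_eq val_inj) -wq (inj_eq perm_inj).
have [PL [PR [E _]]] := prod_replace q (fun k => M (w k) k).
have E' x : \prod_(k < d) (if (w k == p :> nat) then x (val k) else M (w k) k) = PL * x q * PR.
  rewrite -E; apply: eq_bigr => k _; rewrite wE; by case: eqP => // ->.
by rewrite (E' u) (E' v) (E' (fun l => u l + c * v l)) mulrDr mulrDl !mulrA (cC PL).
Qed.

Lemma cdetn_col_lin d M (p : 'I_d) u v (c : R) : (forall x, GRing.comm c x) ->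
  cdetn d (fun k l => if l == p then u k + c * v k else M k l) =
  cdetn d (fun k l => if l == p then u k else M k l) +
  c * cdetn d (fun k l => if l == p then v k else M k l).
Proof.
move=> cC; rewrite /cdetn mulr_sumr -big_split; apply: eq_bigr => w _ /=.
rewrite mulrA (cC _) -mulrA -mulrDr; congr (_ * _).
have [PL [PR [E _]]] := prod_replace p (fun k => M (w k) k).
have E' x : \prod_(k < d) (if (k == p :> nat) then x (val (w k)) else M (w k) k) = PL * x (w p) * PR.
  rewrite -E; apply: eq_bigr => k _; rewrite (inj_eq val_inj); by case: eqP => // ->.
by rewrite (E' u) (E' v) (E' (fun l => u l + c * v l)) mulrDr mulrDl !mulrA (cC PL).
Qed.

(** On either side only permutations with [w q = p] survive, with factor 1 in column [q]. *)
Lemma cdetn_unit_row_col d M (p q : 'I_d) :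
  cdetn d (fun k l => if k == p then (l == q)%:R else M k l) =
  cdetn d (fun k l => if l == q then (k == p)%:R else M k l).
Proof.
apply: eq_bigr => w _; congr (_ * _).
have [wq|wq] := eqVneq (w q) p.
  apply: eq_bigr => k _.
  have -> : (w k == p :> nat) = (k == q) by rewrite (inj_eq val_inj) -wq (inj_eq perm_inj).
  by rewrite (inj_eq val_inj); case: (k == q).
rewrite [RHS](prod_zero (p := q)) ?eqxx ?(inj_eq val_inj) ?(negPf wq) //.
apply: (prod_zero (p := (w^-1)%g p)); rewrite permKV eqxx (inj_eq val_inj).
by rewrite -(inj_eq (@perm_inj _ w)) permKV eq_sym (negPf wq).
Qed.

(* The two factors in the adjacent columns p, q are replaced by one factor [f i j] depending on both rows. *)
Definition cdet2 d M (p q : 'I_d) (f : nat -> nat -> R) : R :=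
  \sum_(w : 'S_d) (-1) ^+ w *
    \prod_(k < d) (if k == p then f (w p) (w q) else if k == q then 1 else M (w k) k).

Section AdjacentColumns.
Variables (d : nat) (M : nat -> nat -> R) (p q : 'I_d).
Hypothesis qp : q = p.+1 :> nat.

Let pq : p != q.
Proof. by rewrite -(inj_eq val_inj) /= qp neq_ltn ltnSn. Qed.

Lemma cdet2E (u v : nat -> R) :
  cdetn d (fun k l => if l == p then u k else if l == q then v k else M k l) =
  cdet2 M p q (fun i j => u i * v j).
Proof.
apply: eq_bigr => w _; congr (_ * _).
have [PL [PR E]] := prod_replace2 (fun k => M (w k) k) qp.
have ne (k r : 'I_d) : k != r -> (k == r :> nat) = false.
  by rewrite (inj_eq val_inj) => /negPf.
rewrite !E ?eqxx ?ne ?mulr1 //; first by rewrite eq_sym (negPf pq) mulr1.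
- by rewrite eq_sym.
- by move=> k /negPf-> /negPf->.
- by move=> k kp kq; rewrite !ne.
Qed.

Lemma cdet2_anti f : cdet2 M p q f = - cdet2 M p q (fun i j => f j i).
Proof.
rewrite /cdet2 (reindex_inj (mulgI (tperm p q))) /= -sumrN.
apply: eq_bigr => w _; have [_ ->] := tperm_odd pq w.
rewrite signrN mulNr; congr (- (_ * _)); apply: eq_bigr => k _.
rewrite !permM tpermL tpermR; case: ifP => // kp; case: ifP => // kq.
by rewrite tpermD // eq_sym ?kp ?kq.
Qed.

Lemma cdet2B f g : cdet2 M p q f - cdet2 M p q g = cdet2 M p q (fun i j => f i j - g i j).
Proof.
rewrite /cdet2 -sumrB; apply: eq_bigr => w _; rewrite -mulrBr; congr (_ * _).
have [PL [PR [/= E _]]] := prod_replace p (fun k => if k == q then 1 else M (w k) k).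
by rewrite !E -mulrBl -mulrBr.
Qed.

Lemma cdet2Z c f : (forall x, GRing.comm c x) ->
  cdet2 M p q (fun i j => c * f i j) = c * cdet2 M p q f.
Proof.
move=> cC; rewrite /cdet2 mulr_sumr; apply: eq_bigr => w _.
have [PL [PR [/= E _]]] := prod_replace p (fun k => if k == q then 1 else M (w k) k).
by rewrite !E [RHS]mulrA (cC (_ ^+ _)) -[RHS]mulrA; congr (_ * _); rewrite !mulrA (cC PL).
Qed.

Lemma cdetn_swap_col (u v : nat -> R) : (forall k l, GRing.comm (u k) (v l)) ->
  cdetn d (fun k l => if l == p then u k else if l == q then v k else M k l) =
  - cdetn d (fun k l => if l == p then v k else if l == q then u k else M k l).
Proof.
move=> uv; rewrite !cdet2E cdet2_anti; congr (- _); apply: eq_bigr => w _.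
by congr (_ * _); apply: eq_bigr => k _; rewrite uv.
Qed.

End AdjacentColumns.
End ColumnDeterminant.

(** * Congruences modulo X^m *)

Section Truncation.
Variable R : nzRingType.
Implicit Types (p q : {poly R}) (m : nat).

Definition eqm m p q := forall c, (c < m)%N -> p`_c = q`_c.

Lemma eqm_trans m p q r : eqm m p q -> eqm m q r -> eqm m p r.
Proof. by move=> E E' c cm; rewrite E // E'. Qed.
Lemma eqmD m p p' q q' : eqm m p p' -> eqm m q q' -> eqm m (p + q) (p' + q').
Proof. by move=> E E' c cm; rewrite !coefD E // E'. Qed.
Lemma eqmN m p p' : eqm m p p' -> eqm m (- p) (- p').
Proof. by move=> E c cm; rewrite !coefN E. Qed.
Lemma eqmB m p p' q q' : eqm m p p' -> eqm m q q' -> eqm m (p - q) (p' - q').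
Proof. by move=> E E'; apply/eqmD/eqmN. Qed.
Lemma eqmM m p p' q q' : eqm m p p' -> eqm m q q' -> eqm m (p * q) (p' * q').
Proof.
move=> E E' c cm; rewrite !coefM; apply: eq_bigr => j _; rewrite E ?E' //.
  by apply: leq_ltn_trans cm; rewrite leq_subr.
by apply: leq_ltn_trans cm; rewrite -ltnS.
Qed.
Lemma eqm_sum m (I : Type) (r : seq I) (Q : pred I) (f g : I -> {poly R}) :
  (forall i, Q i -> eqm m (f i) (g i)) ->
  eqm m (\sum_(i <- r | Q i) f i) (\sum_(i <- r | Q i) g i).
Proof. by move=> E; elim/big_ind2: _ => // *; apply: eqmD. Qed.
Lemma eqm_prod m (I : Type) (r : seq I) (Q : pred I) (f g : I -> {poly R}) :
  (forall i, Q i -> eqm m (f i) (g i)) ->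
  eqm m (\prod_(i <- r | Q i) f i) (\prod_(i <- r | Q i) g i).
Proof. by move=> E; elim/big_ind2: _ => // *; apply: eqmM. Qed.
Lemma eqm_Xn m k p : (m <= k)%N -> eqm m ('X^k * p) 0.
Proof. by move=> mk c cm; rewrite coefXnM (leq_trans cm mk) coef0. Qed.

(** By [cdet2_anti], twice the left side is a sum over commutators of entries of the repeated
    column. Their assumed form makes it twice [c] times a determinant with a unit column, and 2 can
    be cancelled. *)
Lemma eqm_cdetn_col_eq m d M (p q : 'I_d) (xi : nat -> {poly R}) (c : {poly R}) (r : nat) :
  (forall x : R, x *+ 2 = 0 -> x = 0) -> q = p.+1 :> nat -> (forall x, GRing.comm c x) ->
  (forall i j, (i < d)%N -> (j < d)%N -> eqm m (xi i * xi j - xi j * xi i)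
     (c * ((xi i * (j == r)%:R) - (xi j * (i == r)%:R)))) ->
  eqm m (cdetn d (fun k l => if l == p then xi k else if l == q then xi k else M k l))
   (c * cdetn d (fun k l => if l == p then xi k else if l == q then (k == r)%:R else M k l)).
Proof.
move=> H2 qp cC H; rewrite !cdet2E //.
set f := fun i j => xi i * xi j; set g := fun i j => xi i * (j == r)%:R.
have : eqm m (cdet2 M p q f *+ 2) ((c * cdet2 M p q g) *+ 2).
  rewrite !mulr2n {2}cdet2_anti // cdet2B.
  rewrite -mulrDr {2}[cdet2 M p q g]cdet2_anti // cdet2B -cdet2Z //.
  apply: eqm_sum => w _; apply: eqmM => //; apply: eqm_prod => k _.
  by case: ifP => // _; apply: H.
by move=> E k /E; rewrite !coefMn => /eqP; rewrite -subr_eq0 -mulrnBl => /eqP/H2/eqP;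
  rewrite subr_eq0 => /eqP.
Qed.

End Truncation.

(** * Commutators of column minors *)

Section Centrality.
Variables (F : fieldType) (lam : seq nat).
Local Notation n := (size lam).
Local Notation N := (sumn lam).
Local Notation L i := (nth 0%N lam i).
Local Notation P := (centralizer (jordan_nil F lam)).
Variables (A : algType F) (iu : 'M[F]_N -> A) (HU : is_UEA P iu).
Hypotheses (HF : [pchar F] =i pred0) (Lpos : all (fun x => 0 < x)%N lam).

(* Indexing e_{i,j;r} by the defect c = L j - 1 - r turns the adjoint action of e_{a,b;s}
   into multiplication by powers of 'X, modulo 'X^m when m <= L i and m <= L j. *)
Definition ee i j r : A := iu (Eijr F lam i j r).
Definition ft i j : {poly A} := \poly_(c < L j) etilde iu i j (L j - c.+1).
Definition fp i j : {poly A} := \poly_(c < L j) ee i j (L j - c.+1).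

Lemma ee_ge i j r : (L j <= r)%N -> ee i j r = 0.
Proof. by move=> jr; rewrite /ee E_ge // (iu0 HU). Qed.

Lemma ee_comm a b s i j r : valid lam a b s -> valid lam i j r ->
  ee a b s * ee i j r - ee i j r * ee a b s =
  (b == i)%:R * ee a j (s + r) - (j == a)%:R * ee i b (r + s).
Proof.
move=> /and4P[al bl lo1 _] /and4P[il jl lo2 _].
case: (HU) => _ HL _; rewrite /ee -HL; try exact: centralizer_E.
rewrite !E_mul // -scaleN1r addrC (iuL HU) scaleN1r addrC.
by case: (b == i); case: (j == a); rewrite ?mul1r ?mul0r ?(iu0 HU).
Qed.

Lemma coef_ft i j c : (c < L j)%N -> (ft i j)`_c = etilde iu i j (L j - c.+1).
Proof. by move=> cj; rewrite coef_poly cj. Qed.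

Lemma coef_fp i j c : (fp i j)`_c = if (c < L j)%N then ee i j (L j - c.+1) else 0.
Proof. by rewrite coef_poly. Qed.

Lemma ft_fp i j : (j < n)%N ->
  fp i j = ft i j + ((i == j)%:R * (i * L i)%:R * 'X^((L j).-1)) * 1.
Proof.
move=> jl; have L0 := L_gt0 Lpos jl; apply/polyP => c.
rewrite mulr1 coefD -natrM mulr_natl coefMn coefXn !coef_poly /etilde -/(ee _ _ _).
case: ltnP => cj; last first.
  by have -> : (c == (L j).-1) = false by [lia]; rewrite mul0rn addr0.
have -> : (L j - c.+1 == 0)%N = (c == (L j).-1) by lia.
case: (c == _); last by rewrite andbF mul0r subr0 mul0rn addr0.
by rewrite andbT -natrM (_ : true%:R = 1) // subrK.
Qed.

Lemma fp_neq i j : (j < n)%N -> i != j -> fp i j = ft i j.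
Proof. by move=> jl /negPf ij; rewrite ft_fp // ij !mul0r addr0. Qed.

Lemma etilde_comm a b s i j r : valid lam a b s -> valid lam i j r ->
  ee a b s * etilde iu i j r - etilde iu i j r * ee a b s =
  (b == i)%:R * ee a j (s + r) - (j == a)%:R * ee i b (r + s).
Proof.
move=> v1 v2; rewrite /etilde -/(ee _ _ _) -ee_comm // -natrM.
by rewrite mulrBr mulrBl mulr_natr mulr_natl opprB addrA subrK.
Qed.

Lemma etilde_comm2 a b s i j r : valid lam a b s -> valid lam i j r ->
  etilde iu a b s * etilde iu i j r - etilde iu i j r * etilde iu a b s =
  (b == i)%:R * ee a j (s + r) - (j == a)%:R * ee i b (r + s).
Proof.
move=> v1 v2; rewrite -etilde_comm //; move: (etilde iu i j r) => x.
rewrite /etilde -/(ee _ _ _) -natrM.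
by rewrite mulrBr mulrBl mulr_natr mulr_natl opprB addrA subrK.
Qed.

Lemma valid_coef i j c m : (i < n)%N -> (j < n)%N -> (m <= L i)%N -> (m <= L j)%N ->
  (c < m)%N -> valid lam i j (L j - c.+1).
Proof. by move=> il jl mi mj cm; apply/and4P; split=> //; lia. Qed.

(** If e_{i,j;r} has defect [c], then e_{a,j;s+r} has defect [c - s], and e_{i,b;r+s} with j = a has
    defect [c - (s + L a - L b)]; validity makes the last exponent nonnegative. Below [m] every
    index is valid, so [etilde_comm] applies; the constants drop out, whence [fp] on the right. *)
Lemma ft_comm m a b s i j : valid lam a b s -> (i < n)%N -> (j < n)%N ->
  (m <= L i)%N -> (m <= L j)%N ->
  eqm m ((ee a b s)%:P * ft i j - ft i j * (ee a b s)%:P)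
    ((b == i)%:R * ('X^s * fp a j) - (a == j)%:R * ('X^(s + L a - L b) * fp i b)).
Proof.
move=> v il jl mi mj c cm; have /and4P[al bl lo sb] := v.
have cj : (c < L j)%N by lia.
rewrite coefB coefCM coefMC coef_ft // etilde_comm //; last exact: valid_coef cm.
rewrite coefB !mulr_natl !coefMn !coefXnM !coef_fp [a == j]eq_sym; congr (_ - _).
  case: (b == i) => //; rewrite !mulr1n; case: ltnP => cs; first by rewrite ee_ge //; lia.
  by rewrite (_ : (c - s < L j)%N); [congr (ee _ _ _); lia | lia].
case: eqP => // ja; rewrite !mulr1n; case: ltnP => cs; first by rewrite ee_ge //; subst j; lia.
by rewrite (_ : (c - (s + L a - L b) < L b)%N); [congr (ee _ _ _); subst j; lia | subst j; lia].
Qed.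

(** In degree [c] all [c + 1] commutators coincide, with index 2 L_b - 2 - c. This is out of range
    for [c < L b - 1], and [m] cuts off [c >= L b]; at [c = L b - 1] there are [L b] equal terms.
    Hence the factor lambda_i in the shift. *)
Lemma ft_col_comm m i j b : (i < n)%N -> (j < n)%N -> (b < n)%N ->
  (m <= L i)%N -> (m <= L j)%N -> (m <= L b)%N ->
  eqm m (ft i b * ft j b - ft j b * ft i b)
    (((L b)%:R * 'X^((L b).-1)) * (ft i b * (j == b)%:R - ft j b * (i == b)%:R)).
Proof.
move=> il jl bl mi mj mb c cm; have L0 := L_gt0 Lpos bl.
rewrite coefB coefM coefMr -sumrB.
rewrite (eq_bigr (fun k : 'I_c.+1 => (b == j)%:R * ee i b (L b - 1 + (L b - c.+1)) -
   (b == i)%:R * ee j b (L b - 1 + (L b - c.+1)))); last first.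
  move=> k _; have kc := ltn_ord k; rewrite !coef_ft; try lia.
  rewrite etilde_comm2; try (apply: valid_coef; eauto; lia).
  by congr (_ * ee _ _ _ - _ * ee _ _ _); lia.
rewrite sumr_const card_ord -[in RHS]mulrA [in RHS]mulr_natl [in RHS]coefMn [in RHS]coefXnM.
case: ltnP => cb; first by rewrite !ee_ge ?mulr0 ?subrr ?mul0rn //; lia.
have -> : c = (L b).-1 by lia.
rewrite prednK // !subnn addn0 subn1; congr (_ *+ _).
rewrite coefB !mulr_natr !coefMn !coef_ft // subn1 ![b == _]eq_sym.
have [->|ib] := eqVneq i b; have [->|jb] := eqVneq j b;
  rewrite ?mul1r ?mul0r ?mulr1n ?mulr0n ?subrr ?subr0 ?sub0r //.
  by rewrite /etilde (negPf jb) mul0r subr0.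
by rewrite /etilde (negPf ib) mul0r subr0.
Qed.


Definition minor_det (s : seq nat) : {poly A} :=
  cdetn (size s) (fun k l => ft (nth 0%N s k) (nth 0%N s l)).

Lemma commXn (k : nat) (x : {poly A}) : GRing.comm 'X^k x.
Proof. by rewrite /GRing.comm -commr_polyXn. Qed.

Lemma two_torsion_free (x : A) : x *+ 2 = 0 -> x = 0.
Proof.
rewrite -scaler_nat => /eqP; rewrite scaler_eq0 => /orP[|/eqP //].
by rewrite ((pcharf0P F).1 HF).
Qed.

Section MinorCommutator.
Variables (m : nat) (s : seq nat) (a b r : nat).
Hypotheses (us : uniq s) (sn : forall i, i \in s -> (i < n)%N)
  (sm : forall i, i \in s -> (m <= L i)%N) (v : valid lam a b r).

Let d := size s.
Let M k l := ft (nth 0%N s k) (nth 0%N s l).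
Let x := (ee a b r)%:P.

(** The substituted row carries [fp] because constants vanish in commutators. It differs from [ft]
    only where row and column index coincide. *)
Definition row_part : {poly A} := if b \in s then
  'X^r * cdetn d (fun k l => if k == index b s then fp a (nth 0%N s l) else M k l) else 0.
Definition col_part : {poly A} := if a \in s then
  'X^(r + L a - L b) * cdetn d (fun k l => if l == index a s then fp (nth 0%N s k) b else M k l)
  else 0.

(** By the Leibniz rule a term arises from each factor with row index [b] or column index [a]; these
    collect into the two substituted determinants. *)
Lemma minor_det_comm : eqm m (x * minor_det s - minor_det s * x) (row_part - col_part).
Proof.
pose U (w : 'S_d) (l : 'I_d) : {poly A} :=
  (b == nth 0%N s (w l))%:R * ('X^r * fp a (nth 0%N s l)).
pose V (w : 'S_d) (l : 'I_d) : {poly A} :=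
  (a == nth 0%N s l)%:R * ('X^(r + L a - L b) * fp (nth 0%N s (w l)) b).
pose rp (w : 'S_d) (l : 'I_d) u := \prod_(k < d) (if k == l then u else M (w k) k).
have rpE w l : exists PL PR, forall u, rp w l u = PL * u * PR.
  by have [PL [PR [E _]]] := prod_replace l (fun k : 'I_d => M (w k) k); exists PL, PR.
have rp0 w l : rp w l 0 = 0.
  by have [PL [PR ->]] := rpE w l; rewrite mulr0 mul0r.
have rpX w l k u : rp w l ('X^k * u) = 'X^k * rp w l u.
  have [PL [PR E]] := rpE w l; by rewrite !E !mulrA (commXn k PL).
have ordP (k : nat) : (k < d)%N -> nth 0%N s k \in s by apply: mem_nth.
apply: (@eqm_trans _ _ _ (\sum_(w : 'S_d) (-1) ^+ w *
    (\sum_l rp w l (U w l) - \sum_l rp w l (V w l)))).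
  rewrite /minor_det mulr_sumr mulr_suml -sumrB; apply: eqm_sum => w _.
  rewrite [x * _]mulrA (commr_sign x w) -!mulrA -mulrBr; apply: eqmM => //.
  rewrite prod_commutator -sumrB; apply: eqm_sum => l _.
  have [PL [PR E]] := rpE w l; rewrite !E -mulrBl -mulrBr.
  apply: (@eqm_trans _ _ _ (rp w l (x * M (w l) l - M (w l) l * x))).
    by rewrite /rp; apply: eqm_prod => k _; case: eqP => [->|_].
  rewrite E; apply: eqmM => //; apply: eqmM => //.
  by apply: ft_comm => //; rewrite ?sn ?sm ?ordP.
move=> c _; congr (_`_c).
under eq_bigr => w _ do rewrite mulrBr.
rewrite sumrB.
suff [-> ->] : \sum_(w : 'S_d) (-1) ^+ w * (\sum_l rp w l (U w l)) = row_part /\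
  \sum_(w : 'S_d) (-1) ^+ w * (\sum_l rp w l (V w l)) = col_part by [].
split.
  rewrite /row_part; case: ifP => bs; last first.
    rewrite big1 // => w _; rewrite big1 ?mulr0 // => l _.
    rewrite /U; case: eqP => [E|_]; last by rewrite mul0r rp0.
    by move: bs; rewrite E ordP.
  have kd : (index b s < d)%N by rewrite index_mem.
  pose kb := Ordinal kd.
  rewrite /cdetn mulr_sumr; apply: eq_bigr => w _.
  rewrite mulrA (commXn r) -mulrA; congr (_ * _).
  have UE l : (b == nth 0%N s (w l)) = (l == (w^-1)%g kb).
    rewrite -(inj_eq (@perm_inj _ w)) permKV -(inj_eq val_inj) /=.
    by rewrite -{1}(nth_index 0%N bs) nth_uniq // eq_sym.
  rewrite (bigD1 ((w^-1)%g kb)) //= big1 ?addr0 => [|l lw]; last first.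
    by rewrite /U UE (negPf lw) mul0r rp0.
  rewrite /U UE eqxx mul1r rpX /rp; congr (_ * _); apply: eq_bigr => k _.
  have -> : (w k == index b s :> nat) = (k == (w^-1)%g kb).
    by rewrite -UE -{2}(nth_index 0%N bs) nth_uniq // eq_sym.
  by case: eqP => // ->.
rewrite /col_part; case: ifP => ja; last first.
  rewrite big1 // => w _; rewrite big1 ?mulr0 // => l _.
  rewrite /V; case: eqP => [E|_]; last by rewrite mul0r rp0.
  by move: ja; rewrite E ordP.
have kd : (index a s < d)%N by rewrite index_mem.
pose ka := Ordinal kd.
rewrite /cdetn mulr_sumr; apply: eq_bigr => w _.
rewrite mulrA (commXn _) -mulrA; congr (_ * _).
have VE (l : 'I_d) : (a == nth 0%N s l) = (l == ka).
  by rewrite -(inj_eq val_inj) /= -{1}(nth_index 0%N ja) nth_uniq // eq_sym.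
rewrite (bigD1 ka) //= big1 ?addr0 => [|l lw]; last first.
  by rewrite /V VE (negPf lw) mul0r rp0.
rewrite /V VE eqxx mul1r rpX /rp; congr (_ * _); apply: eq_bigr => k _.
have -> : (k == index a s :> nat) = (k == ka) by rewrite -(inj_eq val_inj).
by case: eqP => // ->.
Qed.

Hypothesis al : (a < n)%N.
Hypothesis bl : (b < n)%N.

(** For a = b both substitutions only change [ft] into [fp] at the diagonal entry (a, a). *)
Lemma minor_det_comm_diag : a = b -> eqm m (x * minor_det s) (minor_det s * x).
Proof.
move=> ab; have H : row_part - col_part = 0.
  rewrite /row_part /col_part -ab addnK; case: ifP => as_; rewrite ?subrr //.
  apply/eqP; rewrite subr_eq0; apply/eqP; congr (_ * _).
  apply: eq_bigr => w _; congr (_ * _); apply: eq_bigr => k _.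
  have E (l : 'I_d) : (l == index a s :> nat) = (nth 0%N s l == a).
    by rewrite -{2}(nth_index 0%N as_) nth_uniq // index_mem.
  rewrite !E; case: eqP => [wa|wa]; case: eqP => [ka|ka] //.
  - by rewrite wa ka.
  - by rewrite /M wa fp_neq ?sn ?mem_nth //; apply/eqP => /esym.
  - by rewrite /M ka fp_neq //; apply/eqP.
by move=> c cm; apply/eqP; rewrite -subr_eq0 -coefB minor_det_comm // H coef0.
Qed.

Lemma minor_det_comm_notin : a \notin s -> b \notin s -> eqm m (x * minor_det s) (minor_det s * x).
Proof.
move=> as_ bs c cm; apply/eqP; rewrite -subr_eq0 -coefB minor_det_comm //.
by rewrite /row_part /col_part (negPf as_) (negPf bs) subrr coef0.
Qed.

(* Three terms survive: the shifts of the two diagonal entries and the commutators of two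
   equal adjacent columns. They cancel if L a = L b and are beyond the truncation otherwise. *)
Lemma minor_det_comm_in : a \in s -> b \in s ->
  (index b s = (index a s).+1 /\ b = a.+1) \/ (index a s = (index b s).+1 /\ a = b.+1) ->
  eqm m (x * minor_det s) (minor_det s * x).
Proof.
move=> as_ bs adj; have kad : (index a s < d)%N by rewrite index_mem.
have kbd : (index b s < d)%N by rewrite index_mem.
pose ka := Ordinal kad; pose kb := Ordinal kbd.
have ab : a != b by case: adj => -[_ ->]; rewrite neq_ltn ltnSn ?orbT.
have kab : ka != kb.
  apply: contraNneq ab => /(congr1 val) /= E.
  by rewrite -(nth_index 0%N as_) -[X in _ == X](nth_index 0%N bs) E.
have idx c (l : nat) : c \in s -> (l < d)%N -> (nth 0%N s l == c) = (l == index c s).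
  by move=> cs ld; rewrite -{1}(nth_index 0%N cs) nth_uniq // index_mem.
have XC c k : forall y : {poly A}, GRing.comm (c%:R * 'X^k) y.
  move=> y; apply: commr_sym; apply: commrM; last exact/commr_sym/commXn.
  exact: commr_nat.
pose Q := cdetn d (fun k l => if l == index a s then (k == index b s)%:R else M k l).
(* Row [a] now occurs twice and contributes 0; of the substituted row only the shift of its entry in
   column [a] is left. *)
have rowE : row_part = 'X^r * ((a * L a)%:R * 'X^((L a).-1)) * Q.
  rewrite /row_part bs.
  rewrite (eq_cdetn (M' := fun k l => if k == kb then
      M ka l + ((a * L a)%:R * 'X^((L a).-1)) * (l == index a s)%:R else M k l)).
    rewrite cdetn_row_lin // (@cdetn_row_eq _ _ _ ka kb) ?add0r ?mulrA //.
      by congr (_ * _); exact: (cdetn_unit_row_col M kb ka).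
    move=> k; rewrite eqxx; case: eqP => // E; by rewrite E.
  move=> k l kd ld /=; case: eqP => // _.
  rewrite ft_fp ?sn ?mem_nth // /M nth_index // mulr1; congr (_ + _).
  rewrite eq_sym idx //; case: eqP => [E|_]; last by rewrite !mul0r mulr0.
  by rewrite E nth_index // mul1r mulr1.
pose xi k := M k (index b s).
pose T := cdetn d (fun k l => if l == index a s then xi k else M k l).
pose lb : {poly A} := (L b)%:R * 'X^((L b).-1).
have colE : col_part =
    'X^(r + L a - L b) * (T + ((b * L b)%:R * 'X^((L b).-1)) * Q).
  rewrite /col_part as_; congr (_ * _).
  rewrite -(@cdetn_col_lin _ _ _ ka xi) //; apply: eq_cdetn => k l kd ld /=.
  case: eqP => // _; rewrite ft_fp // /xi /M nth_index // mulr1; congr (_ + _).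
  rewrite idx //; case: eqP => [E|_]; last by rewrite !mul0r mulr0.
  by rewrite E nth_index // mul1r mulr1.
have xiH i j : (i < d)%N -> (j < d)%N -> eqm m (xi i * xi j - xi j * xi i)
   (lb * ((xi i * (j == index b s)%:R) - (xi j * (i == index b s)%:R))).
  move=> id jd; rewrite -!idx // /xi /M nth_index //.
  by apply: ft_col_comm; rewrite ?sn ?sm ?mem_nth.
have e01 k l : GRing.comm (xi k) ((l == index b s)%:R : {poly A}) by exact: commr_nat.
have L0a := L_gt0 Lpos al; have L0b := L_gt0 Lpos bl.
have /and4P[_ _ lo _] := v.
suff H : eqm m (row_part - col_part) 0.
  by move=> c cm; apply/eqP; rewrite -subr_eq0 -coefB minor_det_comm // H // coef0.
have T1 : (b = a.+1 /\ eqm m T (lb * (- Q))) \/ (a = b.+1 /\ eqm m T (lb * Q)).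
  case: adj => -[adj ba]; [left|right]; split=> //.
    have -> : T = cdetn d (fun k l => if l == ka then xi k else if l == kb then xi k else M k l).
      by apply: eq_cdetn => k l _ _ /=; case: eqP => // _; case: eqP => // ->.
    have -> : - Q = cdetn d (fun k l => if l == ka then xi k else
        if l == kb then (k == index b s)%:R else M k l).
      rewrite (@cdetn_swap_col _ d M ka kb adj xi (fun k => (k == index b s)%:R)) //.
      congr (- _); apply: eq_cdetn => k l _ _ /=.
      by case: eqP => // _; case: eqP => // ->.
    exact: (@eqm_cdetn_col_eq _ m d M ka kb xi lb _ two_torsion_free adj (XC _ _) xiH).
  have -> : T = cdetn d (fun k l => if l == kb then xi k else if l == ka then xi k else M k l).
    apply: eq_cdetn => k l _ _ /=; case: (l =P index b s) => [->|_ //].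
    by case: eqP.
  have -> : Q = cdetn d (fun k l => if l == kb then xi k else
      if l == ka then (k == index b s)%:R else M k l).
    apply: eq_cdetn => k l _ _ /=; case: (l =P index b s) => [->|_ //].
    by rewrite adj -[X in X == _]add0n -addn1 addnC eqn_add2l.
  exact: (@eqm_cdetn_col_eq _ m d M kb ka xi lb _ two_torsion_free adj (XC _ _) xiH).
have Xsh k l c (u : {poly A}) : 'X^k * (c%:R * 'X^l * u) = 'X^(k + l) * (c%:R * u).
  by rewrite -[c%:R * 'X^l]commXn -mulrA mulrA -exprD.
have [Lab|Lab] := eqVneq (L a) (L b); last first.
  have big : (m <= r + (L a).-1)%N.
    by have := sm as_; have := sm bs; lia.
  have z1 : eqm m row_part 0 by rewrite rowE -mulrA Xsh; apply: eqm_Xn.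
  have z2 c (u : {poly A}) : eqm m ('X^(r + L a - L b) * (c%:R * 'X^((L b).-1) * u)) 0.
    by rewrite Xsh; apply: eqm_Xn; lia.
  have [u Tu] : exists u, eqm m T (lb * u) by case: T1 => -[_ E]; eexists; exact: E.
  rewrite -(subrr (0 : {poly A})) colE mulrDr; apply: eqmB; first exact: z1.
  rewrite -[X in eqm _ _ X]addr0; apply: eqmD; last exact: z2.
  apply: (@eqm_trans _ _ _ ('X^(r + L a - L b) * (lb * u))); last exact: z2.
  exact: eqmM.
(* With L = [L b] the coefficients are a L - (-L + b L) = 0 for b = a + 1, and a L - (L + b L) = 0
   for a = b + 1. *)
rewrite rowE colE Lab addnK -mulrA -mulrBr -(mulr0 'X^r); apply: eqmM => //.
have XE c (u : {poly A}) : c%:R * 'X^((L b).-1) * u = 'X^((L b).-1) * (u *+ c).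
  by rewrite -[c%:R * _]commXn -mulrA mulr_natl.
case: T1 => -[E ET].
  apply: (@eqm_trans _ _ _ ((a * L b)%:R * 'X^((L b).-1) * Q -
     (lb * (- Q) + (b * L b)%:R * 'X^((L b).-1) * Q))).
    by apply: eqmB => //; apply: eqmD.
  move=> c _; congr (_`_c); rewrite /lb !XE -mulrDr -mulrBr E mulSn.
  by rewrite mulNrn mulrnDr addrA addNr add0r subrr mulr0.
apply: (@eqm_trans _ _ _ ((a * L b)%:R * 'X^((L b).-1) * Q -
   (lb * Q + (b * L b)%:R * 'X^((L b).-1) * Q))).
  by apply: eqmB => //; apply: eqmD.
move=> c _; congr (_`_c); rewrite /lb !XE -mulrDr -mulrBr E mulSn.
by rewrite mulrnDr subrr mulr0.
Qed.

End MinorCommutator.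
End Centrality.

(** * The elements z_r as coefficients of column minors *)

Section Subcompositions.
Implicit Types (lam mu : seq nat).

Lemma mem_subcomps lam mu : (mu \in subcomps lam) =
  (size mu == size lam) && all2 leq mu lam.
Proof.
elim: lam mu => [|a l IH] mu; first by case: mu.
have -> : subcomps (a :: l) = flatten [seq [seq x :: s | s <- subcomps l] | x <- iota 0 a.+1] by [].
apply/flatten_mapP/idP => [[x]|].
  rewrite mem_iota add0n ltnS => /= xa /mapP[s]; rewrite IH => /andP[ss sl] ->.
  by rewrite /= eqSS ss xa.
case: mu => [|x s] // /andP[ss H]; have /andP[xa sl] : (x <= a)%N && all2 leq s l := H.
exists x; first by rewrite mem_iota add0n ltnS xa.
by apply/mapP; exists s; rewrite // IH -eqSS sl andbT.
Qed.

Lemma subcompsP lam mu : reflect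
  (size mu = size lam /\ forall j, (nth 0%N mu j <= nth 0%N lam j)%N) (mu \in subcomps lam).
Proof.
rewrite mem_subcomps; apply: (iffP andP) => [[/eqP ss]|[ss H]].
  elim: mu lam ss => [|x s IH] [|a l] //=.
  move=> [ss] /andP[xa sl]; have [_ H] := IH l ss sl.
  by split; [rewrite ss | case].
split; first exact/eqP.
elim: mu lam ss H => [|x s IH] [|a l] //= [ss] H; rewrite (H 0%N) /=.
by apply: IH => // j; apply: (H j.+1).
Qed.

Lemma uniq_subcomps lam : uniq (subcomps lam).
Proof.
elim: lam => [|a l IH] //.
have -> : subcomps (a :: l) = flatten [seq [seq x :: s | s <- subcomps l] | x <- iota 0 a.+1] by [].
apply: allpairs_uniq => [||[x s] [x' s'] _ _ [-> ->]] //.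
exact: iota_uniq.
Qed.

Variable n : nat.

Definition set_seq (I : {set 'I_n}) : seq nat := [seq val i | i <- enum I].

Definition supp mu : {set 'I_n} := [set i : 'I_n | nth 0%N mu i != 0%N].

Lemma set_seqE (I : {set 'I_n}) (a : pred nat) : (forall i : 'I_n, (i \in I) = a i) ->
  set_seq I = [seq i <- iota 0 n | a i].
Proof.
move=> aE; rewrite /set_seq /enum_mem -enumT.
rewrite (eq_filter (a2 := preim val a)) => [|i]; last by rewrite /= aE.
by rewrite -filter_map val_enum_ord.
Qed.

Lemma set_seq_supp mu : size mu = n ->
  [seq i <- iota 0 (size mu) | nth 0%N mu i != 0%N] = set_seq (supp mu).
Proof. by move=> ->; rewrite (@set_seqE _ (fun i => nth 0%N mu i != 0%N)) // => i; rewrite inE. Qed.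

Lemma size_set_seq I : size (set_seq I) = #|I|.
Proof. by rewrite size_map cardE. Qed.

Lemma uniq_set_seq I : uniq (set_seq I).
Proof. by rewrite map_inj_uniq ?enum_uniq //; apply: val_inj. Qed.

Lemma mem_set_seq I (i : 'I_n) : (val i \in set_seq I) = (i \in I).
Proof. by rewrite mem_map ?mem_enum //; apply: val_inj. Qed.

Lemma set_seq_lt I j : j \in set_seq I -> (j < n)%N.
Proof. by case/mapP => i _ ->; apply: ltn_ord. Qed.

Lemma sorted_set_seq I : sorted ltn (set_seq I).
Proof.
rewrite (@set_seqE _ (fun j => j \in set_seq I)) => [|i]; last by rewrite mem_set_seq.
by apply: sorted_filter; [apply: ltn_trans | apply: iota_ltn_sorted].
Qed.

Lemma sum_set_seq (I : {set 'I_n}) (f : nat -> nat) :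
  (\sum_(i in I) f i = \sum_(k < size (set_seq I)) f (nth 0%N (set_seq I) k))%N.
Proof.
rewrite -[LHS]big_enum -(big_map val xpredT f) /=.
by rewrite -/(set_seq I) (big_nth 0%N) big_mkord.
Qed.

Lemma ell_supp mu : size mu = n -> ell mu = #|supp mu|.
Proof.
move=> sn; rewrite -size_set_seq -set_seq_supp // size_filter /ell.
by rewrite -{1}(mkseq_nth 0%N mu) /mkseq count_map.
Qed.

Lemma sumn_supp mu : size mu = n -> sumn mu = (\sum_(i in supp mu) nth 0%N mu i)%N.
Proof.
move=> sn; rewrite sumnE (big_nth 0%N) sn big_mkord [RHS]big_mkcond /=.
by apply: eq_bigr => i _; rewrite inE; case: eqP.
Qed.

Variable lam : seq nat.
Hypothesis sl : size lam = n.
Local Notation L i := (nth 0%N lam i).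
Local Notation N := (sumn lam).
Variables (I : {set 'I_n}) (R : nat).
Hypothesis RN : (R <= N)%N.
Let s := set_seq I.
Let d := size s.
Let LI := (\sum_(i in I) L i)%N.

Let LIE : LI = (\sum_(k < d) L (nth 0%N s k))%N.
Proof. exact: (sum_set_seq I (fun i => L i)). Qed.

Lemma sum_le_sumn : (LI <= N)%N.
Proof.
rewrite /LI sumnE (big_nth 0%N) sl big_mkord big_mkcond /=.
by apply: leq_sum => i _; case: ifP.
Qed.

(** [c k] stands for lambda_i - mu_i at the k-th support element i. The equation says that mu has
    size [R]; written with [N], all its subtractions are exact and it names the coefficient
    [N - R]. *)
Definition defects (c : {ffun 'I_d -> 'I_N.+1}) : bool :=
  [forall k, (c k < L (nth 0%N s k))%N] && (N - R == N - LI + \sum_k c k)%N.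
Definition comp_of (c : {ffun 'I_d -> 'I_N.+1}) : seq nat :=
  mkseq (fun j => \sum_(k < d | nth 0%N s k == j) (L j - c k))%N n.

Let s_lt (k : 'I_d) : (nth 0%N s k < n)%N.
Proof. exact: (@set_seq_lt I _ (mem_nth 0%N (ltn_ord k))). Qed.

Lemma nth_comp_of c (k : 'I_d) : nth 0%N (comp_of c) (nth 0%N s k) = (L (nth 0%N s k) - c k)%N.
Proof.
rewrite nth_mkseq // (big_pred1 k) // => l.
by rewrite nth_uniq //; apply: uniq_set_seq.
Qed.

Lemma nth_comp_of_notin c j : j \notin s -> nth 0%N (comp_of c) j = 0%N.
Proof.
move=> js; case: (ltnP j n) => [jn|nj]; last by rewrite nth_default // size_mkseq.
rewrite nth_mkseq // big_pred0 // => k; apply/negP => /eqP E.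
by move: js; rewrite -E mem_nth.
Qed.

Lemma perm_comp_of :
  perm_eq [seq comp_of c | c <- enum defects]
    [seq mu <- subcomps lam | (sumn mu == R) && (supp mu == I)].
Proof.
have sIn (i : 'I_n) : i \in I -> exists k : 'I_d, nth 0%N s k = i.
  rewrite -mem_set_seq -/s => is_; have kd : (index (val i) s < d)%N by rewrite index_mem.
  by exists (Ordinal kd); rewrite /= nth_index.
have nthI (k : 'I_d) : exists2 i, i \in I & nth 0%N s k = i.
  exists (Ordinal (s_lt k)) => //; rewrite -mem_set_seq; exact: mem_nth.
apply: uniq_perm; last move=> mu.
- rewrite map_inj_in_uniq ?enum_uniq // => c c'.
  rewrite !mem_enum => /andP[/forallP cl _] /andP[/forallP cl' _] E.
  apply/ffunP => k; apply: val_inj => /=.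
  have := nth_comp_of c k; rewrite E nth_comp_of; have := cl k; have := cl' k; lia.
- by rewrite filter_uniq // uniq_subcomps.
rewrite mem_filter; apply/mapP/idP => [[c]|/andP[/andP[/eqP smu /eqP supmu] /subcompsP[szm lem]]].
  rewrite mem_enum => /andP[/forallP cl /eqP cs] ->.
  have suppc : supp (comp_of c) = I.
    apply/setP => i; rewrite inE; case: (boolP (i \in I)) => iI.
      have [k <-] := sIn i iI; rewrite nth_comp_of; have := cl k; lia.
    by rewrite nth_comp_of_notin ?eqxx // /s mem_set_seq.
  rewrite suppc eqxx andbT; apply/andP; split.
    rewrite sumn_supp ?size_mkseq // suppc (sum_set_seq I (fun j => nth 0%N (comp_of c) j)).
    rewrite -/s -/d (eq_bigr _ (fun k _ => nth_comp_of c k)).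
    have : (\sum_(k < d) (L (nth 0%N s k) - c k) + \sum_k c k = LI)%N.
      by rewrite -big_split LIE /=; apply: eq_bigr => k _; rewrite subnK // ltnW.
    move: cs (sum_le_sumn) RN; rewrite -/LI.
    move: (\sum_(k < d) (L (nth 0%N s k) - c k))%N (\sum_k c k)%N LI => S C l cs lN RN' E.
    by apply/eqP; lia.
  apply/subcompsP; rewrite size_mkseq sl; split=> // j.
  case: (boolP (j \in s)) => js; last by rewrite nth_comp_of_notin.
  have kd : (index j s < d)%N by rewrite index_mem.
  have := nth_comp_of c (Ordinal kd); rewrite /= nth_index // => ->; exact: leq_subr.
have bnd (k : 'I_d) : (L (nth 0%N s k) - nth 0%N mu (nth 0%N s k) < N.+1)%N.
  by rewrite ltnS; apply: leq_trans (leq_subr _ _) (part_le_sumn _ _).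
have mu0 (k : 'I_d) : (0 < nth 0%N mu (nth 0%N s k))%N.
  have [i iI ->] := nthI k; move: iI; rewrite -supmu inE; lia.
pose c : {ffun 'I_d -> 'I_N.+1} := [ffun k => Ordinal (bnd k)].
exists c.
  rewrite mem_enum; apply/andP; split.
    by apply/forallP => k; rewrite ffunE /=; have := mu0 k; have := lem (nth 0%N s k); lia.
  have : (R + \sum_k c k = LI)%N.
    rewrite -smu sumn_supp ?szm // supmu (sum_set_seq I (fun j => nth 0%N mu j)) -/s -/d.
    by rewrite -big_split LIE /=; apply: eq_bigr => k _; rewrite ffunE /= subnKC.
  have := sum_le_sumn; lia.
apply: (@eq_from_nth _ 0%N); first by rewrite size_mkseq szm.
move=> j; rewrite szm sl => jn; case: (boolP (j \in s)) => js.
  have kd : (index j s < d)%N by rewrite index_mem.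
  have := nth_comp_of c (Ordinal kd); rewrite ffunE /= nth_index // => ->.
  by rewrite subKn.
have : Ordinal jn \notin I by rewrite -mem_set_seq.
by rewrite -supmu inE negbK /= nth_comp_of_notin // => /eqP.
Qed.

End Subcompositions.

Section GeneratorCoefficients.
Variables (F : fieldType) (lam : seq nat).
Local Notation n := (size lam).
Local Notation N := (sumn lam).
Local Notation L i := (nth 0%N lam i).
Variables (A : algType F) (iu : 'M[F]_N -> A).
Local Notation ft := (ft iu).

Lemma prod_monomials d (e : 'I_d -> A) (c : 'I_d -> nat) :
  \prod_(k < d) (e k *: 'X^(c k)) = (\prod_(k < d) e k) *: 'X^(\sum_(k < d) c k).
Proof.
elim: d e c => [|d IH] e c; first by rewrite !big_ord0 scale1r expr0.
rewrite !big_ord_recl IH exprD -!mul_polyC polyCM.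
rewrite -!mulrA; congr (_ * _); rewrite !mulrA; congr (_ * _).
by rewrite commr_polyXn.
Qed.

Definition psize (I : {set 'I_n}) : nat := (\sum_(i in I) L i)%N.

Lemma psize_le I : (psize I <= N)%N.
Proof. exact: sum_le_sumn. Qed.

(** Expanding each [ft] amounts to choosing a defect in every column. The power of X is a padding
    that makes [N - R] the right index for every [I]; for [psize I < R] that coefficient is 0. *)
Lemma cdet_sum_supp (I : {set 'I_n}) R : (R <= N)%N ->
  \sum_(mu <- subcomps lam | (sumn mu == R) && (supp n mu == I)) cdet iu mu =
  ('X^(N - psize I) * minor_det iu (set_seq I))`_(N - R).
Proof.
move=> RN; set s := set_seq I; set d := size s.
pose T (w : 'S_d) mu : A := \prod_(k < d)
  etilde iu (nth 0%N s (w k)) (nth 0%N s k) (nth 0%N mu (nth 0%N s k)).-1.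
have -> : \sum_(mu <- subcomps lam | (sumn mu == R) && (supp n mu == I)) cdet iu mu =
    \sum_(w : 'S_d) (-1) ^+ odd_perm w *
      \sum_(mu <- subcomps lam | (sumn mu == R) && (supp n mu == I)) T w mu.
  under [RHS]eq_bigr => w _ do rewrite mulr_sumr.
  rewrite exchange_big /= big_seq_cond [RHS]big_seq_cond; apply: eq_bigr => mu.
  case/and3P => /subcompsP[szm _] _ /eqP supmu.
  rewrite /cdet (set_seq_supp szm) supmu; apply: eq_bigr => w _.
  by rewrite scaler_sign mulr_sign.
rewrite /minor_det /cdetn mulr_sumr coef_sum; apply: eq_bigr => w _.
rewrite mulrA (commr_sign 'X^(N - psize I) w) -mulrA !mulr_sign.
suff -> : \sum_(mu <- subcomps lam | (sumn mu == R) && (supp n mu == I)) T w mu =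
    ('X^(N - psize I) * \prod_(k < size s) ft (nth 0%N s (w k)) (nth 0%N s k))`_(N - R).
  by case: (odd_perm w); rewrite ?coefN.
rewrite -big_filter -(perm_big _ (perm_comp_of (erefl n) I RN)) big_map /= big_enum /=.
pose e (k : 'I_d) (c : 'I_N.+1) : A := if (c < L (nth 0%N s k))%N then
  etilde iu (nth 0%N s (w k)) (nth 0%N s k) (L (nth 0%N s k) - c.+1) else 0.
have ftE k : ft (nth 0%N s (w k)) (nth 0%N s k) = \sum_(c < N.+1) e k c *: 'X^c.
  rewrite /ft poly_def (big_ord_widen N.+1 (fun c => etilde iu (nth 0%N s (w k))
    (nth 0%N s k) (L (nth 0%N s k) - c.+1) *: 'X^c)) ?leqW ?part_le_sumn //.
  by rewrite big_mkcond; apply: eq_bigr => c _; rewrite /e; case: ifP; rewrite ?scale0r.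
under [in RHS]eq_bigr => k _ do rewrite ftE.
rewrite bigA_distr_bigA mulr_sumr coef_sum big_mkcond /=; apply: eq_bigr => c _.
rewrite prod_monomials -mul_polyC mulrA -commr_polyXn -mulrA -exprD coefCM coefXn.
rewrite [c \in _]unfold_in /defects -/(psize I).
case: (N - R =P _)%N => [E|_]; rewrite ?andbT ?andbF ?mulr1 ?mulr0 //.
case: ifP => [/forallP cl|/negbT/forallPn[k ck]]; last first.
  by rewrite (prod_zero (p := k)) // /e (negPf ck).
apply: eq_bigr => k _; rewrite /e cl nth_comp_of //; congr (etilde _ _ _ _).
by rewrite subnS.
Qed.

Lemma zgen_coef R : (R <= N)%N ->
  zgen iu R = \sum_(I : {set 'I_n} | #|I| == nth 0%N (degseq lam) R.-1)
    ('X^(N - psize I) * minor_det iu (set_seq I))`_(N - R).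
Proof.
move=> RN; under eq_bigr => I _ do rewrite -cdet_sum_supp //.
rewrite /zgen; set dR := nth _ _ _.
transitivity (\sum_(mu <- subcomps lam) \sum_(I : {set 'I_n} | #|I| == dR)
    if (sumn mu == R) && (supp n mu == I) then cdet iu mu else 0); last first.
  by rewrite exchange_big; apply: eq_bigr => I _; rewrite -big_mkcond.
rewrite big_mkcond /= !big_seq; apply: eq_bigr => mu /subcompsP[szm _].
rewrite (ell_supp szm) big_mkcond /= (bigD1 (supp n mu)) //= eqxx andbT.
rewrite big1 ?addr0 => [|I /negPf Imu]; last by rewrite [_ == I]eq_sym Imu andbF if_same.
by case: eqP; case: eqP.
Qed.

End GeneratorCoefficients.

(** * Centrality of z_r *)

Section Degrees.
Implicit Type lam : seq nat.

Definition sorted_parts lam := if sorted geq lam then lam else rev lam.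

Lemma size_sorted_parts lam : size (sorted_parts lam) = size lam.
Proof. by rewrite /sorted_parts; case: ifP => // _; rewrite size_rev. Qed.

Lemma sumn_sorted_parts lam : sumn (sorted_parts lam) = sumn lam.
Proof. by rewrite /sorted_parts; case: ifP => // _; rewrite sumn_rev. Qed.

(** Seen as a row of the decreasing diagram, the degree is tied by [box_eq] to the partial sums of
    the largest parts. *)
Lemma degseq_nth lam h : (h < sumn lam)%N ->
  nth 0%N (degseq lam) h = (brow (sorted_parts lam) h).+1.
Proof.
have E (l : seq nat) k h' : (h' < sumn l)%N ->
    nth 0%N (flatten [seq nseq (nth 0%N l i) (i + k).+1 | i <- iota 0 (size l)]) h' =
    (brow l h' + k).+1.
  rewrite /brow; elim: l k h' => [|a l IH] k h' //= hl.
  rewrite nth_cat size_nseq nth_nseq; case: (ltnP h' a) => // ah /=.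
  rewrite -[1%N]addn0 iotaDl -map_comp.
  rewrite (eq_map (g := fun i => nseq (nth 0%N l i) (i + k.+1).+1)); last first.
    by move=> i /=; rewrite add1n /= addnS.
  by rewrite IH ?addSnnS // ltn_subLR.
move=> hl; have := E (sorted_parts lam) 0%N h; rewrite sumn_sorted_parts addn0 => <- //.
rewrite size_sorted_parts /degseq /sorted_parts; case: ifP => _; congr (nth _ (flatten _) _).
  by apply: eq_map => i; rewrite addn0.
apply/eq_in_map => i; rewrite mem_iota add0n => /andP[_ il].
by rewrite addn0 nth_rev.
Qed.

Lemma sorted_ltn_nth_ge s k j : sorted ltn s -> (k <= j)%N -> (j < size s)%N ->
  (nth 0%N s k + (j - k) <= nth 0%N s j)%N.
Proof.
move=> ss; elim: j => [|j IH] kj js.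
  have -> : k = 0%N by lia.
  by rewrite addn0.
case: (ltnP j k) => [jk|jk].
  by have -> : k = j.+1; [lia | rewrite subnn addn0].
have := IH jk (ltnW js); have : (nth 0%N s j < nth 0%N s j.+1)%N.
  by apply: (sorted_ltn_nth ltn_trans) => //; rewrite inE // ltnW.
lia.
Qed.

Lemma nth_geq lam i j : sorted geq lam -> (i <= j)%N -> (nth 0%N lam j <= nth 0%N lam i)%N.
Proof.
move=> sl ij; case: (ltnP j (size lam)) => [jl|lj]; last by rewrite nth_default.
have T : transitive geq by move=> x y z yx zx; apply: leq_trans zx yx.
by apply: (sorted_leq_nth T leqnn) => //; rewrite inE //; apply: leq_ltn_trans jl.
Qed.

Lemma nth_leq lam i j : sorted leq lam -> (i <= j)%N -> (j < size lam)%N ->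
  (nth 0%N lam i <= nth 0%N lam j)%N.
Proof.
move=> sl ij jl; apply: (sorted_leq_nth leq_trans leqnn) => //.
by rewrite inE; apply: leq_ltn_trans jl.
Qed.

Lemma sum_nth_take l d : (d <= size l)%N -> (\sum_(k < d) nth 0%N l k = sumn (take d l))%N.
Proof.
move=> dl; rewrite sumnE (big_nth 0%N) size_takel // big_mkord.
by apply: eq_bigr => k _; rewrite nth_take.
Qed.

(** The parts are compared one by one. The k-th smallest index, counted from 0, is at least [k]; the
    k-th largest is at most [n - 1 - k]. The former serves for decreasing, the latter for increasing
    parts. *)
Lemma psize_le_top lam (J : {set 'I_(size lam)}) : sorted geq lam \/ sorted leq lam ->
  (psize J <= sumn (take #|J| (sorted_parts lam)))%N.
Proof.
move=> Hm; rewrite /psize (sum_set_seq J (fun i => nth 0%N lam i)) -(size_set_seq J).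
set s := set_seq J; have sd : (size s <= size lam)%N.
  by rewrite size_set_seq -[X in (_ <= X)%N]card_ord max_card.
rewrite -sum_nth_take ?size_sorted_parts //.
have ss := sorted_set_seq J; rewrite -/s in ss.
rewrite /sorted_parts; case: ifP => Hg.
  apply: leq_sum => k _; apply: nth_geq => //.
  have := @sorted_ltn_nth_ge s 0 k ss (leq0n _) (ltn_ord k); lia.
case: Hm => [|Hl]; first by rewrite Hg.
rewrite (reindex_inj rev_ord_inj) /=; apply: leq_sum => k _.
have ks := ltn_ord k; rewrite nth_rev; last by lia.
have ls : (nth 0%N s (size s).-1 < size lam)%N.
  by apply: (@set_seq_lt _ J); apply: mem_nth; rewrite -/s ltn_predL (leq_ltn_trans _ ks).
apply: nth_leq => //; last by lia.
have : (nth 0%N s (size s - k.+1) + ((size s).-1 - (size s - k.+1)) <= nth 0%N s (size s).-1)%N.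
  by apply: sorted_ltn_nth_ge => //; lia.
lia.
Qed.

(* This is what the condition ell(mu) = d_R gives: the total defect is smaller than every part involved. *)
Lemma psize_defect lam (I : {set 'I_(size lam)}) R i : sorted geq lam \/ sorted leq lam ->
  (0 < R <= sumn lam)%N -> #|I| = nth 0%N (degseq lam) R.-1 -> i \in I ->
  (psize I < R + nth 0%N lam i)%N.
Proof.
move=> Hm /andP[R0 RN] dI iI; have RN' : (R.-1 < sumn lam)%N by lia.
have := psize_le_top (I :\ i) Hm; rewrite (cardsD1 i) iI add1n degseq_nth // in dI.
have -> : psize I = (nth 0%N lam i + psize (I :\ i))%N by rewrite /psize (big_setD1 i).
case: dI => ->; have := @box_eq (sorted_parts lam) R.-1; rewrite sumn_sorted_parts => /(_ RN').
lia.
Qed.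

End Degrees.

(** * Commutation of z_R with the e_{a,b;r} *)

Section CentralGenerators.
Variables (F : fieldType) (lam : seq nat).
Local Notation n := (size lam).
Local Notation N := (sumn lam).
Local Notation L i := (nth 0%N lam i).
Local Notation P := (centralizer (jordan_nil F lam)).
Variables (A : algType F) (iu : 'M[F]_N -> A) (HU : is_UEA P iu).
Hypotheses (HF : [pchar F] =i pred0) (Lpos : all (fun x => 0 < x)%N lam).
Hypothesis Hmono : sorted geq lam \/ sorted leq lam.
Local Notation ee := (ee iu).

Lemma index_adjacent (I : {set 'I_n}) a b : a \in set_seq I -> b \in set_seq I -> b = a.+1 ->
  index b (set_seq I) = (index a (set_seq I)).+1.
Proof.
move=> aI bI ba; set s := set_seq I; have ss : sorted ltn s := sorted_set_seq I.
have ka : (index a s < size s)%N by rewrite index_mem.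
have kb : (index b s < size s)%N by rewrite index_mem.
have na := nth_index 0%N aI; have nb := nth_index 0%N bI; rewrite -/s in na nb.
case: (ltngtP (index b s) (index a s).+1) => [lt|gt|//].
  have := @sorted_ltn_nth_ge s (index b s) (index a s) ss; rewrite na nb => /(_ lt ka).
  by move: ba lt; lia.
have := @sorted_ltn_nth_ge s (index a s) (index b s) ss; rewrite na nb => /(_ (ltnW (ltnW gt)) kb).
by move: ba gt; lia.
Qed.

(** No index lies strictly between [a] and [b], so replacing [b] by [a] in place keeps the list
    increasing, and the columns keep their order. *)
Lemma set_seq_tperm (I : {set 'I_n}) (a b : 'I_n) : (b = a.+1 :> nat) \/ (a = b.+1 :> nat) ->
  b \in I -> a \notin I ->
  set_seq [set tperm a b i | i in I] = [seq if j == b :> nat then val a else j | j <- set_seq I].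
Proof.
move=> ab bI aI; apply: (irr_sorted_eq ltn_trans ltnn); first exact: sorted_set_seq.
- have ss := sorted_set_seq I.
  apply: (homo_sorted_in (P := mem (set_seq I)) _ _ ss); last exact/allP.
  move=> j j' js js' jj'.
  have na : val a \notin set_seq I by rewrite mem_set_seq.
  have ja : j != a by apply: contraNneq na => /= <-.
  have ja' : j' != a by apply: contraNneq na => /= <-.
  move: jj' ab; move/eqP: ja; move/eqP: ja' => /=; case: (j =P b :> nat); case: (j' =P b :> nat); lia.
move=> j; apply/mapP/mapP => [[k]|[k]].
  rewrite mem_enum => /imsetP[i iI ->] ->.
  exists (val i); first by rewrite mem_set_seq.
  case: tpermP => [E|->|/eqP ia /eqP ib]; first by rewrite -E iI in aI.
    by rewrite eqxx.
  by rewrite (inj_eq val_inj) (negPf ib).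
case/mapP => i; rewrite mem_enum => iI -> ->.
exists (tperm a b i); first by rewrite mem_enum imset_f.
case: tpermP => [E|->|/eqP ia /eqP ib]; first by rewrite -E iI in aI.
  by rewrite eqxx.
by rewrite (inj_eq val_inj) (negPf ib).
Qed.

Lemma psize_tperm (I : {set 'I_n}) (a b : 'I_n) : b \in I -> a \notin I ->
  (psize [set tperm a b i | i in I] + L b = psize I + L a)%N.
Proof.
move=> bI aI; rewrite /psize big_imset /=; last by move=> ? ? _ _; apply: perm_inj.
rewrite (bigD1 b) //= tpermR [in RHS](bigD1 b) //=.
rewrite (eq_bigr (fun i : 'I_n => L i)); first by lia.
move=> i /andP[iI ib]; rewrite tpermD 1?eq_sym //.
by apply: contraNneq aI => <-.
Qed.

(** Both matrices have rows indexed by the exchanged set and columns by [I]. The entries written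
    with [fp] are off the diagonal, where [fp] is [ft]; [psize_tperm] matches the powers of X. *)
Lemma row_col_swap (I : {set 'I_n}) (a b : 'I_n) r :
  (b = a.+1 :> nat) \/ (a = b.+1 :> nat) -> b \in I -> a \notin I -> (L b <= r + L a)%N ->
  'X^(N - psize I) * row_part iu (set_seq I) a b r =
  'X^(N - psize [set tperm a b i | i in I]) *
    col_part iu (set_seq [set tperm a b i | i in I]) a b r.
Proof.
move=> ab bI aI lo; set I' := [set _ | _ in I].
have Es : set_seq I' = _ := set_seq_tperm ab bI aI.
have bs : val b \in set_seq I by rewrite mem_set_seq.
have as' : val a \in set_seq I'.
  by rewrite mem_set_seq; apply/imsetP; exists b; rewrite ?tpermR.
rewrite /row_part /col_part bs as' !mulrA -!exprD.
have Ep := psize_tperm bI aI; rewrite -/I' in Ep.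
have -> : (N - psize I + r = N - psize I' + (r + L a - L b))%N.
  have := psize_le I; have := psize_le I'; lia.
congr (_ * _); rewrite Es size_map; apply: eq_cdetn => k l kd ld.
have kI : nth 0%N (set_seq I) k \in set_seq I by rewrite mem_nth.
have lI : nth 0%N (set_seq I) l \in set_seq I by rewrite mem_nth.
have neq j : j \in set_seq I -> j != a.
  by move=> js; apply: contraNneq aI => E; rewrite -mem_set_seq /= -E.
have eqb j : (j < size (set_seq I))%N -> (j == index (val b) (set_seq I)) = (nth 0%N (set_seq I) j == b).
  by move=> js; rewrite -[X in _ = (_ == X)](nth_index 0%N bs) nth_uniq ?uniq_set_seq ?index_mem.
have eqa : (l == index (val a) (set_seq I')) = (nth 0%N (set_seq I) l == b).
  have l' : (l < size (set_seq I'))%N by rewrite Es size_map.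
  rewrite -(nth_uniq 0%N l' _ (uniq_set_seq I')) ?index_mem // nth_index // Es (nth_map 0%N) //.
  by case: (nth 0%N (set_seq I) l =P b :> nat) => _; rewrite ?eqxx //; apply: negPf; apply: neq.
rewrite -Es eqa eqb // Es !(nth_map 0%N) //.
case: (nth 0%N _ k =P b :> nat) => [_|nk]; case: (nth 0%N _ l =P b :> nat) => [El|_] //.
- by rewrite El.
- by rewrite fp_neq ?(set_seq_lt lI) // eq_sym neq.
- by rewrite El fp_neq //; apply/eqP.
Qed.

Lemma zgen_comm_adjacent (a b : 'I_n) r R : valid lam a b r -> (0 < R <= N)%N ->
  [\/ a = b, b = a.+1 :> nat | a = b.+1 :> nat] ->
  ee a b r * zgen iu R = zgen iu R * ee a b r.
Proof.
move=> v /[dup] R1 /andP[R0 RN] adj; have /and4P[al bl lo _] := v.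
rewrite zgen_coef // mulr_sumr mulr_suml.
pose x : {poly A} := (ee a b r)%:P.
apply/eqP; rewrite -subr_eq0 -sumrB; apply/eqP.
pose U (I : {set 'I_n}) := if (b \in I) && (a \notin I) then
  ('X^(N - psize I) * row_part iu (set_seq I) a b r)`_(N - R) else 0.
pose V (I : {set 'I_n}) := if (a \in I) && (b \notin I) then
  ('X^(N - psize I) * col_part iu (set_seq I) a b r)`_(N - R) else 0.
rewrite (eq_bigr (fun I => U I - V I)); last first.
  move=> I /eqP dI; pose s := set_seq I.
  have us : uniq s by apply: uniq_set_seq.
  have sn j : j \in s -> (j < n)%N by apply: set_seq_lt.
  (* The truncation order [(psize I - R).+1] is at most every part in [I], as the commutator
     formulas require, and the coefficient sought involves only degrees below it. *)
  have sm j : j \in s -> ((psize I - R).+1 <= L j)%N.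
    case/mapP => i; rewrite mem_enum => iI ->.
    move: (psize_defect Hmono R1 dI iI) (L_gt0 Lpos (ltn_ord i)) => /=; lia.
  have low p q : eqm (psize I - R).+1 p q ->
      ('X^(N - psize I) * p)`_(N - R) = ('X^(N - psize I) * q)`_(N - R) :> A.
    move=> E; rewrite !coefXnM; case: ltnP => // le; apply: E.
    by have := psize_le I; lia.
  rewrite -coefCM -coefMC -/x.
  have -> : x * ('X^(N - psize I) * minor_det iu s) = 'X^(N - psize I) * (x * minor_det iu s).
    by rewrite mulrA commr_polyXn -mulrA.
  rewrite -[_ * _ * x]mulrA.
  have E0 : eqm (psize I - R).+1 (x * minor_det iu s) (minor_det iu s * x) ->
     ('X^(N - psize I) * (x * minor_det iu s))`_(N - R) -
     ('X^(N - psize I) * (minor_det iu s * x))`_(N - R) = 0 by move/low ->; rewrite subrr.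
  have Ec := minor_det_comm HU Lpos us sn sm v; rewrite -/x in Ec.
  rewrite /U /V -!(mem_set_seq I) -/s.
  case: (boolP (val a \in s)) => as_; case: (boolP (val b \in s)) => bs /=; rewrite ?subrr.
  - apply: E0; case: adj => adj; last first.
    + apply: minor_det_comm_in => //; right; split=> //; exact: index_adjacent.
    + apply: minor_det_comm_in => //; left; split=> //; exact: index_adjacent.
    + by apply: minor_det_comm_diag => //; rewrite adj.
  - rewrite -coefB -mulrBr (low _ _ Ec) /row_part (negPf bs) sub0r mulrN coefN.
    by rewrite sub0r.
  - by rewrite -coefB -mulrBr (low _ _ Ec) /col_part (negPf as_) !subr0.
  - by apply: E0; apply: minor_det_comm_notin.
rewrite sumrB; apply/eqP; rewrite subr_eq0; apply/eqP.
have [ab|ab] := eqVneq a b.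
  by rewrite !big1 // => I _; rewrite /U /V ab; case: (b \in I).
have adj' : (b = a.+1 :> nat) \/ (a = b.+1 :> nat).
  by case: adj => [E|E|E]; [rewrite E eqxx in ab|left|right].
(* This involution on supports preserves the cardinality and matches the row terms [U] with the
   column terms [V]. *)
pose h (I : {set 'I_n}) := [set tperm a b i | i in I].
have hI : involutive h.
  move=> I; rewrite /h -imset_comp -[RHS]imset_id; apply: eq_imset => i /=.
  by rewrite tpermK.
rewrite [RHS](reindex_inj (inv_inj hI)) /=; apply: eq_big => [I|I _].
  by rewrite card_imset //; apply: perm_inj.
have mh i : (i \in h I) = (tperm a b i \in I).
  by rewrite -{1}(tpermK a b i) mem_imset //; apply: perm_inj.
rewrite /U /V !mh tpermL tpermR; case: ifP => // /andP[bI aI].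
by rewrite (row_col_swap adj' bI aI lo).
Qed.

(** For [c] between [i] and [j], e_{i,j;r} is the commutator of e_{i,c;s} and e_{c,j;r-s}, where s =
    max(L_c - L_i, 0) is the least admissible degree. Monotonicity puts L_c between L_i and L_j,
    which makes the second factor valid. *)
Lemma zgen_comm_ee i j r R : valid lam i j r -> (0 < R <= N)%N ->
  ee i j r * zgen iu R = zgen iu R * ee i j r.
Proof.
move=> v RN; set z := zgen iu R.
have Rz : zgen iu R = z by [].
have [k] := ubnP ((i - j) + (j - i))%N; elim: k i j r v => // k IH i j r v ijk.
have /and4P[il jl lo rj] := v.
have adjacent : [\/ i = j, j = i.+1 | i = j.+1] -> ee i j r * z = z * ee i j r.
  move=> adj; apply: (@zgen_comm_adjacent (Ordinal il) (Ordinal jl) r R) => //.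
  by case: adj => E; [apply: Or31; apply: val_inj|apply: Or32|apply: Or33].
have chain c : (c < n)%N -> i != j -> (i - c + (c - i) < k)%N -> (c - j + (j - c) < k)%N ->
    (L i <= L c <= L j)%N \/ (L j <= L c <= L i)%N -> ee i j r * z = z * ee i j r.
  move=> cl ij ick cjk M; have Li := L_gt0 Lpos il; have Lc := L_gt0 Lpos cl.
  have v1 : valid lam i c (L c - L i) by apply/and4P; split=> //; lia.
  have v2 : valid lam c j (r - (L c - L i)) by apply/and4P; split=> //; lia.
  have := ee_comm HU v1 v2; rewrite eqxx mul1r eq_sym (negPf ij) mul0r subr0.
  have -> : (L c - L i + (r - (L c - L i)) = r)%N by lia.
  have z1 : ee i c (L c - L i) * z = z * ee i c (L c - L i) by apply: IH => //; lia.
  have z2 : ee c j (r - (L c - L i)) * z = z * ee c j (r - (L c - L i)) by apply: IH => //; lia.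
  move=> <-; rewrite mulrBl mulrBr -!mulrA z1 z2.
  by congr (_ - _); rewrite mulrA ?z1 ?z2 -?mulrA.
have [ij|ij|ij] := ltngtP i j; last by apply: adjacent; apply: Or31.
  have [ji|ji] := eqVneq j i.+1; first by apply: adjacent; apply: Or32.
  apply: (chain i.+1); try lia.
  by case: Hmono => sl; [right; rewrite !nth_geq | left; rewrite !nth_leq //]; lia.
have [ji|ji] := eqVneq i j.+1; first by apply: adjacent; apply: Or33.
apply: (chain i.-1); try lia.
by case: Hmono => sl; [left; rewrite !nth_geq | right; rewrite !nth_leq //]; lia.
Qed.

Theorem zgen_central R : (0 < R <= N)%N -> in_center (zgen iu R).
Proof.
move=> RN c; set z := zgen iu R.
have [k] := generated (@cobL F lam) (@bas_centralizer F lam) (@centralizer_span F lam Lpos)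
  (@centralizerM F lam) (@centralizer1 F lam) (@centralizerL F lam) HU c.
elim=> [|d w a _ _ IH]; first by rewrite mulr0 mul0r.
rewrite mulrDl mulrDr IH -scalerAl -scalerAr; congr (_ *: _ + _).
rewrite /word; elim: w => [|i w IHw]; first by rewrite big_nil mulr1 mul1r.
rewrite big_cons mulrA -(zgen_comm_ee (triP (tri i)) RN) -/z -!mulrA IHw.
by [].
Qed.

End CentralGenerators.

(** * The slice *)

Section CompanionDeterminant.
Variable R : comNzRingType.

(** The last column has only its top entry; deleting it and the top row leaves the identity. *)
Lemma det_companion d p (C : 'M[R]_d) (t : nat -> R) : d = p.+1 ->
  (forall i j : 'I_d, C i j = if i == 0%N :> nat then t j else (i == j.+1 :> nat)%:R) ->
  \det C = (-1) ^+ p * t p.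
Proof.
move=> dp; subst d => CE; rewrite (expand_det_col C ord_max) (bigD1 ord0) //=.
rewrite big1 ?addr0 => [|i i0]; last first.
  rewrite CE; have -> : (i == 0%N :> nat) = false by apply: negbTE; rewrite -(inj_eq val_inj) in i0.
  by have := ltn_ord i; rewrite ltn_neqAle => /andP[/negPf-> _]; rewrite mul0r.
rewrite CE /= /cofactor /= add0n mulrC; congr (_ * _).
rewrite (_ : row' _ _ = 1%:M) ?det1 ?mulr1 //; apply/matrixP => i j.
by rewrite !mxE CE lift0 lift_max /= eqSS.
Qed.

Lemma det_reindex d (s : 'I_d -> 'I_d) (A : 'M[R]_d) : injective s ->
  \det (\matrix_(i, j) A (s i) (s j)) = \det A.
Proof.
move=> sI; have -> : \matrix_(i, j) A (s i) (s j) = row_perm (perm sI) (col_perm (perm sI) A).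
  by apply/matrixP => i j; rewrite !mxE !permE.
rewrite row_permE col_permE !det_mulmx !det_perm odd_permV mulrCA.
by rewrite -signr_addb addbb mulr1.
Qed.

Lemma det_row0 d (A : 'M[R]_d) i : (forall j, A i j = 0) -> \det A = 0.
Proof.
by move=> A0; rewrite (expand_det_row A i) big1 // => j _; rewrite A0 mul0r.
Qed.

End CompanionDeterminant.

Section Slice.
Variables (F : fieldType) (lam : seq nat).
Local Notation n := (size lam).
Local Notation N := (sumn lam).
Local Notation L i := (nth 0%N lam i).
Local Notation lamd := (sorted_parts lam).
Local Notation m := #|{: triple lam}|.
(* [rk i] is the position of the i-th part in the decreasing listing of the parts; it is an involution. *)
Definition rk (i : nat) : nat := if sorted geq lam then i else (n - i.+1)%N.

Lemma rk_lt i : (i < n)%N -> (rk i < n)%N.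
Proof. by rewrite /rk; case: ifP => // _; lia. Qed.

Lemma rkK i : (i < n)%N -> rk (rk i) = i.
Proof. by move=> il; rewrite /rk; case: (sorted geq lam); lia. Qed.

Lemma L_rk q : (q < n)%N -> L (rk q) = nth 0%N lamd q.
Proof. by move=> qn; rewrite /rk /sorted_parts; case: ifP => // _; rewrite nth_rev. Qed.

Lemma rk_inj i j : (i < n)%N -> (j < n)%N -> rk i = rk j -> i = j.
Proof. by move=> il jl E; rewrite -(rkK il) E rkK. Qed.

Hypothesis Lpos : all (fun x => 0 < x)%N lam.
Hypothesis Hmono : sorted geq lam \/ sorted leq lam.

Lemma sorted_lamd : sorted geq lamd.
Proof.
rewrite /sorted_parts; case: ifP => // Hg; case: Hmono => [|Hl]; first by rewrite Hg.
by rewrite rev_sorted; apply: sub_sorted Hl.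
Qed.

(** The sum has at most one term. Numbering the variables by boxes of the decreasing diagram makes
    ['X_r] the variable met by z_(r+1). *)
Definition box_var (p c : nat) : {mpoly F[N]} :=
  \sum_(h : 'I_N | (brow lamd h == p) && (bcol lamd h == c)) 'X_h.

Lemma box_varE (h : 'I_N) : box_var (brow lamd h) (bcol lamd h) = 'X_h.
Proof.
rewrite /box_var (big_pred1 h) // => k; apply/andP/eqP => [[/eqP Er /eqP Ec]|-> //].
have bk := @box_eq lamd k; have bh := @box_eq lamd h.
rewrite sumn_sorted_parts in bk bh; apply: val_inj => /=.
by rewrite bk // Er Ec -bh.
Qed.

(* The slice consists of companion matrices: free entries in the row of the largest part, and ones
   below the diagonal (in the ordering of the parts by decreasing size). *)
Definition slice_fun (i j r : nat) : {mpoly F[N]} :=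
  if rk i == 0%N then box_var (rk j) r else ((rk i == (rk j).+1) && (r == (L j).-1))%:R.

Definition slice : m.-tuple {mpoly F[N]} :=
  [tuple slice_fun (tri_row (tri k)) (tri_col (tri k)) (tri_deg (tri k)) | k < m].

Definition sym_form (X : 'M[F]_N) : {mpoly F[m]} := lform (@cob F lam) X.

Lemma sym_form_slice i j r : valid lam i j r ->
  sym_form (Eijr F lam i j r) \mPo slice = slice_fun i j r.
Proof.
move=> /triple_ex[x [rx cx dx]].
have -> : Eijr F lam i j r = bas F (enum_rank x) by rewrite /bas /tri enum_rankK rx cx dx.
rewrite /sym_form (lform_b (cob_bas F Lpos)) comp_mpolyXU -tnth_nth tnth_mktuple.
by rewrite /tri enum_rankK rx cx dx.
Qed.

Definition xdet (mu : seq nat) : {mpoly F[m]} :=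
  let s := [seq i <- iota 0 (size mu) | nth 0%N mu i != 0%N] in
  \sum_(w : 'S_(size s)) (-1) ^+ (odd_perm w) *:
    \prod_(k < size s)
      sym_form (Eijr F lam (nth 0%N s (w k)) (nth 0%N s k) (nth 0%N mu (nth 0%N s k)).-1).

Definition generating_comp R mu := [&& mu \in subcomps lam, sumn mu == R & ell mu == nth 0%N (degseq lam) R.-1].

Definition xgen (R : nat) : {mpoly F[m]} :=
  \sum_(mu <- subcomps lam | (sumn mu == R) && (ell mu == nth 0%N (degseq lam) R.-1)) xdet mu.

(** By [psize_defect] the total defect, hence each lambda_j - mu_j, is less than lambda_i; this is
    the lower bound required of r = mu_j - 1. *)
Lemma generating_valid R mu i j : (0 < R <= N)%N -> generating_comp R mu ->
  i \in set_seq (supp n mu) -> j \in set_seq (supp n mu) ->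
  valid lam i j (nth 0%N mu j).-1.
Proof.
move=> RN /and3P[/subcompsP[szm le] /eqP smu /eqP emu].
case/mapP => i' ii ->; case/mapP => j' jj ->; rewrite !mem_enum in ii jj.
have := @psize_defect lam (supp n mu) R i' Hmono RN; rewrite -(ell_supp szm) => /(_ emu ii).
rewrite -smu (sumn_supp szm) /psize !(big_setD1 j' jj) /=.
have : (\sum_(i in supp n mu :\ j') nth 0%N mu i <= \sum_(i in supp n mu :\ j') L i)%N.
  by apply: leq_sum => k _; apply: le.
have := le j'; move: jj; rewrite inE => jj.
move: (\sum_(_ in _) _)%N (\sum_(_ in _) _)%N => S1 S2 H1 H2 H3.
by apply/and4P; split; rewrite ?ltn_ord //=; lia.
Qed.

Section Symbols.
Local Notation P := (centralizer (jordan_nil F lam)).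
Variables (A : algType F) (iu : 'M[F]_N -> A) (HU : is_UEA P iu).

Lemma symb_etilde i j r : valid lam i j r ->
  symb (fun k => iu (@bas F lam k)) 1 (etilde iu i j r) (sym_form (Eijr F lam i j r)).
Proof.
move=> /and4P[il jl lo rj]; rewrite -[sym_form _]subr0; apply: symbB.
  exact: (lin_form_symb (@centralizer_span F lam Lpos) HU (centralizer_E F lo il jl)).
apply: symb_low; rewrite -natrM -scaler_nat; apply: filZ.
by have := @filwd _ _ _ (fun k => iu (@bas F lam k)) [::] 1; rewrite /word big_nil; apply.
Qed.

Lemma symb_zgen R : (0 < R <= N)%N ->
  symb (fun k => iu (@bas F lam k)) (nth 0%N (degseq lam) R.-1) (zgen iu R) (xgen R).
Proof.
move=> RN; rewrite /zgen /xgen big_seq_cond [X in symb _ _ _ X]big_seq_cond.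
apply: symb_sum => mu gen; have /and3P[/subcompsP[szm _] _ /eqP emu] := gen.
rewrite -emu (ell_supp szm) /cdet /xdet (set_seq_supp szm) -(size_set_seq (supp n mu)).
apply: symb_sum => w _; apply: symbZ.
have E1 e : (\sum_(i <- index_enum 'I_e) 1 = e)%N.
  by rewrite -[RHS]card_ord -sum1_card; apply: eq_bigl.
set s := set_seq _.
have := @symb_prod F A m (fun k => iu (bas F k)) _ (index_enum 'I_(size s)) (fun=> 1%N)
  (fun k => etilde iu (nth 0%N s (w k)) (nth 0%N s k) (nth 0%N mu (nth 0%N s k)).-1)
  (fun k => sym_form (Eijr F lam (nth 0%N s (w k)) (nth 0%N s k) (nth 0%N mu (nth 0%N s k)).-1)).
rewrite E1; apply=> k _; by apply: symb_etilde; apply: generating_valid gen _ _; rewrite ?mem_nth.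
Qed.

End Symbols.

Lemma xdet_slice R mu : (0 < R <= N)%N -> generating_comp R mu ->
  xdet mu \mPo slice = \det (\matrix_(k < size (set_seq (supp n mu)), l < size (set_seq (supp n mu)))
    slice_fun (nth 0%N (set_seq (supp n mu)) k) (nth 0%N (set_seq (supp n mu)) l)
      (nth 0%N mu (nth 0%N (set_seq (supp n mu)) l)).-1).
Proof.
move=> RN gen; have /and3P[/subcompsP[szm _] _ _] := gen.
rewrite /xdet (set_seq_supp szm) -det_tr raddf_sum /=; apply: eq_bigr => w _.
rewrite comp_mpolyZ scaler_sign mulr_sign rmorph_prod /=.
suff -> : \prod_(k < size (set_seq (supp n mu))) (sym_form (Eijr F lam
    (nth 0%N (set_seq (supp n mu)) (w k)) (nth 0%N (set_seq (supp n mu)) k)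
    (nth 0%N mu (nth 0%N (set_seq (supp n mu)) k)).-1) \mPo slice) =
  \prod_i (\matrix_(k < size (set_seq (supp n mu)), l < size (set_seq (supp n mu)))
    slice_fun (nth 0%N (set_seq (supp n mu)) k) (nth 0%N (set_seq (supp n mu)) l)
      (nth 0%N mu (nth 0%N (set_seq (supp n mu)) l)).-1)^T i (w i) by [].
apply: eq_bigr => k _; rewrite !mxE sym_form_slice //.
by apply: generating_valid gen _ _; rewrite ?mem_nth.
Qed.

Lemma lamd_gt0 q : (q < n)%N -> (0 < nth 0%N lamd q)%N.
Proof. by move=> qn; rewrite -L_rk //; apply/L_gt0/rk_lt. Qed.

Definition by_rank (l : seq nat) : seq nat := if sorted geq lam then l else rev l.

Lemma nth_by_rank l q : size l = n -> (q < n)%N -> nth 0%N (by_rank l) q = nth 0%N l (rk q).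
Proof. by move=> sl qn; rewrite /by_rank /rk; case: ifP => // _; rewrite nth_rev sl. Qed.

Lemma by_rankK : involutive by_rank.
Proof. by move=> l; rewrite /by_rank; case: (sorted geq lam) => //; apply: revK. Qed.

Lemma size_by_rank l : size (by_rank l) = size l.
Proof. by rewrite /by_rank; case: ifP; rewrite ?size_rev. Qed.

Lemma sumn_by_rank l : sumn (by_rank l) = sumn l.
Proof. by rewrite /by_rank; case: ifP; rewrite ?sumn_rev. Qed.

Lemma ell_by_rank l : ell (by_rank l) = ell l.
Proof. by rewrite /ell /by_rank; case: ifP; rewrite ?count_rev. Qed.

Definition top_comp p c : seq nat := take p lamd ++ c :: nseq (n - p.+1) 0%N.

Lemma size_top_comp p c : (p < n)%N -> size (top_comp p c) = n.
Proof. by move=> pn; rewrite size_cat size_takel /= ?size_nseq ?size_sorted_parts; lia. Qed.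

Lemma nth_top_comp p c q : (p < n)%N ->
  nth 0%N (top_comp p c) q = if (q < p)%N then nth 0%N lamd q else if q == p then c else 0%N.
Proof.
move=> pn; have sz : size (take p lamd) = p by rewrite size_takel // size_sorted_parts ltnW.
rewrite nth_cat sz.
case: (ltnP q p) => qp; first by rewrite nth_take.
case: (q =P p) => [->|/eqP qp']; first by rewrite subnn.
have -> : (q - p = (q - p).-1.+1)%N by lia.
by rewrite /= nth_nseq if_same.
Qed.

Lemma sumn_top_comp p c : sumn (top_comp p c) = (sumn (take p lamd) + c)%N.
Proof. by rewrite sumn_cat /= sumn_nseq mul0n addn0. Qed.

(** The hypothesis is what nonzero rows impose on the slice. It makes the support an initial
    segment, maximal except at its last entry; the number of nonzero entries tells where it ends. *)
Lemma staircase (nu : seq nat) p : size nu = n -> ell nu = p.+1 ->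
  (forall q, (0 < q < n)%N -> nth 0%N nu q != 0%N -> nth 0%N nu q.-1 = nth 0%N lamd q.-1) ->
  (p < n)%N /\ nu = top_comp p (nth 0%N nu p).
Proof.
move=> sn en H; have pn : (p < n)%N by rewrite -sn -en count_size.
split=> //.
have down q q' : (q' < q)%N -> nth 0%N nu q != 0%N -> nth 0%N nu q' = nth 0%N lamd q'.
  elim: q => // q IH; rewrite ltnS => qq nq.
  have qn : (q.+1 < n)%N.
    by rewrite ltnNge; apply/negP => le; rewrite nth_default ?sn in nq.
  have E := H q.+1 qn nq; rewrite /= in E.
  move: qq; rewrite leq_eqVlt => /orP[/eqP -> //|qq]; apply: IH => //.
  by rewrite E -lt0n lamd_gt0 // ltnW.
have nzcount k : (k <= n)%N -> (forall q, (q < k)%N -> nth 0%N nu q != 0%N) -> (k <= ell nu)%N.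
  move=> kn nz; rewrite /ell -(cat_take_drop k nu) count_cat.
  have /eqP -> : count (fun x => x != 0%N) (take k nu) == size (take k nu).
    rewrite -all_count; apply/(all_nthP 0%N) => q; rewrite size_takel ?sn // => qk.
    by rewrite nth_take // nz.
  by rewrite size_takel ?sn // leq_addr.
have zcount k : (forall q, (k <= q)%N -> nth 0%N nu q = 0%N) -> (ell nu <= k)%N.
  move=> z; rewrite /ell -(cat_take_drop k nu) count_cat.
  have -> : count (fun x => x != 0%N) (drop k nu) = 0%N.
    apply/eqP; rewrite -leqn0 leqNgt -has_count; apply/(has_nthP 0%N) => -[q _].
    by rewrite nth_drop z ?leq_addr.
  by rewrite addn0; apply: leq_trans (count_size _ _) _; rewrite size_take; case: ltnP.
have np : nth 0%N nu p != 0%N.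
  apply/eqP => p0; have : (ell nu <= p)%N; last by rewrite en ltnn.
  apply: zcount => q; rewrite leq_eqVlt => /orP[/eqP <- //|pq]; apply/eqP.
  apply: contraT => nq; have := down _ _ pq nq; rewrite p0 => E.
  by have := lamd_gt0 pn; rewrite -E.
have zp q : (p < q)%N -> nth 0%N nu q = 0%N.
  move=> pq; apply/eqP; apply: contraT => nq.
  have qn : (q < n)%N by rewrite ltnNge; apply/negP => le; rewrite nth_default ?sn in nq.
  have : (p.+2 <= ell nu)%N; last by rewrite en ltnn.
  apply: nzcount => [|q']; first by lia.
  rewrite ltnS leq_eqVlt => /orP[/eqP ->|q'p].
    by move: pq; rewrite leq_eqVlt => /orP[/eqP -> //|pq']; rewrite (down _ _ pq' nq) -lt0n lamd_gt0 //; lia.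
  by rewrite (down q) ?(leq_ltn_trans _ pq) // -lt0n lamd_gt0 //; lia.
apply: (@eq_from_nth _ 0%N); first by rewrite size_top_comp.
move=> q _; rewrite nth_top_comp //; case: (ltnP q p) => [qp|]; first exact: down np.
by rewrite leq_eqVlt eq_sym => /orP[/eqP ->|pq]; [rewrite eqxx | rewrite gtn_eqF // zp].
Qed.

Section SliceValue.
Variable r : 'I_N.
Let p := brow lamd r.
Let c := bcol lamd r.
Let mu0 := by_rank (top_comp p c.+1).

Let rd : (r < sumn lamd)%N.
Proof. by rewrite sumn_sorted_parts. Qed.

Let pn : (p < n)%N.
Proof. by rewrite -size_sorted_parts; apply: brow_lt. Qed.

Let cL : (c < nth 0%N lamd p)%N.
Proof. exact: bcol_lt. Qed.

Let rE : r = (sumn (take p lamd) + c)%N :> nat.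
Proof. exact: box_eq. Qed.

Lemma nth_mu0 q : (q < n)%N -> nth 0%N mu0 (rk q) =
  if (q < p)%N then nth 0%N lamd q else if q == p then c.+1 else 0%N.
Proof. by move=> qn; rewrite nth_by_rank ?rk_lt ?size_top_comp // rkK // nth_top_comp. Qed.

Lemma generating_mu0 : generating_comp r.+1 mu0.
Proof.
apply/and3P; split.
- apply/subcompsP; split=> [|j]; first by rewrite size_by_rank size_top_comp.
  case: (ltnP j n) => jn; last by rewrite nth_default // size_by_rank size_top_comp.
  rewrite -(rkK jn) nth_mu0 ?rk_lt // L_rk ?rk_lt //.
  by case: ifP => // _; case: eqP => // ->.
- by rewrite sumn_by_rank sumn_top_comp rE addnS.
- have sz : size (take p lamd) = p by rewrite size_takel // size_sorted_parts ltnW.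
  rewrite ell_by_rank degseq_nth //= /ell /top_comp count_cat /=.
  have -> : count (fun x => x != 0%N) (nseq (n - p.+1) 0%N) = 0%N.
    by apply/eqP; rewrite -leqn0 leqNgt -has_count has_nseq /= andbF.
  have /eqP -> : count (fun x => x != 0%N) (take p lamd) == size (take p lamd).
    rewrite -all_count; apply/(all_nthP 0%N) => q.
    rewrite sz => qp.
    by rewrite nth_take // -lt0n lamd_gt0 // (ltn_trans qp).
  by rewrite sz addn0 addn1.
Qed.

Lemma xdet_slice_other mu : generating_comp r.+1 mu -> mu != mu0 -> xdet mu \mPo slice = 0.
Proof.
move=> gen ne; have /and3P[/subcompsP[szm le] /eqP smu /eqP emu] := gen.
rewrite (xdet_slice _ gen); last by rewrite /= ltn_ord.
set s := set_seq (supp n mu); set M := \matrix_(k, l) _.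
have sP j : (j < n)%N -> (j \in s) = (nth 0%N mu j != 0%N).
  by move=> jn; have := mem_set_seq (supp n mu) (Ordinal jn); rewrite inE.
(* A zero row kills the determinant. In rank order, row [q > 0] can only have a 1 in column [q - 1],
   and only if mu is maximal there. *)
case: (boolP [exists k, [forall l, M k l == 0]]) => [/existsP[k /forallP kP]|].
  by apply: (det_row0 (i := k)) => l; apply/eqP.
move=> /existsPn H; case/eqP: ne.
have [] := @staircase (by_rank mu) p.
- by rewrite size_by_rank.
- by rewrite ell_by_rank emu /= degseq_nth ?ltn_ord.
- move=> q /andP[q0 qn]; rewrite nth_by_rank // => nq.
  have qs : rk q \in s by rewrite sP ?rk_lt.
  have kd : (index (rk q) s < size s)%N by rewrite index_mem.
  have /forallPn[l] := H (Ordinal kd); rewrite mxE /= nth_index // /slice_fun rkK //.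
  rewrite (gtn_eqF q0); case: andP => [[/eqP qE /eqP mE] _|]; last by rewrite eqxx.
  have ls : nth 0%N s l \in s by rewrite mem_nth.
  have ln : (nth 0%N s l < n)%N by apply: set_seq_lt ls.
  have nl : (0 < nth 0%N mu (nth 0%N s l))%N by move: ls; rewrite sP // lt0n.
  have Ll := L_gt0 Lpos ln.
  rewrite nth_by_rank //; last by lia.
  by rewrite -L_rk; [rewrite qE /= rkK //; lia | lia].
move=> _ E; apply: (can_inj by_rankK); rewrite by_rankK E; congr top_comp.
have := congr1 sumn E; rewrite sumn_by_rank sumn_top_comp smu rE; lia.
Qed.

(** Renumbering rows and columns by rank gives a companion matrix: [mu0] is maximal in ranks below
    [p], so the subdiagonal ones are present, and the last entry of the top row is ['X_r]. *)
Lemma xdet_slice_mu0 : xdet mu0 \mPo slice = (-1) ^+ p *: 'X_r.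
Proof.
have gen := generating_mu0; have /and3P[/subcompsP[szm le] /eqP smu /eqP emu] := gen.
rewrite (xdet_slice _ gen); last by rewrite /= ltn_ord.
set s := set_seq (supp n mu0).
have ss : size s = p.+1 by rewrite size_set_seq -(ell_supp szm) emu /= degseq_nth ?ltn_ord.
have sn (k : 'I_(size s)) : (nth 0%N s k < n)%N.
  by apply: (@set_seq_lt _ (supp n mu0)); rewrite mem_nth.
have sP (k : 'I_(size s)) : nth 0%N mu0 (nth 0%N s k) != 0%N.
  have : nth 0%N s k \in s by rewrite mem_nth.
  by rewrite -[nth 0%N s k]/(val (Ordinal (sn k))) mem_set_seq inE.
have rk_lep (k : 'I_(size s)) : (rk (nth 0%N s k) < p.+1)%N.
  have := sP k; rewrite -{1}(rkK (sn k)) nth_mu0 ?rk_lt // ltnS.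
  by case: (ltnP (rk _) p) => [/ltnW //|_]; case: (rk (nth 0%N s k) =P p) => [->|].
have rk_le (k : 'I_(size s)) : (rk (nth 0%N s k) < size s)%N.
  by have := rk_lep k; rewrite -ss.
pose sg k := Ordinal (rk_le k).
have sgI : injective sg.
  move=> k k' /(congr1 val) /= E; apply: val_inj; apply/eqP => /=.
  by rewrite -(nth_uniq 0%N _ _ (uniq_set_seq (supp n mu0))) //; apply/eqP/rk_inj.
pose t q := box_var q (nth 0%N mu0 (rk q)).-1.
pose C : 'M_(size s) := \matrix_(i, j) if i == 0%N :> nat then t j else (i == j.+1 :> nat)%:R.
have -> : \matrix_(k < size s, l < size s) slice_fun (nth 0%N s k) (nth 0%N s l)
      (nth 0%N mu0 (nth 0%N s l)).-1 = \matrix_(k, l) C (sg k) (sg l).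
  apply/matrixP => k l; rewrite !mxE /slice_fun /= /t rkK //.
  case: ifP => // _; congr (_%:R); congr nat_of_bool.
  case: eqP => //= E; have lp : (rk (nth 0%N s l) < p)%N.
    by have := rk_lep k; rewrite E.
  by rewrite -{1}(rkK (sn l)) nth_mu0 ?rk_lt // lp -L_rk ?rk_lt // rkK // eqxx.
rewrite (det_reindex _ sgI) (det_companion (t := t) ss) => [|i j]; last by rewrite mxE.
rewrite /t nth_mu0 // ltnn eqxx /= box_varE.
by rewrite -[in LHS]signr_odd -[in RHS]signr_odd scaler_sign mulr_sign.
Qed.

(* On the slice only one composition mu contributes, with a companion determinant. *)
Lemma xgen_slice : xgen r.+1 \mPo slice = (-1) ^+ p *: 'X_r.
Proof.
rewrite /xgen raddf_sum /= -big_filter (bigD1_seq mu0) /=; last 2 first.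
- by have /and3P[? ? ?] := generating_mu0; rewrite mem_filter; apply/andP; split=> //; apply/andP.
- by rewrite filter_uniq // uniq_subcomps.
rewrite xdet_slice_mu0 big_seq_cond big1 ?addr0 // => mu.
rewrite mem_filter => /andP[/andP[/andP[smu emu] mus] ne].
by apply: xdet_slice_other => //; apply/and3P.
Qed.

End SliceValue.
End Slice.

(** * Invariants vanishing on the slice *)

Lemma mderiv_comp (F : fieldType) (m M : nat) (v : m.-tuple {mpoly F[M]}) (t : 'I_M) p :
  (p \mPo v)^`M(t) = \sum_k (p^`M(k) \mPo v) * (tnth v k)^`M(t).
Proof.
have D0 k : (0 : {mpoly F[m]})^`M(k) = 0 by exact: mderiv0.
move: p; apply: mpoly_ring_ind => [c|i|p q Ep Eq|p q Ep Eq].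
- by rewrite comp_mpolyC mderivC big1 // => k _; rewrite mderivC comp_mpoly0 mul0r.
- rewrite comp_mpolyXU -tnth_nth (bigD1 i) //= big1 ?addr0 => [|k ki]; rewrite mderivX mnm1E.
    have -> : (U_(i) - U_(i) = 0 :> 'X_{1..m})%MM by apply/mnmP => l; rewrite mnmBE subnn mnm0E.
    by rewrite eqxx scale1r mpolyX0 comp_mpoly1 mul1r.
  by rewrite eq_sym (negPf ki) scale0r comp_mpoly0 mul0r.
- rewrite comp_mpolyD mderivD Ep Eq -big_split; apply: eq_bigr => k _ /=.
  by rewrite mderivD comp_mpolyD mulrDl.
rewrite (rmorphM (comp_mpoly v)) /= mderivM Ep Eq mulr_suml mulr_sumr -big_split.
apply: eq_bigr => k _ /=; rewrite mderivM comp_mpolyD !(rmorphM (comp_mpoly v)) /=.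
by rewrite mulrDl -!mulrA; congr (_ * _ + _); rewrite mulrC.
Qed.

(** * Derivatives of an invariant *)

Section IteratedDerivatives.
Variables (F : fieldType) (N m : nat) (b : 'I_m -> 'M[F]_N) (co : 'I_m -> 'M[F]_N -> F).
Variable f : {mpoly F[m]}.

Definition iter_deriv (s : seq 'I_m) : {mpoly F[m]} := foldr (fun k q => q^`M(k)) f s.

Inductive deriv_span (d : nat) : {mpoly F[m]} -> Prop :=
| deriv_span0 : deriv_span d 0
| deriv_spanL c s g : size s = d -> deriv_span d g -> deriv_span d (c *: iter_deriv s + g).

Lemma deriv_spanD d g h : deriv_span d g -> deriv_span d h -> deriv_span d (g + h).
Proof.
move=> sg sh; elim: sg => [|c s {}g ss _ IH]; first by rewrite add0r.
by rewrite -addrA; apply: deriv_spanL.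
Qed.

Lemma deriv_span_mderiv d g k : deriv_span d g -> deriv_span d.+1 g^`M(k).
Proof.
elim=> [|c s {}g ss _ IH]; first by rewrite mderiv0; apply: deriv_span0.
rewrite mderivD mderivZ -[(iter_deriv s)^`M(k)]/(iter_deriv (k :: s)).
by apply: deriv_spanL => //=; rewrite ss.
Qed.

(** The coefficients of [ad] are linear forms, so moving it past a partial derivative leaves a
    constant combination of partial derivatives, and the order does not grow. *)
Lemma deriv_span_ad X s : ad b co X f = 0 -> deriv_span (size s) (ad b co X (iter_deriv s)).
Proof.
move=> fX; elim: s => [|i s IH] /=; first by rewrite fX; apply: deriv_span0.
set g := iter_deriv s in IH *.
have -> : ad b co X g^`M(i) = (ad b co X g)^`M(i) +
    \sum_k (- co i (X *m b k - b k *m X)) *: (g^`M(k)).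
  rewrite /ad /deriv_of raddf_sum -big_split; apply: eq_bigr => k _ /=.
  rewrite mderivM [g^`M(k)^`M(i)]mderiv_comm addrAC scaleNr.
  suff -> : (lform co (X *m b k - b k *m X))^`M(i) = (co i (X *m b k - b k *m X))%:MP.
    by rewrite mul_mpolyC subrr add0r.
  rewrite /lform raddf_sum (bigD1 i) //= big1 ?addr0 => [|j ji]; rewrite mderivZ mderivX mnm1E.
    have -> : (U_(i) - U_(i) = 0 :> 'X_{1..m})%MM by apply/mnmP => l; rewrite mnmBE subnn mnm0E.
    by rewrite eqxx scale1r mpolyX0 -mul_mpolyC mulr1.
  by rewrite (negPf ji) scale0r scaler0.
apply: deriv_spanD; first exact: deriv_span_mderiv.
elim/big_ind: _ => [|u w su sw|k _]; [exact: deriv_span0|exact: deriv_spanD|].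
rewrite -[_ *: _]addr0 -[g^`M(k)]/(iter_deriv (k :: s)); apply: deriv_spanL => //.
exact: deriv_span0.
Qed.

End IteratedDerivatives.

Section Vanishing.
Variables (F : fieldType) (lam : seq nat).
Local Notation n := (size lam).
Local Notation N := (sumn lam).
Local Notation L i := (nth 0%N lam i).
Local Notation lamd := (sorted_parts lam).
Local Notation l q := (nth 0%N (sorted_parts lam) q).
Local Notation m := #|{: triple lam}|.
Hypothesis HF : [pchar F] =i pred0.
Hypothesis Lpos : all (fun x => 0 < x)%N lam.
Hypothesis Hmono : sorted geq lam \/ sorted leq lam.
Local Notation rk := (rk lam).
Local Notation slice := (slice F lam).
Local Notation ad := (ad (@bas F lam) (@cob F lam)).
Local Notation trow k := (rk (tri_row (tri k))).
Local Notation tcol k := (rk (tri_col (tri k))).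
Local Notation tdeg k := (tri_deg (tri k)).

Lemma tri_valid (k : 'I_m) : [/\ (trow k < n)%N, (tcol k < n)%N,
  (l (tcol k) <= tdeg k + l (trow k))%N & (tdeg k < l (tcol k))%N].
Proof.
have /and4P[rn cn lo dl] := triP (tri k).
by rewrite !rk_lt // -!L_rk ?rk_lt // !rkK.
Qed.

Lemma tri_inj (k k' : 'I_m) : trow k = trow k' -> tcol k = tcol k' -> tdeg k = tdeg k' -> k = k'.
Proof.
have /and4P[rn cn _ _] := triP (tri k); have /and4P[rn' cn' _ _] := triP (tri k').
move=> /(rk_inj rn rn') Er /(rk_inj cn cn') Ec Ed; apply: enum_val_inj.
by apply/eqP; rewrite -/(tri k) -/(tri k') triple_eq Er Ec Ed.
Qed.

(** * Transversality: a gradient killed along the slice and along the orbits is zero *)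

Section Gradient.
Variable Y : 'I_m -> {mpoly F[N]}.
Hypothesis Ytop : forall k, trow k = 0%N -> Y k = 0.
Hypothesis Yad : forall k0, \sum_k (lform (@cob F lam) (bas F k0 *m bas F k - bas F k *m bas F k0)
  \mPo slice) * Y k = 0.

Let y p q c := \sum_(k | [&& trow k == p, tcol k == q & (tdeg k + c.+1 == l q)%N]) Y k.

Lemma sym_form_slice_low i j r : (0 < rk i)%N -> (i < n)%N -> (j < n)%N -> (L j <= r + L i)%N ->
  sym_form (Eijr F lam i j r) \mPo slice = ((rk i == (rk j).+1) && (r.+1 == L j))%:R.
Proof.
move=> i0 il jl lo; case: (ltnP r (L j)) => rj.
  rewrite sym_form_slice //; last by apply/and4P.
  rewrite /slice_fun gtn_eqF //; congr (_%:R); congr nat_of_bool; congr (_ && _).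
  by have := L_gt0 Lpos jl; lia.
rewrite E_ge // /sym_form; have -> : lform (@cob F lam) 0 = 0.
  by rewrite /lform big1 // => k _; rewrite (co0 (@cobL F lam)) scale0r.
rewrite comp_mpoly0; have -> : (r.+1 == L j) = false by lia.
by rewrite andbF.
Qed.

(* Pairing the gradient Y with [e_{rk (q+1), rk p; s}, -]; [y p q c] is the entry of Y at
   e_{rk p, rk q; l q - 1 - c}, or 0. *)
Lemma diag_step p q s : (p < n)%N -> (q.+1 < n)%N -> (l p <= s + l q.+1)%N -> (s < l p)%N ->
  y p q s = y p.+1 q.+1 (s + l q.+1 - l p).
Proof.
move=> pn qn lo sp.
have v : valid lam (rk q.+1) (rk p) s by apply/and4P; split; rewrite ?rk_lt ?L_rk.
have [x [rx cx dx]] := triple_ex v.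
have := Yad (enum_rank x).
have bx : bas F (enum_rank x) = Eijr F lam (rk q.+1) (rk p) s.
  by rewrite /bas /tri enum_rankK rx cx dx.
rewrite bx (eq_bigr (fun k => (if [&& trow k == p, tcol k == q & (tdeg k + s.+1 == l q)%N]
   then Y k else 0) - (if [&& trow k == p.+1, tcol k == q.+1 &
   (tdeg k + (s + l q.+1 - l p).+1 == l q.+1)%N] then Y k else 0))).
  by rewrite sumrB -!big_mkcond => /eqP; rewrite subr_eq0 => /eqP.
move=> k _; have /and4P[il jl lo' dl] := triP (tri k).
have lf X Z : lform (@cob F lam) (X - Z) = lform (@cob F lam) X - lform (@cob F lam) Z.
  by rewrite addrC -scaleN1r (lformL (@cobL F lam)) scaleN1r addrC.
rewrite lf comp_mpolyB mulrBl /bas !E_mul ?L_rk //.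
have lf0 : lform (@cob F lam) 0 = 0.
  by rewrite /lform big1 // => i _; rewrite (co0 (@cobL F lam)) scale0r.
congr (_ - _).
  have -> : (rk p == tri_row (tri k)) = (trow k == p).
    by apply/eqP/eqP => [<-|<-]; rewrite rkK.
  case: eqP => [E|_] /=; last by rewrite lf0 comp_mpoly0 mul0r.
  rewrite -/(sym_form _) sym_form_slice_low ?rkK ?rk_lt ?L_rk //; last first.
    by move: lo'; rewrite -(rkK il) E L_rk //; lia.
  rewrite eqSS eq_sym -addSn addnC addnS; case: eqP => [Ec|_] /=; last by rewrite mul0r.
  rewrite -[in L _](rkK jl) Ec L_rk 1?ltnW // -addnS.
  by case: eqP; rewrite ?mul1r ?mul0r.
have -> : (tri_col (tri k) == rk q.+1) = (tcol k == q.+1).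
  by apply/eqP/eqP => [->|<-]; rewrite rkK.
case: (tcol k =P q.+1) => [E|_] /=; last by rewrite andbF lf0 comp_mpoly0 mul0r.
have [r0|r0] := posnP (trow k).
  by rewrite (Ytop r0) mulr0 if_same.
have El : L (tri_col (tri k)) = l q.+1 by rewrite -(rkK jl) E L_rk.
rewrite -/(sym_form _) sym_form_slice_low ?rkK ?rk_lt ?L_rk //; last by lia.
have -> : (tdeg k + (s + l q.+1 - l p).+1 == l q.+1)%N = ((tdeg k + s).+1 == l p)%N by lia.
by case: ifP; rewrite ?mul1r ?mul0r.
Qed.

Lemma l_mono p q : (p <= q)%N -> (q < n)%N -> (l q <= l p)%N.
Proof. by move=> pq qn; apply: nth_geq pq; apply: sorted_lamd. Qed.

Lemma y_row_ge p q c : (n <= p)%N -> y p q c = 0.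
Proof.
move=> np; rewrite /y big_pred0 // => k; apply/negP => /and3P[/eqP E _ _].
by have [] := tri_valid k; rewrite E ltnNge np.
Qed.

Lemma y_large p q c : (l p <= c)%N || (l q <= c)%N -> y p q c = 0.
Proof.
move=> H; rewrite /y big_pred0 // => k; apply/negP => /and3P[/eqP Er /eqP Ec /eqP Ed].
by have [_ _] := tri_valid k; rewrite Er Ec; move: H; lia.
Qed.

(** [diag_step] pushes the entry down its diagonal until the row leaves the range. *)
Lemma y_lower p q c : (q < p)%N -> y p q c = 0.
Proof.
have [k] := ubnP (n - p)%N; elim: k p q c => // k IH p q c kp qp.
case: (ltnP p n) => [pn|]; last exact: y_row_ge.
case: (ltnP c (l p)) => [cp|cp]; last by rewrite y_large // cp.
rewrite diag_step //; [|lia|].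
  by apply: IH; lia.
by apply: leq_trans (l_mono qp pn) (leq_addl _ _).
Qed.

(** [diag_step] is used backwards, up the diagonal to row 0, where [Ytop] applies. *)
Lemma y_upper p q c : (p <= q)%N -> (q < n)%N -> y p q c = 0.
Proof.
elim: p q c => [|p IH] [|q] c //; try by move=> *; rewrite /y big1 // => k /and3P[/eqP/Ytop].
move=> pq qn; case: (ltnP c (l q.+1)) => [cq|cq]; last by rewrite y_large // cq orbT.
have lqp : (l q.+1 <= l p)%N by apply: l_mono => //; lia.
have := @diag_step p q (c + l p - l q.+1).
have -> : (c + l p - l q.+1 + l q.+1 - l p = c)%N by lia.
move=> <-; try lia.
by apply: IH => //; lia.
Qed.

Lemma gradient_zero k : Y k = 0.
Proof.
have [rn cn lo dl] := tri_valid k.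
have : y (trow k) (tcol k) (l (tcol k) - (tdeg k).+1) = 0.
  by case: (leqP (trow k) (tcol k)) => H; [apply: y_upper | apply: y_lower].
rewrite /y (big_pred1 k) // => k'; apply/and3P/eqP => [[/eqP Er /eqP Ec /eqP Ed]|->].
  by apply: tri_inj => //; lia.
by split=> //; lia.
Qed.

End Gradient.

(* By induction on the order, all iterated derivatives of f vanish on the slice: their
   gradients are killed both along the slice and along the coadjoint orbits. *)
Lemma vanish_on_slice f : (forall k, ad (bas F k) f = 0) -> f \mPo slice = 0 -> f = 0.
Proof.
move=> fI f0.
have van d (s : seq 'I_m) : size s = d -> iter_deriv f s \mPo slice = 0.
  elim: d s => [|d IH] [|k s] //= [ss]; set h := iter_deriv f s.
  apply: (gradient_zero (Y := fun k => h^`M(k) \mPo slice)) => {}k.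
    move=> r0; have [rn cn lo dl] := tri_valid k.
    have cn' : (tcol k < size lamd)%N by rewrite size_sorted_parts.
    have [t [rt ct]] := box_exists cn' dl.
    have tN : (t < N)%N := leq_trans (ltn_ord t) (eq_leq (sumn_sorted_parts lam)).
    pose t' : 'I_N := Ordinal tN.
    (* Coordinate [k] of the slice is the variable [t'], and no other coordinate involves it. By the
       chain rule this derivative of [h] is taken along the slice, where [h] vanishes. *)
    have := mderiv_comp slice t' h; rewrite IH // mderiv0 (bigD1 k) //= big1 => [|k' kk'].
      rewrite tnth_mktuple /slice_fun r0 eqxx -rt -ct -[val t]/(val t').
      rewrite box_varE mderivX mnm1E eqxx scale1r.
      have -> : (U_(t') - U_(t') = 0 :> 'X_{1..N})%MM.
        by apply/mnmP => i; rewrite mnmBE subnn mnm0E.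
      by rewrite mpolyX0 mulr1 addr0 => /esym.
    rewrite tnth_mktuple /slice_fun; case: eqP => [r0'|_]; last first.
      by rewrite -mpolyC_nat mderivC mulr0.
    have [rn' cn2 lo' dl'] := tri_valid k'.
    have cn2' : (tcol k' < size lamd)%N by rewrite size_sorted_parts.
    have [u [ru cu]] := box_exists cn2' dl'.
    have uN : (u < N)%N := leq_trans (ltn_ord u) (eq_leq (sumn_sorted_parts lam)).
    rewrite -ru -cu -[nat_of_ord u]/(nat_of_ord (Ordinal uN)) box_varE mderivX mnm1E.
    case: eqP => [E|]; last by rewrite scale0r mulr0.
    have Eu : nat_of_ord u = t by have /(congr1 val) := E.
    case/eqP: kk'; apply: tri_inj; rewrite ?r0 ?r0' // -?ru -?cu -?rt -?ct Eu //.
  (* [ad] applied to [h] combines derivatives of order [d], which vanish on the slice by induction;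
     this is the orbit condition [Yad]. *)
  have := deriv_span_ad s (fI k).
  have sp g : deriv_span f (size s) g -> g \mPo slice = 0.
    elim=> [|c s' {}g ss' _ Eg]; first exact: comp_mpoly0.
    by rewrite comp_mpolyD comp_mpolyZ IH ?Eg ?scaler0 ?addr0 // ss'.
  move/sp; rewrite /ad /deriv_of raddf_sum /= => E.
  by rewrite -[RHS]E; apply: eq_bigr => k' _; rewrite rmorphM.
apply: (@deriv_closed_zero F m (fun p => forall s, iter_deriv p s \mPo slice = 0)) => //.
- move=> p k H s; have := H (rcons s k).
  by rewrite /iter_deriv -cats1 foldr_cat.
- by move=> c /(_ [::]); rewrite /= comp_mpolyC => /eqP; rewrite mpolyC_eq0 => /eqP.
- by move=> s; apply: (van (size s)).
Qed.

End Vanishing.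

Theorem mainTheorem1 (F : closedFieldType) (HF : [pchar F] =i pred0)
  (lam : seq nat) (Hpos : all (fun x => 0 < x)%N lam)
  (Hmono : sorted geq lam \/ sorted leq lam)
  (A : algType F) (iu : 'M[F]_(sumn lam) -> A)
  (HU : is_UEA (centralizer (jordan_nil F lam)) iu) :
  let z := fun r : 'I_(sumn lam) => zgen iu r.+1 in
  [/\ forall r, in_center (z r),
      injective (@zeval F _ A z)
    & forall a : A, in_center a -> exists p : {mpoly F[sumn lam]}, @zeval F _ A z p = a].
Proof.
move=> z; have RN (r : 'I_(sumn lam)) : (0 < r.+1 <= sumn lam)%N by rewrite ltn_ord.
have Pspan := @centralizer_span F lam Hpos.
have zx r := symb_zgen Hpos Hmono HU (RN r).
have xv r := xgen_slice F Hpos Hmono r.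
(* The sign of a companion determinant whose size is the degree of z_(r+1). *)
have eps0 (r : 'I_(sumn lam)) : (-1 : F) ^+ brow (sorted_parts lam) r != 0.
  by rewrite signr_eq0.
have zC r : in_center (z r) by exact: zgen_central HU HF Hpos Hmono _ (RN r).
split=> // [p q|a].
  exact: (zeval_inj (@cobL F lam) (@bas_centralizer F lam) Pspan (cob_bas F Hpos)
    (@centralizerM F lam) (@centralizer1 F lam) HU HF zx eps0 xv).
exact: (center_zeval (@cobL F lam) (@bas_centralizer F lam) Pspan (cob_bas F Hpos)
  (@centralizerM F lam) (@centralizer1 F lam) (@centralizerL F lam) HU HF zC zx eps0 xv
  (vanish_on_slice HF Hpos Hmono)).
Qed.
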